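(* Let $d\ge3$. There exist positive constants $\gamma\in(0,\tfrac1{10})$, $c_1$, $c_2<\tfrac{\gamma}{2}$, $c_3$, $c_4$, $s_0$, depending only on $d$, such that for any $s\ge s_0$ and any set $A\subset\mathbb{Z}^d$ such that $\mathbb{Z}^d\setminus B(A,s)$ is nonempty, there is a set $A^{(s)}\subset\mathbb{Z}^d$ with the following properties: (a) $A\subseteq A^{(s)}\subseteq B\big(A,\tfrac s5\big)$; (b) for any $y\in\partial A^{(s)}$, $$\sup_{x\in\mathbb{Z}^d:\ \|x-y\|\ge\gamma s/2}P_x[X_{H_{A^{(s)}}}=y]\le c_1s^{-(d-1)};$$ (c) for any $y\in\partial A^{(s)}$ there exists a ball $\bar B_y$ of radius $\gamma s$ such that its distance to $y$ lies in $[\gamma s,2\gamma s]$ and $$\inf_{x\in\bar B_y}P_x\big[X_{H_{A^{(s)}}}=y,\ H_{A^{(s)}}<H_{\mathbb{Z}^d\setminus B(y,4\gamma s)}\big]\ge c_1^{-1}s^{-(d-1)};$$ (d) for any $y\in\partial A^{(s)}$, $\ |\{z\in\partial A^{(s)}:\|y-z\|\le c_2s\}|\ge c_3s^{d-1}$; (e) for any $y,y'\in\partial A^{(s)}$ with $\|y-y'\|\le c_2s$ there exists a set $\hat D$ (depending on $y,y'$) that separates $\{y,y'\}$ from $\partial B(y,\gamma s)$ (i.e., any nearest-neighbor path starting at $\partial B(y,\gamma s)$ that enters $A^{(s)}$ at $\{y,y'\}$ must pass through $\hat D$) such that $$\sup_{\substack{x\in\hat D:\\ P_x[X_{H_{A^{(s)}}}=y']>0}}\frac{P_x[X_{H_{A^{(s)}}}=y]}{P_x\big[X_{H_{A^{(s)}}}=y',\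 H_{A^{(s)}}<H_{\mathbb{Z}^d\setminus B(y',5\gamma s)}\big]}\le c_4.$$
   Context: $\|\cdot\|$ is the Euclidean norm; $B(x,\rho)=\{y\in\mathbb{Z}^d:\|x-y\|\le\rho\}$ and $B(A,\rho)=\bigcup_{x\in A}B(x,\rho)$. Neighbors in $\mathbb{Z}^d$ are points at Euclidean distance $1$; $\partial K=\{x\in K:x\text{ has a neighbor in }K^c\}$ is the internal boundary. $P_x$ is the law of simple random walk $(X_n)_{n\ge0}$ on $\mathbb{Z}^d$ from $x$, and $H_K=\inf\{k\ge0:X_k\in K\}$ is the entrance time of $K$; the event $\{X_{H_K}=y\}$ includes $H_K<\infty$. *)

(* Defs.v *)
From HB Require Import structures.
From mathcomp Require Import all_boot all_order all_algebra.
From mathcomp Require Import all_classical all_reals all_analysis.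

Set Implicit Arguments.
Unset Strict Implicit.
Unset Printing Implicit Defensive.

Import Order.TTheory GRing.Theory Num.Theory.

Local Open Scope classical_set_scope.
Local Open Scope ring_scope.

HB.instance Definition _ := isPointed.Build int 0.

Notation Zd d := 'rV[int]_d.

Definition enorm (R : realType) (d : nat) (x : Zd d) : R :=
  Num.sqrt (\sum_(i < d) ((x 0 i)%:~R) ^+ 2).

Definition zball (R : realType) (d : nat) (x : Zd d) (rho : R) : set (Zd d) :=
  [set y | enorm R (x - y) <= rho].

Definition zballs (R : realType) (d : nat) (A : set (Zd d)) (rho : R) :
  set (Zd d) := \bigcup_(x in A) zball x rho.

Definition zdist (R : realType) (d : nat) (y : Zd d) (B : set (Zd d)) : R :=
  inf [set enorm R (y - z) | z in B].

Definition neighbor (R : realType) (d : nat) (x y : Zd d) : Prop :=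
  enorm R (x - y) = 1.

Definition int_boundary (R : realType) (d : nat) (K : set (Zd d)) :
  set (Zd d) := [set x | K x /\ exists2 y, neighbor R x y & ~ K y].

Definition coord_events (d : nat) : set (set (nat -> Zd d)) :=
  [set C | exists (n : nat) (z : Zd d), C = [set w : nat -> Zd d | w n = z]].

Notation path_space d := (g_sigma_algebraType (@coord_events d)).

(* The random walk is realized on the real line equipped with the uniform law
   on [0, 1]: the digits of omega in base 2d are independent and uniform, and
   the n-th digit selects the n-th step. *)
Definition digit (R : realType) (b n : nat) (omega : R) : nat :=
  (Num.truncn (b%:R ^+ n.+1 * omega) %% b)%N.

(* for j < 2d, j = 2i stands for e_i and j = 2i + 1 for - e_i *)
Definition unit_step (d j : nat) : Zd d :=
  \row_(i < d) (if (i == j./2 :> nat)%N then (-1) ^+ j else 0).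

Definition walk (R : realType) (d : nat) (x : Zd d) (omega : R) :
  path_space d :=
  fun n => x + \sum_(k < n) unit_step d (digit d.*2 k omega).

Section walk_measurable.
Context {R : realType}.

Lemma measurable_fiber_comp (T : countType) (U : Type) (f : R -> T)
    (h : T -> U) (u : U) :
  (forall t, measurable [set a | f a = t]) ->
  measurable [set a | h (f a) = u].
Proof.
move=> mf.
have -> : [set a | h (f a) = u] =
    \bigcup_(t in [set t | h t = u]) [set a | f a = t].
  by apply/seteqP; split=> [a /= <-|a [t /= <- <-]//]; exists (f a).
rewrite bigcup_mkcond; apply: countable_bigcupT_measurable => // t.
by case: ifP.
Qed.

Lemma measurable_fiber_pair (T U : countType) (f : R -> T) (g : R -> U) :
  (forall t, measurable [set a | f a = t]) ->
  (forall u, measurable [set a | g a = u]) ->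
  forall p, measurable [set a | (f a, g a) = p].
Proof.
move=> mf mg [t u].
have -> : [set a | (f a, g a) = (t, u)] =
    [set a | f a = t] `&` [set a | g a = u].
  by apply/seteqP; split=> a /= [-> ->].
exact: measurableI.
Qed.

Lemma truncn_fiber (c : R) (m : nat) : 0 < c ->
  [set a : R | Num.truncn (c * a) = m.+1] =
  `[m.+1%:R / c, m.+2%:R / c[%classic.
Proof.
move=> c0; apply/seteqP; split=> a /=; rewrite in_itv/= ler_pdivrMr// ltr_pdivlMr//.
  move=> tm; rewrite mulrC -tm; apply: truncn_itv.
  by rewrite ltW// (lt_le_trans ltr01)// -truncn_gt0 tm.
by rewrite mulrC; exact: truncn_def.
Qed.

Lemma measurable_truncn (c : R) (m : nat) : 0 <= c ->
  measurable [set a : R | Num.truncn (c * a) = m].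
Proof.
rewrite le0r => /predU1P[->|c0].
  have [->|m0] := eqVneq m 0%N.
    rewrite [X in measurable X](_ : _ = setT)//.
    by apply/seteqP; split=> a //= _; rewrite mul0r truncn0.
  rewrite [X in measurable X](_ : _ = set0)//.
  by apply/seteqP; split=> a //=; rewrite mul0r truncn0 => /esym/eqP; rewrite (negbTE m0).
case: m => [|m]; last by rewrite truncn_fiber//; exact: measurable_itv.
rewrite [X in measurable X](_ : _ = `]-oo, c^-1[%classic)//.
apply/seteqP; split=> a /=; rewrite in_itv/= -[c^-1]div1r ltr_pdivlMr// mulrC ltNge -truncn_gt0.
  by move=> ->.
by case: (Num.truncn _).
Qed.

Lemma measurable_walk_fiber (d : nat) (x : Zd d) (n : nat) (z : Zd d) :
  measurable [set a : R | walk x a n = z].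
Proof.
elim: n z => [|n IH] z.
  have -> : [set a : R | walk x a 0 = z] = [set _ | x = z].
    by apply/seteqP; split=> a /=; rewrite /walk big_ord0 addr0.
  by have [xz|xz] := pselect (x = z);
    [rewrite (_ : [set _ | _] = setT)|rewrite (_ : [set _ | _] = set0)] => //;
    apply/seteqP; split.
have -> : [set a : R | walk x a n.+1 = z] =
  [set a | (fun p : Zd d * nat => p.1 + unit_step d p.2)
             (walk x a n, digit d.*2 n a) = z].
  by apply/seteqP; split=> a /=; rewrite /walk big_ord_recr/= addrA.
apply: (@measurable_fiber_comp (Zd d * nat)%type _
  (fun a => (walk x a n, digit d.*2 n a))
  (fun p => p.1 + unit_step d p.2)) => p.
apply: measurable_fiber_pair => // j.
apply: (@measurable_fiber_comp nat _
  (fun a => Num.truncn (d.*2%:R ^+ n.+1 * a)) (modn^~ d.*2)) => m.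
by apply: measurable_truncn; rewrite exprn_ge0.
Qed.

Lemma measurable_walk (d : nat) (x : Zd d) :
  measurable_fun [set: measurableTypeR R] (@walk R d x).
Proof.
apply: (@measurability _ _ (measurableTypeR R) (path_space d) setT _ (@coord_events d)) => // _ [_ [n [z ->]] <-].
rewrite setTI; exact: measurable_walk_fiber.
Qed.

Definition walk_mfun (d : nat) (x : Zd d) :
    {mfun measurableTypeR R >-> path_space d} :=
  @mfun_Sub _ _ (measurableTypeR R) (path_space d) _
    (mem_set (measurable_walk x)).

End walk_measurable.

Definition srw (R : realType) (d : nat) (x : Zd d) :
    probability (path_space d) R :=
  distribution (uniform_prob (@ltr01 R)) (walk_mfun x).

Lemma srwE (R : realType) (d : nat) (x : Zd d) (E : set (nat -> Zd d)) :
  srw R x E = uniform_prob (@ltr01 R) [set omega | E (walk x omega)].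
Proof. by []. Qed.

Section srw_law.
Context {R : realType}.

Lemma truncn_digit (b n : nat) (a : R) : (0 < b)%N -> 0 <= a ->
  Num.truncn (b%:R ^+ n.+1 * a) =
  (Num.truncn (b%:R ^+ n * a) * b + digit b n a)%N.
Proof.
move=> b0 a0; rewrite /digit [LHS](divn_eq _ b); congr (_ * _ + _)%N.
apply/eqP; rewrite eqn_leq leq_divRL// -ltnS ltn_divLR//.
have ? : 0 <= b%:R ^+ n * a by rewrite mulr_ge0// exprn_ge0.
have ? : 0 <= b%:R ^+ n.+1 * a by rewrite mulr_ge0// exprn_ge0.
have /andP[t1 t2] : (Num.truncn (b%:R ^+ n * a))%:R <= b%:R ^+ n * a <
  (Num.truncn (b%:R ^+ n * a)).+1%:R by exact: truncn_itv.
rewrite truncn_lt_nat// truncn_ge_nat// !natrM exprS -mulrA.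
by rewrite ![_ * b%:R]mulrC ltr_pM2l ?ltr0n// ler_pM2l ?ltr0n// t1 t2.
Qed.

Fixpoint digits_val (b : nat) (c : nat -> nat) (n : nat) : nat :=
  if n is m.+1 then (digits_val b c m * b + c m)%N else 0%N.

Lemma digits_val_lt (b : nat) (c : nat -> nat) (n : nat) :
  (forall k, (k < n)%N -> (c k < b)%N) -> (digits_val b c n < b ^ n)%N.
Proof.
elim: n => [//|n IH] cb /=.
have b0 : (0 < b)%N by rewrite (leq_ltn_trans _ (cb n _)).
have cn := cb n (ltnSn n).
have /(leq_mul (leqnn b)) : (digits_val b c n < b ^ n)%N.
  by apply: IH => k kn; apply: cb; rewrite ltnS ltnW.
rewrite expnS; apply: leq_trans.
by rewrite mulnS addnC mulnC ltn_add2r.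
Qed.

Lemma digitsP (b n : nat) (c : nat -> nat) (a : R) :
  (forall k, (k < n)%N -> (c k < b)%N) -> 0 <= a < 1 ->
  (forall k, (k < n)%N -> digit b k a = c k) <->
  Num.truncn (b%:R ^+ n * a) = digits_val b c n.
Proof.
move=> + /andP[a0 a1]; elim: n => [|n IH] cb.
  split=> // _; rewrite expr0 mul1r /=; apply/eqP.
  by rewrite truncn_eq// a0.
have b0 : (0 < b)%N by rewrite (leq_ltn_trans _ (cb n _)).
have {}IH := IH (fun k kn => cb k (ltnW kn)).
rewrite truncn_digit//=; split=> [dc|tE].
  rewrite dc//; congr (_ * _ + _)%N; apply/IH => k kn.
  by apply: dc; rewrite ltnS ltnW.
have dn : digit b n a = c n.
  have := congr1 (modn^~ b) tE.
  by rewrite !modnMDl (modn_small (cb _ (ltnSn n))) /digit modn_mod.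
move: tE; rewrite dn => /addIn/eqP; rewrite eqn_pmul2r// => /eqP/IH dk k.
by rewrite ltnS leq_eqVlt => /predU1P[->//|]; exact: dk.
Qed.

Lemma uniform_prob_digits (b n : nat) (c : nat -> nat) (U : set R) :
  (0 < b)%N -> (forall k, (k < n)%N -> (c k < b)%N) ->
  measurable U ->
  (forall a : R, 0 <= a < 1 -> U a <-> forall k, (k < n)%N -> digit b k a = c k) ->
  uniform_prob (@ltr01 R) U = (b%:R ^- n)%:E.
Proof.
move=> b0 cb mU UE; pose N := digits_val b c n.
have bn0 : (0 : R) < b%:R ^+ n by rewrite exprn_gt0// ltr0n.
have Nbn : (N.+1%:R : R) <= b%:R ^+ n by rewrite -natrX ler_nat digits_val_lt.
pose I := `[N%:R / b%:R ^+ n, N.+1%:R / b%:R ^+ n[%classic : set R.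
have IE : U `&` `[0, 1]%classic = I `|` (U `&` [set 1]).
  have in01 (a : R) : I a -> 0 <= a < 1.
    rewrite /I/= in_itv/= => /andP[h1 h2]; apply/andP; split.
      by apply: le_trans h1; rewrite divr_ge0// ltW.
    by apply: lt_le_trans h2 _; rewrite ler_pdivrMr// mul1r.
  have UI (a : R) : 0 <= a < 1 -> U a <-> I a.
    move=> a01; rewrite UE// digitsP// /I/= in_itv/= ler_pdivrMr// ltr_pdivlMr//.
    rewrite [a * _]mulrC; have ? : 0 <= b%:R ^+ n * a.
      by rewrite mulr_ge0 ?(ltW bn0)//; case/andP: a01.
    by rewrite -truncn_eq//; split=> /eqP.
  apply/seteqP; split=> a /=.
    rewrite in_itv/= => -[Ua /andP[a0]]; rewrite le_eqVlt => /predU1P[a1|a1].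
      by right; split.
    by left; apply/UI => //; rewrite a0.
  move=> [Ia|[Ua a1]]; last by rewrite in_itv/= a1 ler01 lexx -a1.
  have /andP[a0 a1] := in01 _ Ia.
  split; first by apply/UI => //; rewrite a0.
  by rewrite in_itv/= a0 ltW.
rewrite /uniform_prob integral_uniform_pdf IE.
rewrite (eq_integral (fun=> 1%:E)); last first.
  move=> a; rewrite -IE inE => -[_] /=; rewrite in_itv/= /uniform_pdf => ->.
  by rewrite subr0 invr1.
have mU1 : measurable (U `&` [set 1]) by exact: measurableI.
rewrite integral_cst//; last by apply: measurableU => //; exact: measurable_itv.
rewrite mul1e measureU0//.
- rewrite /I/= lebesgue_measure_itv/= lte_fin ltr_pM2r ?invr_gt0// ltr_nat ltnSn.
  by rewrite -EFinD -mulrBl -natrB// subSnn mul1r.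
- exact: measurable_itv.
- apply/eqP; rewrite eq_le measure_ge0 andbT -(lebesgue_measure_set1 (1 : R)).
  by apply: le_measure; rewrite ?inE//; exact: measurable_set1.
Qed.

Lemma unit_step_inj (d i j : nat) : (i < d.*2)%N -> (j < d.*2)%N ->
  unit_step d i = unit_step d j -> i = j.
Proof.
move=> id jd ij.
have i2 : (i./2 < d)%N by rewrite ltn_half_double.
have := congr1 (fun v : 'rV_d => v 0 (Ordinal i2)) ij; rewrite !mxE/= eqxx.
case: eqP => [h|_] /eqP; last by rewrite signr_eq0.
rewrite -[in X in X == _]signr_odd -[in X in _ == X]signr_odd => s.
rewrite -(odd_double_half i) -(odd_double_half j) h; congr (nat_of_bool _ + _)%N.
by move: s; case: (odd i); case: (odd j).
Qed.

Lemma neighbor_unit_step (d : nat) (x y : Zd d) : neighbor R x y ->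
  exists2 j, (j < d.*2)%N & y = x + unit_step d j.
Proof.
rewrite /neighbor /enorm => xy.
have : \sum_(i < d) ((x - y) 0 i) ^+ 2 = 1 :> int.
  apply: (@intr_inj R); rewrite rmorph1 raddf_sum/=.
  under eq_bigr do rewrite rmorphXn/=.
  move: xy => /(congr1 (fun u => u ^+ 2)); rewrite expr1n sqr_sqrtr//.
  by apply: sumr_ge0 => i _; rewrite sqr_ge0.
set v := x - y => v1.
have -> : y = x - v by rewrite /v opprB addrC subrK.
clearbody v.
have [i vi] : exists i, v 0 i != 0.
  apply/existsP; apply: contraT => /existsPn/= v0.
  move: v1; rewrite big1// => i _.
  by move: (v0 i); rewrite negbK => /eqP ->; rewrite expr0n.
have sq1 : 1 <= v 0 i ^+ 2.
  by rewrite -gtz0_ge1 lt_def sqrf_eq0 vi sqr_ge0.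
have rest0 : \sum_(k < d | k != i) (v 0 k) ^+ 2 >= 0.
  by apply: sumr_ge0 => k _; rewrite sqr_ge0.
move: v1; rewrite (bigD1 i)//= => v1.
have vi1 : v 0 i ^+ 2 = 1.
  by apply/eqP; rewrite eq_le sq1 andbT -[leRHS]v1 lerDl.
have vk k : k != i -> v 0 k = 0.
  move=> ki; have : \sum_(k < d | k != i) (v 0 k) ^+ 2 = 0.
    by apply: (@addrI _ (1 : int)); rewrite addr0 -[in LHS]vi1.
  move/eqP; rewrite psumr_eq0; last by move=> *; rewrite sqr_ge0.
  move=> /allP/(_ k); rewrite mem_index_enum ki sqrf_eq0 => /(_ isT)/eqP.
  exact.
pose s := (v 0 i == 1).
exists (s + i.*2)%N.
  rewrite -ltn_half_double half_bit_double.
  exact: ltn_ord.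
congr (_ + _); apply/rowP => k; rewrite !mxE half_bit_double.
case: ifPn => [/eqP/val_inj ->|ki]; last by rewrite vk ?oppr0.
rewrite -signr_odd oddD odd_double addbF oddb /s.
move/eqP: vi1; rewrite sqrf_eq1 => /predU1P[->//|/eqP ->].
by rewrite opprK.
Qed.

Lemma srw_cylinder (d n : nat) (p : nat -> Zd d) : (0 < d)%N ->
  (forall k, (k < n)%N -> neighbor R (p k) (p k.+1)) ->
  srw R (p 0%N) [set w | forall k, (k <= n)%N -> w k = p k] =
  (d.*2%:R ^- n)%:E.
Proof.
move=> d0 pn; rewrite srwE.
have /choice[c pc] (k : nat) : exists j, (k < n)%N ->
    (j < d.*2)%N /\ p k.+1 = p k + unit_step d j.
  have [kn|nk] := boolP (k < n)%N; last by exists 0%N.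
  by have [j jd pj] := neighbor_unit_step (pn _ kn); exists j.
apply: (@uniform_prob_digits _ _ c).
- by rewrite double_gt0.
- by move=> k /pc[].
- rewrite [X in measurable X](_ : _ = \bigcap_(k in [set k | (k <= n)%N])
      [set a : R | walk (p 0%N) a k = p k])//.
  apply: bigcap_measurable => [|k _]; first by exists 0%N.
  exact: measurable_walk_fiber.
move=> a _ /=; rewrite /walk; split=> [wp k kn|dc].
  have [cd pk] := pc _ kn; apply: (@unit_step_inj d) => //.
    by rewrite ltn_mod double_gt0.
  have := wp _ kn; rewrite big_ord_recr/= addrA (wp _ (ltnW kn)) pk.
  exact: addrI.
elim=> [|k IH] kn; first by rewrite big_ord0 addr0.
by rewrite big_ord_recr/= addrA IH ?(ltnW kn)// dc// (pc _ kn).2.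
Qed.

End srw_law.

Definition entrance_time (R : realType) (d : nat) (K : set (Zd d))
    (w : nat -> Zd d) : \bar R :=
  ereal_inf [set k%:R%:E | k in [set k : nat | K (w k)]].

Definition enters_at (R : realType) (d : nat) (K : set (Zd d)) (y : Zd d) :
    set (nat -> Zd d) :=
  [set w | exists2 n : nat, entrance_time R K w = n%:R%:E & w n = y].

Definition enters_before (R : realType) (d : nat) (K L : set (Zd d)) :
    set (nat -> Zd d) :=
  [set w | (entrance_time R K w < entrance_time R L w)%E].

(* Nearest-neighbor paths from S that enter K at a point of T visit D, strictly
   before entering K: were the entrance point itself allowed as the visit to D,
   D := T would always separate. *)
Definition separates (R : realType) (d : nat) (K D T S : set (Zd d)) : Prop :=
  forall (w : nat -> Zd d) (n : nat),
    S (w 0%N) ->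
    (forall k, (k < n)%N -> neighbor R (w k) (w k.+1)) ->
    (forall k, (k < n)%N -> ~ K (w k)) ->
    K (w n) -> T (w n) ->
    exists2 k, (k < n)%N & D (w k).

(* Main.v *)
Require Import Defs.
From HB Require Import structures.
From mathcomp Require Import all_boot all_order all_algebra finmap.
From mathcomp Require Import all_classical all_reals all_analysis.
From mathcomp Require Import ring lra zify.

(** The harmonic measure of a set at a boundary point has the order s^(1-d) of
    surface measure as soon as the boundary is smooth at scale s. So A is
    enlarged to a set {delta <= 0}, where delta imitates the signed distance
    to a smooth hypersurface. Only three properties of such a profile at scale
    sigma are used: steps change it by at most 1, its second differences are
    at most 1 / sigma, and in a strip around its zero level some step
    increases it by at least a fixed a > 0. Here sigma is a small multiple of
    s, and a depends on d only.

    Profiles exist around every set ([exists_profile]). Mark the cells of side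
    r, of order s, that are near A; interpolate the indicator linearly on the
    Kuhn triangulation of r Z^d, and average over a cube whose side rho is a
    small fraction of r. One average over a window bounds the second
    differences of a Lipschitz function. That the level 1 / 2 is nondegenerate
    is usually a matter of Sard's theorem; here it follows from the vertex
    values being 0 and 1. At a point where the interpolation is strictly
    between them, the Kuhn simplex has vertices of both kinds, and along the
    edge that joins them the slope is exactly 1 / r
    ([kuhn_edge_increment]). The same edge can be used at all points of the
    averaging window ([kuhn_stable_vertex]), so the slope survives.

    Potential theory starts from the Green functions of the walk killed
    outside a domain Om. The function (|z|^2 + M)^(1 - d/2) is superharmonic,
    whence G(z, x) <= C |z - x|^(2-d) for every Om ([green_upper]); a
    subharmonic companion gives the matching lower bound in balls
    ([green_ball_lower]), and chains of balls carry it further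
    ([superharmonic_chain]). By reversibility, the probability that the walk
    from x leaves Om at y is the average of G(., x) over the neighbours of y
    ([srw_passage]). So it remains to describe G(., x) near a boundary point.
    The barriers delta -/+ (kappa / l) delta^2 +/- |z - x0|^2 / l are super- and
    subharmonic close to the boundary, since the quadratic term beats the
    curvature 1 / sigma. By the maximum principle a positive function that is
    harmonic in the domain and vanishes outside grows linearly: at height h it
    is of order (1 + h) / l times its size at distance l ([escape_upper],
    [escape_lower]).

    (b) and (c): next to y the height is of order 1, so the Green function,
    of order s^(2-d) at distance s, contributes s^(2-d) / s ([hit_upper],
    [hit_lower]). For the ball in (c), the gradient of delta points to an
    exterior ball at height of order s ([exterior_ball]).
    (d): every line that starts near y in the direction of the increasing
    step crosses the zero level, and there are of order s^(d-1) such lines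
    ([boundary_count]).
    (e): with l the distance of y and y', the part outside the enlargement of
    the sphere of radius 4 l around y separates. There the linear growth, used
    at x as well as at y and y', shows that both hitting probabilities are of
    order (1 + delta x) l^(-d) up to constants, as long as delta x is at most
    of order l; hence their ratio is bounded ([srw_hit_ratio]). *)

Set Implicit Arguments.
Unset Strict Implicit.
Unset Printing Implicit Defensive.

Import Order.TTheory GRing.Theory Num.Theory.

Local Open Scope classical_set_scope.
Local Open Scope ring_scope.

(** * Lattice points, norms and nearest-neighbour steps *)

Section Coordinates.
Context {d : nat}.
Implicit Types (x y : Zd d) (i : 'I_d).

(** The same as mxE, with the ring operations of int in head position. *)
Lemma coordD x y i : (x + y) 0 i = x 0 i + y 0 i.
Proof. by rewrite mxE. Qed.

Lemma coordN x i : (- x) 0 i = - x 0 i.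
Proof. by rewrite mxE. Qed.

Lemma coordB x y i : (x - y) 0 i = x 0 i - y 0 i.
Proof. by rewrite !mxE. Qed.

End Coordinates.

Section EuclideanNorm.
Context {R : realType} {d : nat}.
Implicit Types (a b : 'I_d -> R) (c : R) (x y z v : Zd d).

(** Gradients are real vectors, so the norm is needed beyond lattice points;
    enorm is the case of toR x. *)
Definition vnorm a : R := Num.sqrt (\sum_i a i ^+ 2).

Lemma sumsq_ge0 a : 0 <= \sum_i a i ^+ 2.
Proof. by apply: sumr_ge0 => i _; rewrite sqr_ge0. Qed.

Lemma vnorm_ge0 a : 0 <= vnorm a. Proof. exact: sqrtr_ge0. Qed.

Lemma sqr_vnorm a : vnorm a ^+ 2 = \sum_i a i ^+ 2.
Proof. by rewrite sqr_sqrtr// sumsq_ge0. Qed.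

Lemma vnorm_eq a b : a =1 b -> vnorm a = vnorm b.
Proof. by move=> ab; rewrite /vnorm; under eq_bigr do rewrite ab. Qed.

Lemma vnorm_le a c : 0 <= c -> \sum_i a i ^+ 2 <= c ^+ 2 -> vnorm a <= c.
Proof.
move=> c0 h; rewrite /vnorm -[leRHS]ger0_norm// -[leRHS]sqrtr_sqr.
exact: ler_wsqrtr.
Qed.

Lemma vnorm0_coord a i : vnorm a = 0 -> a i = 0.
Proof.
move=> a0; have := sqr_vnorm a; rewrite a0 expr0n/= => /esym/eqP.
rewrite psumr_eq0; last by move=> *; rewrite sqr_ge0.
by move=> /allP/(_ i); rewrite mem_index_enum sqrf_eq0 => /(_ isT)/eqP.
Qed.

(** Expand the sum of the squares of |b| a_i - |a| b_i. *)
Lemma cauchy_schwarz a b : \sum_i a i * b i <= vnorm a * vnorm b.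
Proof.
have [a0|a0] := eqVneq (vnorm a) 0.
  by rewrite a0 mul0r big1// => i _; rewrite (vnorm0_coord i a0) mul0r.
have [b0|b0] := eqVneq (vnorm b) 0.
  by rewrite b0 mulr0 big1// => i _; rewrite (vnorm0_coord i b0) mulr0.
have pa : 0 < vnorm a by rewrite lt_def a0 vnorm_ge0.
have pb : 0 < vnorm b by rewrite lt_def b0 vnorm_ge0.
have : 0 <= \sum_i (vnorm b * a i - vnorm a * b i) ^+ 2.
  exact: (sumsq_ge0 (fun i => vnorm b * a i - vnorm a * b i)).
have -> : \sum_i (vnorm b * a i - vnorm a * b i) ^+ 2 =
   2 * (vnorm a * vnorm b) * (vnorm a * vnorm b - \sum_i a i * b i).
  transitivity (\sum_i (vnorm b ^+ 2 * a i ^+ 2 + (vnorm a ^+ 2 * b i ^+ 2 +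
      (- (2 * vnorm a * vnorm b)) * (a i * b i)))).
    by apply: eq_bigr => i _; ring.
  rewrite !big_split/= -!mulr_sumr -!sqr_vnorm; ring.
rewrite pmulr_rge0 ?subr_ge0//.
by rewrite mulr_gt0// mulr_gt0.
Qed.

Lemma vnormD a b : vnorm (fun i => a i + b i) <= vnorm a + vnorm b.
Proof.
apply: vnorm_le; first by rewrite addr_ge0// vnorm_ge0.
have -> : \sum_i (a i + b i) ^+ 2 =
   \sum_i a i ^+ 2 + (\sum_i b i ^+ 2 + 2 * \sum_i a i * b i).
  rewrite mulr_sumr -!big_split/=; apply: eq_bigr => i _; ring.
rewrite -!sqr_vnorm; have := cauchy_schwarz a b; nra.
Qed.

Lemma vnormZ (c : R) a : vnorm (fun i => c * a i) = `|c| * vnorm a.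
Proof.
rewrite /vnorm -sqrtr_sqr -sqrtrM ?sqr_ge0//; congr Num.sqrt.
by rewrite mulr_sumr; apply: eq_bigr => i _; rewrite exprMn.
Qed.

Lemma ler_coord_vnorm a i : `|a i| <= vnorm a.
Proof.
rewrite -sqrtr_sqr; apply: ler_wsqrtr.
by rewrite (bigD1 i)//= lerDl sumr_ge0// => j _; rewrite sqr_ge0.
Qed.

(** It loses a factor sqrt d, which is harmless: it is applied to rounding
    errors only. *)
Lemma vnorm_sup a c : (forall i, `|a i| <= c) -> 0 <= c -> vnorm a <= d%:R * c.
Proof.
move=> ac c0; apply: vnorm_le; first by rewrite mulr_ge0.
apply: (@le_trans _ _ (\sum_(i < d) c ^+ 2)).
  by apply: ler_sum => i _; rewrite -real_normK ?num_real// lerXn2r ?nnegrE.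
rewrite sumr_const card_ord -[leLHS]mulr_natl exprMn; apply: ler_wpM2r; first exact: sqr_ge0.
rewrite -natrX ler_nat; case: d => // n; rewrite expnS expn1; lia.
Qed.

Definition toR x : 'I_d -> R := fun i => (x 0 i)%:~R.

Lemma enormE x : enorm R x = vnorm (toR x). Proof. by []. Qed.

Definition nsq x : R := \sum_(i < d) ((x 0 i)%:~R) ^+ 2.

Lemma enorm_ge0 x : 0 <= enorm R x. Proof. exact: vnorm_ge0. Qed.

Lemma sqr_enorm x : enorm R x ^+ 2 = nsq x. Proof. exact: sqr_vnorm. Qed.

Lemma nsq_ge0 x : 0 <= nsq x. Proof. exact: (sumsq_ge0 (toR x)). Qed.

Lemma enormD x y : enorm R (x + y) <= enorm R x + enorm R y.
Proof.
rewrite !enormE; apply: le_trans (vnormD _ _); rewrite le_eqVlt; apply/orP; left.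
by apply/eqP/vnorm_eq => i; rewrite /toR mxE rmorphD.
Qed.

Lemma enormN x : enorm R (- x) = enorm R x.
Proof. by rewrite /enorm; under eq_bigr do rewrite mxE rmorphN sqrrN. Qed.

Lemma enormB x y : enorm R (x - y) = enorm R (y - x).
Proof. by rewrite -enormN opprB. Qed.

Lemma enorm_tri x y z : enorm R (x - z) <= enorm R (x - y) + enorm R (y - z).
Proof.
apply: le_trans (enormD _ _); by rewrite addrA subrK.
Qed.

Lemma enorm0 : enorm R (0 : Zd d) = 0.
Proof. by rewrite /enorm big1 ?sqrtr0// => i _; rewrite mxE expr0n. Qed.

Lemma ler_coord_enorm x i : `|(x 0 i)%:~R : R| <= enorm R x.
Proof. exact: (ler_coord_vnorm (toR x)). Qed.

(** The coordinates of the points of a ball range over a finite interval. *)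
Lemma finite_ball (a : Zd d) (rho : R) : finite_set (zball a rho).
Proof.
pose M := (Num.truncn `|rho|).+1.
have rM : rho < M%:R.
  by apply: le_lt_trans (ler_norm _) _; exact: truncnS_gt.
clearbody M.
pose F (f : {ffun 'I_d -> 'I_(2 * M).+1}) : Zd d :=
  \row_i (a 0 i + (f i)%:Z - M%:Z).
apply: (@sub_finite_set _ _ (F @` setT)); last exact/finite_image/finite_finset.
move=> y; rewrite /zball/= => ay.
have yb i : `|(a - y) 0 i| <= M%:Z.
  have := le_trans (ler_coord_enorm (a - y) i) (le_trans ay (ltW rM)).
  by rewrite -intr_norm (_ : M%:R = (M%:Z)%:~R :> R)// ler_int.
have yb2 i : (`|(y 0 i - a 0 i + M%:Z)%R|%N < (2 * M).+1)%N.
  have := yb i; rewrite coordB ler_norml => /andP[]; lia.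
exists [ffun i => Ordinal (yb2 i)] => //.
apply/rowP => i; rewrite !mxE ffunE /=.
have := yb i; rewrite coordB ler_norml => /andP[]; lia.
Qed.

End EuclideanNorm.

Section Steps.
Context {d : nat}.
Implicit Types (x y z v : Zd d).

Definition ev (i : 'I_d) : Zd d := delta_mx 0 i.

Definition is_step v := exists i, v = ev i \/ v = - ev i.

Lemma unit_step_even (i : 'I_d) : unit_step d (i.*2) = ev i.
Proof.
apply/rowP => k; rewrite !mxE doubleK -signr_odd odd_double expr0.
by have [->|ki] := eqVneq k i; rewrite ?eqxx//= (negbTE (ki : k != i :> nat)).
Qed.

Lemma unit_step_odd (i : 'I_d) : unit_step d (i.*2.+1) = - ev i.
Proof.
apply/rowP => k; rewrite !mxE /= uphalf_double -signr_odd /= odd_double expr1.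
by have [->|ki] := eqVneq k i; rewrite ?eqxx//= (negbTE (ki : k != i :> nat)) ?oppr0.
Qed.

Lemma unit_step_is_step j : (j < d.*2)%N -> is_step (unit_step d j).
Proof.
move=> jd; have j2 : (j./2 < d)%N by rewrite ltn_half_double.
exists (Ordinal j2); rewrite -unit_step_odd -unit_step_even /=.
by have := odd_double_half j; case: (odd j) => e; [right|left]; rewrite -{1}e.
Qed.

Lemma is_stepP v : is_step v -> exists2 j, (j < d.*2)%N & v = unit_step d j.
Proof.
move=> [i [->|->]].
- by exists i.*2; rewrite ?unit_step_even// ltn_double.
- exists i.*2.+1; rewrite ?unit_step_odd// -doubleS.
  by have := ltn_ord i; lia.
Qed.

Lemma is_stepN v : is_step v -> is_step (- v).
Proof. by move=> [i [->|->]]; exists i; [right|left]; rewrite ?opprK. Qed.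

Lemma sum_steps (V : nmodType) (F : nat -> V) n :
  \sum_(j < n.*2) F j = \sum_(i < n) (F i.*2 + F i.*2.+1).
Proof.
elim: n => [|n IH]; first by rewrite !big_ord0.
by rewrite doubleS 2!big_ord_recr/= IH big_ord_recr/= addrA.
Qed.

Lemma sum_stepsE (V : nmodType) (F : Zd d -> V) :
  \sum_(j < d.*2) F (unit_step d j) = \sum_(i < d) (F (ev i) + F (- ev i)).
Proof.
rewrite (sum_steps (fun j => F (unit_step d j))).
by apply: eq_bigr => i _; rewrite unit_step_even unit_step_odd.
Qed.

Lemma sum_steps_opp (V : nmodType) (F : Zd d -> V) :
  \sum_(j < d.*2) F (- unit_step d j) = \sum_(j < d.*2) F (unit_step d j).
Proof.
rewrite sum_stepsE (sum_stepsE (fun v => F (- v))).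
by apply: eq_bigr => i _; rewrite opprK addrC.
Qed.

Definition l1 v : nat := (\sum_(i < d) `|(v 0 i)%R|)%N.

Lemma l1_0 : l1 0 = 0%N.
Proof. by rewrite /l1 big1// => i _; rewrite mxE. Qed.

Lemma l1_pred v : v != 0 -> exists2 e, is_step e & l1 v = (l1 (v - e)).+1.
Proof.
move=> v0; have [i vi] : exists i, v 0 i != 0.
  apply/existsP; apply: contraNT v0 => /existsPn/= h.
  by apply/eqP/rowP => i; rewrite mxE; apply/eqP; have := h i; rewrite negbK.
have key (e : Zd d) (s : int) : (forall k, e 0 k = if k == i then s else 0) ->
    absz (v 0 i)%R = (absz (v 0 i - s)%R).+1 -> l1 v = (l1 (v - e)).+1.
  move=> es h; rewrite /l1 (bigD1 i)//= [in RHS](bigD1 i)//= h.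
  rewrite !mxE es eqxx addSn; congr (_ + _).+1.
  by apply: eq_bigr => k ki; rewrite !mxE es (negbTE ki) subr0.
have [vp|vn] := leP 0 (v 0 i).
  exists (ev i); first by exists i; left.
  by apply: (key _ 1) => [k|]; [rewrite !mxE eqxx/=; case: (k == i)|lia].
exists (- ev i); first by exists i; right.
by apply: (key _ (-1)) => [k|]; [rewrite !mxE eqxx/=; case: (k == i); rewrite ?oppr0|lia].
Qed.

(** Bounds on one-step increments propagate along a shortest path from the
    origin, whose length is the l1 norm. *)
Lemma l1_ind (Q : Zd d -> Prop) : Q 0 ->
  (forall v e, is_step e -> l1 (v + e) = (l1 v).+1 -> Q v -> Q (v + e)) ->
  forall v, Q v.
Proof.
move=> Q0 QS v; have [n] := ubnP (l1 v); elim: n v => // n IH v vn.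
have [->//|v0] := eqVneq v 0; have [e se h] := l1_pred v0.
rewrite -(subrK e v); apply: QS => //; first by rewrite subrK.
by apply: IH; move: vn; rewrite h ltnS.
Qed.

Context {R : realType}.

Lemma l1R v : (l1 v)%:R = \sum_(i < d) `|(v 0 i)%:~R : R|.
Proof.
rewrite /l1 natr_sum; apply: eq_bigr => i _.
by rewrite natr_absz intr_norm.
Qed.

Lemma l1_sq v : (l1 v)%:R ^+ 2 <= d%:R * nsq v :> R.
Proof.
have := cauchy_schwarz (fun _ : 'I_d => 1 : R) (fun i : 'I_d => `|(v 0 i)%:~R : R|).
under eq_bigr do rewrite mul1r.
rewrite -l1R => h.
have : (l1 v)%:R ^+ 2 <= (vnorm (fun _ : 'I_d => 1 : R) *
      vnorm (fun i : 'I_d => `|(v 0 i)%:~R : R|)) ^+ 2.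
  by rewrite ler_sqr ?nnegrE ?mulr_ge0 ?vnorm_ge0.
rewrite exprMn !sqr_vnorm; under eq_bigr do rewrite expr1n.
rewrite sumr_const card_ord.
by under [X in _ <= _ * X]eq_bigr do rewrite real_normK ?num_real//.
Qed.

Lemma l1_enorm v : (l1 v)%:R <= d%:R * enorm R v.
Proof.
rewrite l1R; apply: (@le_trans _ _ (\sum_(i < d) enorm R v)).
  by apply: ler_sum => i _; exact: ler_coord_enorm.
by rewrite sumr_const card_ord mulr_natl.
Qed.

Lemma nsq_ev x i : nsq (x + ev i) = nsq x + 2 * (x 0 i)%:~R + 1 :> R.
Proof.
rewrite /nsq (bigD1 i)//= [in RHS](bigD1 i)//=.
rewrite !mxE !eqxx/= rmorphD/=.
under eq_bigr => k ki do rewrite !mxE (negbTE ki) andbF/= addr0.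
ring.
Qed.

Lemma nsq_evN x i : nsq (x - ev i) = nsq x - 2 * (x 0 i)%:~R + 1 :> R.
Proof.
rewrite /nsq (bigD1 i)//= [in RHS](bigD1 i)//=.
rewrite !mxE !eqxx/= rmorphB/=.
under eq_bigr => k ki do rewrite !mxE (negbTE ki) andbF/= subr0.
ring.
Qed.

Lemma enorm_ev i : enorm R (ev i) = 1.
Proof.
rewrite /enorm -[\sum_(_ < _) _]/(nsq (ev i)) -[ev i]add0r nsq_ev /nsq big1.
  by rewrite mxE mulr0 !add0r sqrtr1.
by move=> k _; rewrite mxE expr0n.
Qed.

Lemma enorm_step v : is_step v -> enorm R v = 1.
Proof. by move=> [i [->|->]]; rewrite ?enormN enorm_ev. Qed.

Lemma neighbor_step x v : is_step v -> neighbor R x (x + v).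
Proof. by move=> sv; rewrite /neighbor opprD addNKr enormN enorm_step. Qed.

Lemma neighborP x y : neighbor R x y -> exists2 v, is_step v & y = x + v.
Proof.
move=> /neighbor_unit_step[j jd ->]; exists (unit_step d j) => //.
exact: unit_step_is_step.
Qed.

(** A shortest path from the origin moves outwards in one coordinate at a
    time, so it never leaves the ball through its end point. *)
Lemma l1_path_norm v e : is_step e -> l1 (v + e) = (l1 v).+1 ->
  enorm R v <= enorm R (v + e).
Proof.
move=> [i he] hl; rewrite /enorm; apply: ler_wsqrtr.
rewrite -/(nsq v) -/(nsq (v + e)).
have : (absz (v 0 i)%R < absz ((v + e) 0 i)%R)%N.
  move: hl; rewrite /l1 (bigD1 i)//= [in RHS](bigD1 i)//= => hl.
  have hk : (\sum_(k < d | k != i) absz ((v + e) 0 k)%R = \sum_(k < d | k != i) absz (v 0 k)%R)%N.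
    apply: eq_bigr => k ki; case: he => ->; by rewrite !mxE (negbTE ki) andbF ?oppr0 addr0.
  by move: hl; rewrite hk -addSn => /addIn ->.
case: he => ->; rewrite ?coordD ?coordB ?mxE !eqxx /= => h; rewrite ?nsq_ev ?nsq_evN.
  have h' : 0 <= (v 0 i)%:~R :> R by rewrite ler0z; lia.
  by lra.
have h' : (v 0 i)%:~R <= 0 :> R by rewrite lerz0; lia.
by lra.
Qed.

End Steps.

(** * One-step averages and the maximum principle *)

Lemma seq_argmax {R : realType} {T : eqType} (F : T -> R) (s : seq T) x0 :
  x0 \in s -> exists2 z, z \in s & forall y, y \in s -> F y <= F z.
Proof.
elim: s x0 => // b t IH x0 _.
have [->|/eqP] := eqVneq t [::].
  by exists b; rewrite ?mem_head// => y; rewrite inE => /eqP ->.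
case: t IH => // c t IH _; have [z zt zm] := IH c (mem_head _ _).
have [bz|zb] := leP (F b) (F z).
  exists z; first by rewrite inE zt orbT.
  by move=> y; rewrite inE => /predU1P[->//|/zm].
exists b; first exact: mem_head.
by move=> y; rewrite inE => /predU1P[->//|/zm/le_trans]; apply; exact: ltW.
Qed.

Section Averages.
Context {R : realType} {d : nat}.
Context (d0 : (0 < d)%N).
Implicit Types (u v w : Zd d -> R) (x y z e : Zd d) (c m : R).

Definition avg u x : R :=
  (d.*2%:R)^-1 * \sum_(j < d.*2) u (x + unit_step d j).

Lemma twod_gt0 : 0 < d.*2%:R :> R.
Proof. by rewrite ltr0n double_gt0. Qed.

Lemma twodE : d.*2%:R = 2 * d%:R :> R.
Proof. by rewrite -mul2n natrM. Qed.

Lemma avg_ev u x :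
  avg u x = (d.*2%:R)^-1 * \sum_(i < d) (u (x + ev i) + u (x - ev i)).
Proof. by rewrite /avg (sum_stepsE (fun e => u (x + e))). Qed.

Lemma avg_le u v x : (forall e, is_step e -> u (x + e) <= v (x + e)) ->
  avg u x <= avg v x.
Proof.
move=> uv; rewrite /avg; apply: ler_wpM2l; first by rewrite invr_ge0 ltW// twod_gt0.
by apply: ler_sum => j _; apply: uv; exact: unit_step_is_step.
Qed.

Lemma avg_eq u v x : (forall e, is_step e -> u (x + e) = v (x + e)) ->
  avg u x = avg v x.
Proof.
by move=> uv; apply/eqP; rewrite eq_le !avg_le// => e /uv ->.
Qed.

Lemma avg_cst c x : avg (fun=> c) x = c.
Proof.
by rewrite /avg sumr_const card_ord -[c *+ _]mulr_natl mulKf// gt_eqF ?twod_gt0.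
Qed.

Lemma avgD u v x : avg (fun z => u z + v z) x = avg u x + avg v x.
Proof. by rewrite /avg big_split/= mulrDr. Qed.

Lemma avgZ c u x : avg (fun z => c * u z) x = c * avg u x.
Proof. by rewrite /avg -mulr_sumr mulrCA. Qed.

Lemma avgN u x : avg (fun z => - u z) x = - avg u x.
Proof. by rewrite /avg sumrN mulrN. Qed.

Lemma avg_ge0 u x : (forall e, is_step e -> 0 <= u (x + e)) -> 0 <= avg u x.
Proof.
by move=> u0; rewrite -(avg_cst 0 x); apply: avg_le.
Qed.

Lemma avg_le_cst u x c : (forall e, is_step e -> u (x + e) <= c) -> avg u x <= c.
Proof. by move=> uc; rewrite -[leRHS](avg_cst c x); exact: avg_le. Qed.

Lemma avg_ge_term u x e : is_step e -> (forall e, is_step e -> 0 <= u (x + e)) ->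
  u (x + e) / d.*2%:R <= avg u x.
Proof.
move=> /is_stepP[j jd ->] u0.
rewrite mulrC /avg; apply: ler_wpM2l; first by rewrite invr_ge0 ltW// twod_gt0.
rewrite (bigD1 (Ordinal jd))//= lerDl sumr_ge0// => k _.
by apply: u0; exact: unit_step_is_step.
Qed.

Lemma avg_shift u (a : Zd d) x : avg (fun z => u (z - a)) x = avg u (x - a).
Proof.
by rewrite /avg; under eq_bigr do rewrite addrAC.
Qed.

(** The squared norm has discrete Laplacian one. It is the term that makes
    weak inequalities strict here, and in the barriers below it takes care of
    the lateral boundary. *)
Lemma avg_nsq x : avg nsq x = nsq x + 1.
Proof.
rewrite avg_ev (eq_bigr (fun=> 2 * (nsq x + 1))); last first.
  by move=> i _; rewrite nsq_ev nsq_evN; ring.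
rewrite sumr_const card_ord -[X in _ * X]mulr_natl twodE; field.
by rewrite pnatr_eq0 -lt0n.
Qed.

(** Adding a small multiple of the squared distance makes a subharmonic
    function strictly subharmonic, and such a function has no interior maximum
    over a finite region. So it is controlled by its values at the outer
    neighbours of the region. *)
Lemma maximum_principle (Reg : set (Zd d)) w a rho :
  (forall x, Reg x -> enorm R (x - a) <= rho) ->
  (forall x, Reg x -> w x <= avg w x) ->
  (forall x e, Reg x -> is_step e -> ~ Reg (x + e) -> w (x + e) <= 0) ->
  forall x, Reg x -> w x <= 0.
Proof.
move=> Rrho sub out x0 Rx0; rewrite leNgt; apply/negP => w0.
have rho0 : 0 <= rho by apply: le_trans (enorm_ge0 _) (Rrho _ Rx0).
pose C : R := (rho + 1) ^+ 2.
have C0 : 0 < C by rewrite exprn_gt0// ltr_wpDl.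
have C2 : 0 < 2 * C by apply: mulr_gt0.
(* Small enough that the perturbation is at most w x0 / 2 at all neighbours of
   the region. *)
pose eps := w x0 / (2 * C).
have eps0 : 0 < eps by apply: divr_gt0.
pose W z := w z + eps * nsq (z - a).
have fR : finite_set Reg.
  apply: (@sub_finite_set _ _ (zball a rho)); last exact: finite_ball.
  by move=> z /Rrho; rewrite /zball/= enormB.
pose s := enum_fset (fset_set Reg).
have sR z : (z \in s) = (z \in Reg).
  by rewrite -(in_fset_set fR).
have [z zs zmax] : exists2 z, z \in s & forall y, y \in s -> W y <= W z.
  by apply: (@seq_argmax _ _ W _ x0); rewrite sR inE.
have Rz : Reg z by apply/set_mem; rewrite -sR.
have Wz : w x0 <= W z.
  apply: le_trans (zmax x0 _); last by rewrite sR inE.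
  by rewrite lerDl mulr_ge0 ?nsq_ge0 ?ltW.
have near_small y : enorm R (y - a) <= rho + 1 -> eps * nsq (y - a) <= w x0 / 2.
  move=> h; rewrite /eps -mulrA ler_pM2l// ler_pdivrMl//.
  rewrite (_ : 2 * C / 2 = C); last by field.
  by rewrite -sqr_enorm ler_sqr ?nnegrE ?enorm_ge0// addr_ge0.
have : avg W z <= W z.
  apply: avg_le_cst => e se.
  have [Rze|nR] := pselect (Reg (z + e)); first by apply: zmax; rewrite sR inE.
  rewrite /W; have := out _ _ Rz se nR.
  have := near_small (z + e); have -> : enorm R (z + e - a) <= rho + 1.
    rewrite addrAC; apply: le_trans (enormD _ _) _.
    by rewrite (enorm_step se) lerD2r; exact: Rrho.
  by move=> /(_ isT); move: Wz; rewrite /W; lra.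
rewrite avgD avgZ (avg_shift nsq) avg_nsq.
by have := sub _ Rz; rewrite /W; lra.
Qed.

End Averages.

(** * The discrete Laplacian of radial functions *)

Section Radial.
Context {R : realType}.
Implicit Types (h w u t M : R) (k : nat).

Let small_norm h : `|h| <= 1 / 2 -> - (1/2) <= h <= 1/2.
Proof. by rewrite ler_norml. Qed.

(** The cubic Taylor polynomial p of (1+h)^(-1/2) satisfies p^2 * (1+h) = 1 +
    O(h^4), and dividing by the positive factor (w+p) * (1+h) turns this into
    a bound on w - p. *)
Lemma inv_sqrt_expand h w : `|h| <= 1 / 2 -> 0 < w -> w ^+ 2 * (1 + h) = 1 ->
  `|w - (1 - h / 2 + 3 / 8 * h ^+ 2 - 5 / 16 * h ^+ 3)| <= 4 * h ^+ 4.
Proof.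
move=> /small_norm/andP[h1 h2] w0 wh.
set p := (X in w - X).
have p0 : 1 / 2 <= p by rewrite /p; nra.
(* The remainder of p^2 * (1+h), found by expanding. *)
pose r : R := - 35 / 64 + 14 / 64 * h - 35 / 256 * h ^+ 2 + 25 / 256 * h ^+ 3.
have pE : p ^+ 2 * (1 + h) = 1 + h ^+ 4 * r by rewrite /p /r; field.
have r1 : `|r| <= 1 by rewrite ler_norml /r; apply/andP; split; nra.
have fac : (w - p) * ((w + p) * (1 + h)) = - (h ^+ 4 * r).
  rewrite (_ : _ * _ = w ^+ 2 * (1 + h) - p ^+ 2 * (1 + h)); last by ring.
  by rewrite wh pE; ring.
have low : 1 / 4 <= (w + p) * (1 + h) by nra.
have : `|w - p| * ((w + p) * (1 + h)) <= h ^+ 4.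
  rewrite -[X in _ * X]ger0_norm; last by lra.
  rewrite -normrM fac normrN normrM ger0_norm ?exprn_even_ge0//.
  by rewrite ler_piMr// exprn_even_ge0.
have := normr_ge0 (w - p); nra.
Qed.

(** Taylor expansion of (1+h)^(-k/2), where w stands for (1+h)^(-1/2):
    multiply the expansions for k and for 1. The cubic coefficient e stays
    implicit because it cancels in symmetric differences. *)
Lemma inv_sqrt_pow_expand k : exists e C : R, 0 <= C /\
  forall h w, `|h| <= 1 / 2 -> 0 < w -> w ^+ 2 * (1 + h) = 1 ->
  `|w ^+ k - (1 - k%:R / 2 * h + k%:R * (k%:R + 2) / 8 * h ^+ 2 + e * h ^+ 3)|
    <= C * h ^+ 4.
Proof.
elim: k => [|k [e [C [C0 IH]]]].
  by exists 0, 0; split=> // h w _ _ _; rewrite expr0 !mul0r subr0 !addr0 subrr normr0.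
pose q1 : R := - (k%:R / 2); pose q2 : R := k%:R * (k%:R + 2) / 8.
pose s0 := - (1/2) * e + 3 / 8 * q2 - 5 / 16 * q1.
pose s1 := 3 / 8 * e - 5 / 16 * q2.
pose s2 := - (5 / 16) * e.
exists (e - k%:R * (k%:R + 2) / 16 - 3 * k%:R / 16 - 5 / 16),
  (`|s0| + `|s1| + `|s2| + 4 * 2 ^+ k + 2 * C).
split; first by rewrite !addr_ge0 ?normr_ge0 ?mulr_ge0 ?exprn_ge0.
move=> h w hh w0 wh.
have hA := inv_sqrt_expand hh w0 wh.
have := IH h w hh w0 wh.
have /small_norm/andP[h1 h2] := hh.
set p := (X in `|w - X| <= _) in hA.
set P := (X in `|w ^+ k - X| <= _) => hB.
have w2 : w <= 2 by nra.
have wk : w ^+ k <= 2 ^+ k by rewrite lerXn2r ?nnegrE// ltW.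
have wk0 : 0 <= w ^+ k by rewrite exprn_ge0// ltW.
have hp : `|p| <= 2 by rewrite ler_norml /p; apply/andP; split; nra.
have h40 : 0 <= h ^+ 4 by rewrite exprn_even_ge0.
have hS : `|s0 + s1 * h + s2 * h ^+ 2| <= `|s0| + `|s1| + `|s2|.
  apply: le_trans (ler_normD _ _) _; apply: lerD.
    apply: le_trans (ler_normD _ _) _; rewrite lerD2l normrM ler_piMr//.
    by apply: le_trans hh _; lra.
  rewrite normrM ler_piMr// ger0_norm ?sqr_ge0//; nra.
rewrite (_ : w ^+ k.+1 - _ = (w - p) * w ^+ k + (p * (w ^+ k - P)
   + h ^+ 4 * (s0 + s1 * h + s2 * h ^+ 2))); last first.
  by rewrite exprS /p /P /s0 /s1 /s2 /q1 /q2 -natr1; field.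
apply: le_trans (ler_normD _ _) _.
rewrite normrM (ger0_norm wk0).
have t1 : `|w - p| * w ^+ k <= 4 * 2 ^+ k * h ^+ 4.
  rewrite mulrAC; apply: ler_pM => //; exact: normr_ge0.
apply: le_trans (lerD t1 (ler_normD _ _)) _.
rewrite (normrM p) (normrM (h ^+ 4)) (ger0_norm h40).
have t2 : `|p| * `|w ^+ k - P| <= 2 * (C * h ^+ 4).
  by apply: ler_pM.
have t3 : h ^+ 4 * `|s0 + s1 * h + s2 * h ^+ 2| <= h ^+ 4 * (`|s0| + `|s1| + `|s2|).
  by apply: ler_wpM2l.
nra.
Qed.

(** This is t^(-k/2). *)
Definition isq (k : nat) (t : R) : R := (Num.sqrt t)^-1 ^+ k.

Lemma isq_gt0 k t : 0 < t -> 0 < isq k t.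
Proof. by move=> t0; rewrite exprn_gt0// invr_gt0 sqrtr_gt0. Qed.

Lemma isq_nhomo k t u : 0 < t -> t <= u -> isq k u <= isq k t.
Proof.
move=> t0 tu; have u0 : 0 < u by apply: lt_le_trans tu.
apply: lerXn2r; rewrite ?nnegrE ?invr_ge0 ?sqrtr_ge0//.
rewrite lef_pV2 ?posrE ?sqrtr_gt0//; exact: ler_wsqrtr.
Qed.

Lemma isqM k t u : 0 <= t -> isq k (t * u) = isq k t * isq k u.
Proof. by move=> t0; rewrite /isq sqrtrM// invfM exprMn. Qed.

Lemma isqS k t : isq k.+1 t = isq 1 t * isq k t.
Proof. by rewrite /isq exprS expr1. Qed.

Lemma isq_sqr k t : 0 <= t -> isq k (t ^+ 2) = t ^- k.
Proof. by move=> t0; rewrite /isq sqrtr_sqr ger0_norm// exprVn. Qed.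

Lemma isq1_sqr t : 0 < t -> isq 1 t ^+ 2 * t = 1.
Proof.
move=> t0; rewrite /isq expr1 exprVn sqr_sqrtr ?(ltW t0)// mulVf//.
by rewrite gt_eqF.
Qed.

Lemma isqE k t : isq k t = isq 1 t ^+ k.
Proof. by rewrite /isq expr1. Qed.

(** In the symmetric sum the odd terms of the expansion cancel. *)
Lemma isq_even k : exists2 C : R, 0 <= C & forall h, `|h| <= 1 / 2 ->
  `|isq k (1 + h) + isq k (1 - h) - 2 - k%:R * (k%:R + 2) / 4 * h ^+ 2|
    <= C * h ^+ 4.
Proof.
have [e [C [C0 H]]] := inv_sqrt_pow_expand k.
exists (2 * C); first by rewrite mulr_ge0.
move=> h hh; have /small_norm/andP[h1 h2] := hh.
have pos1 : 0 < 1 + h by lra.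
have pos2 : 0 < 1 + - h by lra.
have A := H _ _ hh (isq_gt0 1 pos1) (isq1_sqr pos1).
have hh' : `|- h| <= 1 / 2 by rewrite normrN.
have B := H _ _ hh' (isq_gt0 1 pos2) (isq1_sqr pos2).
move: A B; rewrite -!isqE => A B.
have := le_trans (ler_normD _ _) (lerD A B).
rewrite (_ : (- h) ^+ 4 = h ^+ 4); last by ring.
rewrite (_ : C * h ^+ 4 + _ = 2 * C * h ^+ 4); last by ring.
move=> AB; apply: le_trans AB; rewrite le_eqVlt; apply/orP; left; apply/eqP.
by congr `|_|; field.
Qed.

Lemma isq_one k : exists2 C : R, 0 <= C & forall u, `|u| <= 1 / 2 ->
  `|isq k (1 - u) - 1 - k%:R / 2 * u| <= C * u ^+ 2.
Proof.
have [e [C [C0 H]]] := inv_sqrt_pow_expand k.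
exists (C + k%:R * (k%:R + 2) / 8 + `|e|).
  by rewrite !addr_ge0 ?normr_ge0// divr_ge0// mulr_ge0// addr_ge0.
move=> u uu; have /small_norm/andP[h1 h2] := uu.
have pos2 : 0 < 1 + - u by lra.
have hh' : `|- u| <= 1 / 2 by rewrite normrN.
have := H _ _ hh' (isq_gt0 1 pos2) (isq1_sqr pos2).
rewrite -isqE => B.
have u2 : 0 <= u ^+ 2 by rewrite sqr_ge0.
have B' : C * (- u) ^+ 4 <= C * u ^+ 2.
  rewrite ler_wpM2l// (_ : (- u) ^+ 4 = u ^+ 2 * u ^+ 2); last by ring.
  by rewrite ler_piMl//; nra.
have E : `|- (e * u ^+ 3)| <= `|e| * u ^+ 2.
  rewrite normrN normrM ler_wpM2l// exprS normrM (ger0_norm u2).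
  by rewrite ler_piMl//; apply: le_trans uu _; lra.
set k1 := k%:R * (k%:R + 2) / 8.
have F : `|k1 * u ^+ 2| <= k1 * u ^+ 2.
  by rewrite ger0_norm// mulr_ge0// divr_ge0// mulr_ge0// addr_ge0.
have := le_trans (ler_normD _ _) (lerD (le_trans B B') (le_trans (ler_normD _ _) (lerD E F))).
rewrite (_ : C * _ + _ = (C + k1 + `|e|) * u ^+ 2); last by ring.
move=> AB; apply: le_trans AB; rewrite le_eqVlt; apply/orP; left; apply/eqP.
congr `|_|; by rewrite /k1; field.
Qed.

Context {d : nat} (d0 : (0 < d)%N).

(** This is (|z|^2 + M)^(-k/2); the shift M removes the singularity at the
    origin. *)
Definition radial (M : R) (k : nat) (z : Zd d) : R := isq k (nsq z + M).

(** With T = |z|^2 + 1 + M, the neighbours z +- e_i have |z +- e_i|^2 + M = T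
    (1 +- h_i) for h_i = 2 z_i / T, and the centre is T (1 - 1/T). Since the
    h_i^2 add up to 4 |z|^2 / T^2, summing the even expansions gives the
    Laplacian up to a relative error of order T^(-2). Its leading term
    vanishes for k = d - 2. *)
Lemma radial_laplacian k : exists2 C : R, 0 <= C &
  forall M (z : Zd d), 3 <= M ->
  let T := nsq z + 1 + M in
  `|d.*2%:R * (avg (radial M k) z - radial M k z) - isq k T *
     (k%:R * (k%:R + 2 - d%:R) / T - k%:R * (k%:R + 2) * (M + 1) / T ^+ 2)|
   <= isq k T * (C / T ^+ 2).
Proof.
have [C1 C10 H1] := isq_even k; have [C2 C20 H2] := isq_one k.
exists (16 * C1 + d.*2%:R * C2); first by rewrite addr_ge0// mulr_ge0.
move=> M z M3; cbv zeta; set T := nsq z + 1 + M.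
have q0 : 0 <= nsq z :> R by exact: nsq_ge0.
have T4 : 4 <= T by rewrite /T; lra.
have T0 : 0 < T by lra.
pose h i : R := 2 * (z 0 i)%:~R / T.
have hs : \sum_i h i ^+ 2 = 4 * nsq z / T ^+ 2.
  rewrite /nsq mulr_sumr mulr_suml; apply: eq_bigr => i _.
  by rewrite /h; field; rewrite gt_eqF.
have hi2 i : h i ^+ 2 <= 4 / T.
  have : h i ^+ 2 <= \sum_i h i ^+ 2.
    by rewrite (bigD1 i)//= lerDl sumr_ge0// => j _; rewrite sqr_ge0.
  move/le_trans; apply; rewrite hs ler_pdivrMr ?exprn_gt0//.
  rewrite (_ : 4 / T * T ^+ 2 = 4 * T); last by field; rewrite gt_eqF.
  by rewrite /T; lra.
have hsmall i : `|h i| <= 1 / 2.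
  have : `|h i| ^+ 2 <= (1/2) ^+ 2.
    have -> : `|h i| = T^-1 * (2 * `|(z 0 i)%:~R|).
      by rewrite /h !normrM normfV (ger0_norm (ltW T0)) (ger0_norm (ler0n _ 2)) mulrC.
    rewrite exprMn exprMn real_normK ?num_real//.
    rewrite exprVn ler_pdivrMl ?exprn_gt0//.
    have : (z 0 i)%:~R ^+ 2 <= nsq z :> R.
      by rewrite /nsq (bigD1 i)//= lerDl sumr_ge0// => j _; rewrite sqr_ge0.
    move=> za; have TT : (nsq z + 4) ^+ 2 <= T ^+ 2 by rewrite ler_sqr ?nnegrE /T; lra.
    have := sqr_ge0 (nsq z / 2 - 2 : R); move: za TT; move: (T ^+ 2) => T2 /=.
    by rewrite !expr2; lra.
  by rewrite ler_sqr ?nnegrE//; lra.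
have nb i : radial M k (z + ev i) + radial M k (z - ev i) =
    isq k T * (isq k (1 + h i) + isq k (1 - h i)).
  rewrite mulrDr -!isqM ?(ltW T0)// /radial nsq_ev nsq_evN.
  by congr (isq k _ + isq k _); rewrite /h /T; field; rewrite gt_eqF// -/T; lra.
have ctr : radial M k z = isq k T * isq k (1 - T^-1).
  rewrite -isqM ?(ltW T0)// /radial; congr isq; rewrite /T; field.
  by rewrite gt_eqF// -/T; lra.
have Tinv : `|T^-1| <= 1 / 2.
  by rewrite normfV ger0_norm ?(ltW T0)// ler_pdivlMr// mulrC ler_pdivrMr//; lra.
rewrite avg_ev; under eq_bigr do rewrite nb.
rewrite mulrBr mulVKf ?gt_eqF ?twod_gt0// -mulr_sumr ctr.
pose E1 i := isq k (1 + h i) + isq k (1 - h i) - 2 - k%:R * (k%:R + 2) / 4 * h i ^+ 2.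
pose E2 := isq k (1 - T^-1) - 1 - k%:R / 2 * T^-1.
have -> : \sum_(i < d) (isq k (1 + h i) + isq k (1 - h i)) =
   d.*2%:R + k%:R * (k%:R + 2) / 4 * (4 * nsq z / T ^+ 2) + \sum_(i < d) E1 i.
  rewrite -hs mulr_sumr.
  rewrite (_ : d.*2%:R = \sum_(i < d) (2 : R)); last first.
    by rewrite sumr_const card_ord twodE mulr_natr.
  by rewrite -!big_split/=; apply: eq_bigr => i _; rewrite /E1; ring.
have -> : isq k (1 - T^-1) = 1 + k%:R / 2 * T^-1 + E2 by rewrite /E2; ring.
rewrite (_ : _ - _ = isq k T * (\sum_(i < d) E1 i - d.*2%:R * E2)); last first.
  rewrite twodE /T; field; rewrite gt_eqF// -/T; lra.
rewrite normrM (ger0_norm (ltW (isq_gt0 k T0))).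
apply: ler_wpM2l; first by rewrite ltW// isq_gt0.
apply: le_trans (ler_normB _ _) _; rewrite mulrDl; apply: lerD.
  apply: le_trans (ler_norm_sum _ _ _) _.
  apply: (@le_trans _ _ (\sum_(i < d) (C1 * (4 / T)) * h i ^+ 2)).
    apply: ler_sum => i _; apply: le_trans (H1 _ (hsmall i)) _.
    rewrite -mulrA ler_wpM2l// (_ : h i ^+ 4 = h i ^+ 2 * h i ^+ 2); last by ring.
    by rewrite ler_wpM2r ?sqr_ge0.
  rewrite -mulr_sumr hs.
  rewrite (_ : _ * _ = 16 * C1 / T ^+ 2 * (nsq z / T)); last by field; rewrite gt_eqF.
  rewrite ler_piMr//; first by apply: divr_ge0; [exact: mulr_ge0|exact: sqr_ge0].
  by rewrite ler_pdivrMr// mul1r /T; lra.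
rewrite normrM ger0_norm// -mulrA ler_wpM2l//.
by apply: le_trans (H2 _ Tinv) _; rewrite exprVn.
Qed.

End Radial.

(** * Green functions of the killed walk *)

Section Green.
Import numFieldNormedType.Exports.
Context {R : realType} {d : nat} (d3 : (3 <= d)%N).
Implicit Types (x y z e : Zd d) (Om : set (Zd d)).

Let d0 : (0 < d)%N. Proof. by apply: leq_trans d3. Qed.
Let N0 : 0 < d.*2%:R :> R. Proof. exact: twod_gt0. Qed.

(** For k = d - 2 the leading term of the Laplacian vanishes and the next one
    is a negative multiple of M + 1, which beats the error once M is large.
    The gain at the origin makes the function dominate a multiple of the Green
    function. *)
Lemma radial_superharmonic : exists M c : R, [/\ 3 <= M, 0 < c &
  forall z : Zd d, avg (radial M (d - 2)) z + c * (z == 0)%:R <= radial M (d - 2) z].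
Proof.
have [C C0 H] := @radial_laplacian R d d0 (d - 2)%N.
set k := (d - 2)%N in H *.
have kE : k%:R + 2 - d%:R = 0 :> R.
  by rewrite /k natrB ?subrK ?subrr// (leq_trans _ d3).
have k1 : 1 <= k%:R :> R by rewrite ler1n /k subn_gt0 (leq_trans _ d3).
pose M := C + 3; pose D := k%:R * (k%:R + 2) * (M + 1) - C.
have D1 : 1 <= D by rewrite /D /M; nra.
pose T0 := 1 + M; have T0p : 0 < T0 by rewrite /T0 /M; lra.
exists M, (isq k T0 * (D / T0 ^+ 2) / d.*2%:R); split.
- by rewrite /M; lra.
- rewrite divr_gt0// mulr_gt0 ?isq_gt0// divr_gt0 ?exprn_gt0//; lra.
move=> z; have M3 : 3 <= M by rewrite /M; lra.
have := H M z M3; cbv zeta; set T := nsq z + 1 + M.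
have Tp : 0 < T by rewrite /T /M; have := @nsq_ge0 R d z; lra.
rewrite kE mulr0 mul0r sub0r ler_norml => /andP[_ h].
have h' : d.*2%:R * (avg (radial M k) z - radial M k z) <= - (isq k T * (D / T ^+ 2)).
  rewrite -[leLHS](subrK (isq k T * - (k%:R * (k%:R + 2) * (M + 1) / T ^+ 2))).
  apply: le_trans (lerD h (lexx _)) _; rewrite le_eqVlt; apply/orP; left; apply/eqP.
  by rewrite /D; field; rewrite gt_eqF.
have pos : 0 <= isq k T * (D / T ^+ 2).
  by rewrite mulr_ge0 ?(ltW (isq_gt0 k Tp))// divr_ge0 ?sqr_ge0//; lra.
rewrite -lerBrDl -(ler_pM2l N0).
case: eqP => [z0|_].
  rewrite mulr1 mulrCA divff ?gt_eqF// mulr1.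
  have -> : T0 = T by rewrite /T0 /T z0 /nsq big1 ?add0r// => i _; rewrite mxE expr0n.
  by move: h'; rewrite mulrBr mulrBr; lra.
by rewrite !mulr0; move: h'; rewrite mulrBr mulrBr; lra.
Qed.

(** Probability that the walk from z is at x at time n and has spent the times
    0, ..., n in Om. *)
Fixpoint walk_kernel Om (n : nat) z x : R :=
  if n is m.+1 then (z \in Om)%:R * avg (fun z' => walk_kernel Om m z' x) z
  else ((z == x) && (z \in Om))%:R.

Lemma walk_kernelS Om n z x : walk_kernel Om n.+1 z x =
  (z \in Om)%:R * avg (fun z' => walk_kernel Om n z' x) z.
Proof. by []. Qed.

Lemma walk_kernel_ge0 Om n z x : 0 <= walk_kernel Om n z x.
Proof.
elim: n z => [|n IH] z //=; rewrite mulr_ge0//.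
exact: (avg_ge0 d0).
Qed.

Lemma avg_exchange (F : Zd d -> Zd d -> R) z x :
  avg (fun z' => avg (F z') x) z = avg (fun x' => avg (F^~ x') z) x.
Proof. by rewrite /avg -!mulr_sumr; congr (_ * (_ * _)); exact: exchange_big. Qed.

(** Decomposition at the last step; the definition decomposes at the first
    one. *)
Lemma walk_kernel_backward Om n z x :
  walk_kernel Om n.+1 z x = (x \in Om)%:R * avg (fun x' => walk_kernel Om n z x') x.
Proof.
elim: n z x => [|n IH] z x.
  rewrite /= /avg !(mulrCA _ (_^-1)); congr (_ * _).
  rewrite -(sum_steps_opp (fun e => ((z + e == x) && (z + e \in Om))%:R)) !mulr_sumr; apply: eq_bigr => j _.
  rewrite -!mulnb !natrM subr_eq; case: eqP => [->|_]; last by rewrite !mul0r !mulr0.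
  by rewrite addrK (_ : true%:R = 1)// !mul1r !mulr1 mulrC.
transitivity ((z \in Om)%:R *
    ((x \in Om)%:R * avg (fun z' => avg (walk_kernel Om n z') x) z)).
  rewrite walk_kernelS; congr (_ * _); rewrite -avgZ.
  by apply: (avg_eq d0) => e _; rewrite -IH.
rewrite avg_exchange mulrCA; congr (_ * _); rewrite -avgZ.
by apply: (avg_eq d0) => e _; rewrite walk_kernelS.
Qed.

Lemma walk_kernel_sym Om n z x : walk_kernel Om n z x = walk_kernel Om n x z.
Proof.
elim: n z x => [|n IH] z x.
  by rewrite /= eq_sym; case: eqP => // ->.
rewrite walk_kernel_backward /=; congr (_ * _).
by apply: avg_eq => // e _; exact: IH.
Qed.

Definition green_sum Om N z x := \sum_(n < N) walk_kernel Om n z x.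

Lemma green_sum_ge0 Om N z x : 0 <= green_sum Om N z x.
Proof. by apply: sumr_ge0 => n _; exact: walk_kernel_ge0. Qed.

Lemma green_sumS Om N z x : green_sum Om N.+1 z x =
  (z \in Om)%:R * ((z == x)%:R + avg (fun z' => green_sum Om N z' x) z).
Proof.
rewrite /green_sum big_ord_recl /= -mulnb natrM mulrDr mulrC; congr (_ + _).
rewrite /bump/= -mulr_sumr; congr (_ * _).
rewrite /avg -mulr_sumr; congr (_ * _); exact: exchange_big.
Qed.

(** F / c is a supersolution of the recursion that the partial sums satisfy.
    *)
Lemma green_sum_le_super Om N (F : Zd d -> R) (c : R) z x : 0 < c ->
  (forall z, 0 <= F z) ->
  (forall z, avg F z + c * (z == x)%:R <= F z) ->
  green_sum Om N z x <= c^-1 * F z.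
Proof.
move=> c0 F0 FS; elim: N z => [|N IH] z.
  by rewrite /green_sum big_ord0 mulr_ge0// invr_ge0 ltW.
rewrite green_sumS; case: (z \in Om); last by rewrite mul0r mulr_ge0// invr_ge0 ltW.
rewrite mul1r; apply: le_trans (_ : (z == x)%:R + c^-1 * avg F z <= _).
  by rewrite lerD2l -avgZ; apply: (avg_le d0).
by rewrite ler_pdivlMl// mulrDr mulVKf ?gt_eqF// addrC.
Qed.

(** The comparison function is superharmonic on the whole lattice, so the
    bound is uniform over the domains Om. *)
Lemma green_sum_upper : exists M C : R, [/\ 3 <= M, 0 < C &
  forall Om N z x, green_sum Om N z x <= C * radial M (d - 2) (z - x)].
Proof.
have [M [c [M3 c0 H]]] := radial_superharmonic.
exists M, c^-1; split=> //; first by rewrite invr_gt0.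
move=> Om N z x.
apply: (@green_sum_le_super Om N (fun z => radial M (d - 2) (z - x))) => //.
  by move=> y; rewrite ltW// isq_gt0// ltr_wpDl ?nsq_ge0//; lra.
move=> y; rewrite (avg_shift (radial M (d - 2))).
by have := H (y - x); rewrite subr_eq0.
Qed.

Definition green Om z x : R := limn (fun N => green_sum Om N z x).

(** The partial sums increase and the radial bound keeps them bounded: this is
    where transience enters. *)
Lemma green_cvg Om z x :
  (fun N => green_sum Om N z x) @ \oo --> green Om z x.
Proof.
have [M [C [M3 C0 H]]] := green_sum_upper.
apply: nondecreasing_is_cvgn.
  apply/nondecreasing_seqP => n; rewrite /green_sum big_ord_recr/= lerDl.
  exact: walk_kernel_ge0.
by exists (C * radial M (d - 2) (z - x)) => _ [N _ <-].
Qed.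

Lemma green_le Om z x c : (forall N, green_sum Om N z x <= c) -> green Om z x <= c.
Proof.
move=> h; apply: limr_le; first by apply/cvg_ex; exists (green Om z x); exact: green_cvg.
by near=> n.
Unshelve. all: by end_near. Qed.

Lemma green_ge0 Om z x : 0 <= green Om z x.
Proof.
apply: limr_ge; first by apply/cvg_ex; exists (green Om z x); exact: green_cvg.
by near=> n; exact: green_sum_ge0.
Unshelve. all: by end_near. Qed.

Lemma green_sym Om z x : green Om z x = green Om x z.
Proof.
suff e : (fun N => green_sum Om N z x) = (fun N => green_sum Om N x z).
  by rewrite /green e.
by apply/funext => N; apply: eq_bigr => n _; rewrite walk_kernel_sym.
Qed.

Lemma cvg_avg (F : nat -> Zd d -> R) (u : Zd d -> R) x :
  (forall z, F ^~ z @ \oo --> u z) -> (fun N => avg (F N) x) @ \oo --> avg u x.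
Proof.
move=> Fu; rewrite /avg; apply: cvgMr.
have gen n : (fun N => \sum_(j < n) F N (x + unit_step d j)) @ \oo -->
    \sum_(j < n) u (x + unit_step d j); last exact: gen.
elim: n => [|n IH].
  under eq_fun do rewrite big_ord0; rewrite big_ord0; exact: cvg_cst.
under eq_fun do rewrite big_ord_recr/=; rewrite big_ord_recr/=.
exact: cvgD.
Qed.

Lemma green_rec Om z x : green Om z x =
  (z \in Om)%:R * ((z == x)%:R + avg (fun z' => green Om z' x) z).
Proof.
have h1 := @green_cvg Om z x.
rewrite -cvg_shiftS /= in h1.
rewrite (funext (fun N => green_sumS Om N z x)) in h1.
have h2 : (fun N => (z \in Om)%:R * ((z == x)%:R + avg (fun z' => green_sum Om N z' x) z))
   @ \oo --> (z \in Om)%:R * ((z == x)%:R + avg (fun z' => green Om z' x) z).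
  apply: cvgMr; apply: cvgD; first exact: cvg_cst.
  by apply: cvg_avg => z'; exact: green_cvg.
exact: (cvg_unique _ h1 h2).
Qed.

Lemma green_in Om z x : Om z ->
  green Om z x = (z == x)%:R + avg (fun z' => green Om z' x) z.
Proof. by move=> /mem_set zO; rewrite green_rec zO mul1r. Qed.

Lemma green_out Om z x : ~ Om z -> green Om z x = 0.
Proof. by move=> zO; rewrite green_rec memNset// mul0r. Qed.

Lemma green_upper : exists2 C : R, 0 < C & forall Om z x (rho : R), 0 < rho ->
  rho <= enorm R (z - x) -> green Om z x <= C * rho ^- (d - 2).
Proof.
have [M [C [M3 C0 H]]] := green_sum_upper.
exists C => // Om z x rho rho0 hr.
apply: le_trans (green_le (fun N => H Om N z x)) _; rewrite ler_pM2l//.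
rewrite -isq_sqr ?(ltW rho0)//; apply: isq_nhomo; first exact: exprn_gt0.
rewrite -sqr_enorm; apply: (@le_trans _ _ (enorm R (z - x) ^+ 2)).
  by rewrite ler_sqr ?nnegrE ?enorm_ge0 ?(ltW rho0).
by rewrite lerDl; lra.
Qed.

End Green.

(** * Lower bounds in balls and Harnack chains *)

Section BallEstimates.
Context {R : realType} {d : nat} (d3 : (3 <= d)%N).
Implicit Types (x y z e a : Zd d) (Om : set (Zd d)) (u : Zd d -> R) (r rho m : R).

Let d0 : (0 < d)%N. Proof. by apply: leq_trans d3. Qed.
Let N0 : 0 < d.*2%:R :> R. Proof. exact: twod_gt0. Qed.

(** Up to constants, |z|^(2-d) + |z|^(1-d). The Laplacian of the second term,
    of order |z|^(-d-1), is positive and beats the error |z|^(-d-2) of the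
    first, so the sum is subharmonic far from the origin. *)
Definition radial_low z : R := radial 3 (d - 2) z + radial 3 (d - 1) z.

Lemma radial_low_subharmonic : exists2 m0 : R, 2 <= m0 &
  forall z, m0 <= enorm R z -> radial_low z <= avg radial_low z.
Proof.
have [C C0 H] := @radial_laplacian R d d0 (d - 2)%N.
have [C' C'0 H'] := @radial_laplacian R d d0 (d - 1)%N.
set k := (d - 2)%N in H *.
have k1E : (d - 1 = k.+1)%N by rewrite /k; lia.
rewrite k1E in H' *.
have kE : k%:R + 2 - d%:R = 0 :> R.
  by rewrite /k natrB ?subrK ?subrr// (leq_trans _ d3).
pose D1 : R := k%:R * (k%:R + 2) * (3 + 1) + C.
pose D2 : R := k.+1%:R * (k.+1%:R + 2) * (3 + 1) + C'.
have k0 : 0 <= k%:R :> R by [].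
have k10 : 1 <= k.+1%:R :> R by rewrite ler1n.
have D10 : 0 <= D1 by rewrite /D1 addr_ge0// mulr_ge0// mulr_ge0// addr_ge0.
have D20 : 0 <= D2 by rewrite /D2 addr_ge0// mulr_ge0// mulr_ge0// addr_ge0.
exists (D1 + D2 + 2); first by lra.
move=> z hz; rewrite -subr_ge0 -(pmulr_rge0 _ N0).
rewrite /radial_low avgD k1E -/k.
have h3 : 3 <= 3 :> R by [].
have := H 3 z h3; have := H' 3 z h3; cbv zeta; set T := nsq z + 1 + 3.
have q0 : 0 <= nsq z :> R by exact: nsq_ge0.
have T0 : 0 < T by rewrite /T; lra.
rewrite kE (_ : k.+1%:R + 2 - d%:R = 1); last by rewrite -natr1; lra.
rewrite mulr0 mul0r mulr1 sub0r !ler_norml => /andP[h1' _] /andP[h1 _].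
rewrite (isqS k T) in h1'.
set w := isq 1 T in h1'.
have w0 : 0 < w by exact: isq_gt0.
have wT : T^-1 = w ^+ 2.
  by rewrite -[LHS]mul1r -(isq1_sqr T0) mulfK// gt_eqF.
have w1 : w <= 1.
  have : w ^+ 2 <= 1 by rewrite -wT invf_le1 ?T0 //; move: q0; rewrite /T; lra.
  by nra.
have wD : w * (D1 + D2) <= 1.
  have hT : (D1 + D2) ^+ 2 <= T.
    apply: (@le_trans _ _ (nsq z)); last by rewrite /T; lra.
    rewrite -sqr_enorm ler_sqr ?nnegrE ?enorm_ge0//; lra.
  have : (w * (D1 + D2)) ^+ 2 <= 1.
    by rewrite exprMn -wT ler_pdivrMl// mulr1.
  have : 0 <= w * (D1 + D2) by rewrite mulr_ge0 ?(ltW w0)// addr_ge0.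
  by nra.
have ik : 0 < isq k T by exact: isq_gt0.
have key : 0 <= w * (k.+1%:R * w ^+ 2 - D2 * w ^+ 4) - D1 * w ^+ 4.
  rewrite (_ : _ - _ = w ^+ 3 * (k.+1%:R - w * (w * D2 + D1))); last by ring.
  rewrite mulr_ge0 ?exprn_ge0 ?(ltW w0)//.
  have : w * (w * D2 + D1) <= 1.
    by apply: le_trans wD; rewrite ler_pM2l//; nra.
  by lra.
have := mulr_ge0 (ltW ik) key; move/le_trans; apply.
have -> : isq k T * (w * (k.+1%:R * w ^+ 2 - D2 * w ^+ 4) - D1 * w ^+ 4) =
   (- (w * isq k T * (C' / T ^+ 2)) + w * isq k T * (k.+1%:R / T -
      k.+1%:R * (k.+1%:R + 2) * (3 + 1) / T ^+ 2)) +
   (- (isq k T * (C / T ^+ 2)) + isq k T * - (k%:R * (k%:R + 2) * (3 + 1) / T ^+ 2)).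
  by rewrite -!exprVn !wT /D1 /D2; ring.
move: h1 h1'; rewrite !mulrBr mulrDr; lra.
Qed.

(** Comparison with the radial barrier in a spherical shell. A multiple of
    radial_low minus its value at distance r lies below u on both spheres that
    bound the shell, so u keeps the capacitary proportion of m on larger
    balls. *)
Lemma superharmonic_shell : exists2 m0 : R, 2 <= m0 &
  forall a r rho m u, m0 <= rho -> rho <= r / 4 -> 0 <= m ->
  (forall z, 0 <= u z) ->
  (forall z, enorm R (z - a) < r -> avg u z <= u z) ->
  (forall z, enorm R (z - a) < rho -> m <= u z) ->
  forall z, enorm R (z - a) <= r / 2 ->
  2^-1 ^+ d * m * (rho / r) ^+ (d - 2) <= u z.
Proof.
have [m0 m02 sub] := radial_low_subharmonic.
exists m0 => // a r rho m u m0rho rhor mge0 u0 sup inner z hz.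
set k := (d - 2)%N in sub *.
have dE : d = k.+2 by rewrite /k; lia.
have k1E : (d - 1 = k.+1)%N by rewrite /k; lia.
have k1 : (1 <= k)%N by rewrite /k; lia.
have rho2 : 2 <= rho by lra.
have r8 : 8 <= r by lra.
have r0 : 0 < r by lra.
have rho0 : 0 < rho by lra.
have rr1 : rho / r <= 1 by rewrite ler_pdivrMr// mul1r; lra.
have rr0 : 0 <= rho / r by rewrite divr_ge0 ?ltW.
have [zin|zout] := ltP (enorm R (z - a)) rho.
  apply: le_trans (inner _ zin); rewrite mulrAC ler_piMl//.
  by rewrite mulr_ile1 ?exprn_ge0 ?exprn_ile1 ?invf_le1 ?invr_ge0//; lra.
pose gr : R := r ^- k + r ^- k.+1.
pose Cst : R := 2 * (2 / rho) ^+ k.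
have Cst0 : 0 < Cst by rewrite mulr_gt0// exprn_gt0// divr_gt0.
have gr0 : 0 <= gr by rewrite addr_ge0// invr_ge0 exprn_ge0// ltW.
pose w y := m * (radial_low (y - a) + - gr) + - (Cst * u y).
have gbound y t : 0 < t -> t <= enorm R y -> radial_low y <= t ^- k + t ^- k.+1.
  move=> t0 ty; rewrite /radial_low k1E -/k -!isq_sqr ?(ltW t0)//.
  have yt : t ^+ 2 <= nsq y + 3.
    apply: (@le_trans _ _ (enorm R y ^+ 2)); last by rewrite sqr_enorm lerDl.
    by rewrite ler_sqr ?nnegrE ?enorm_ge0 ?(ltW t0).
  by rewrite lerD// /radial isq_nhomo// exprn_gt0.
have : w z <= 0.
  apply: (@maximum_principle R d d0 [set y | rho <= enorm R (y - a) < r] w a r).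
  - by move=> y /= /andP[_ /ltW].
  - move=> y /= /andP[y1 y2]; rewrite /w.
    rewrite avgD avgN avgZ avgZ avgD (avg_shift radial_low) (avg_cst d0).
    apply: lerD; last by rewrite lerN2 ler_pM2l// sup.
    by rewrite ler_wpM2l// lerD2r sub//; lra.
  - move=> y e /= /andP[y1 y2] se.
    have ye : enorm R (y - a) <= enorm R (y + e - a) + 1.
      rewrite (_ : y - a = (y + e - a) + - e); last first.
        by rewrite addrAC addrK.
      by apply: le_trans (enormD _ _) _; rewrite enormN (enorm_step se).
    move=> /negP; rewrite negb_and -ltNge -leNgt => /orP[yin|yout].
      have hin := inner _ yin.
      have : radial_low (y + e - a) <= Cst.
        apply: le_trans (@gbound _ (rho / 2) _ _) _; [lra|lra|].
        have p0 : 0 <= (rho / 2)^-1 ^+ k by rewrite exprn_ge0// invr_ge0; lra.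
        have p1 : (rho / 2)^-1 <= 1 by rewrite invf_le1; lra.
        rewrite /Cst -!exprVn invf_div exprS; rewrite invf_div in p0 p1; nra.
      rewrite /w => h; have : m * (radial_low (y + e - a) - gr) <= m * Cst.
        by rewrite ler_wpM2l//; lra.
      have : Cst * m <= Cst * u (y + e) by rewrite ler_pM2l.
      by rewrite (mulrC m Cst); lra.
    have : radial_low (y + e - a) <= gr by apply: gbound.
    rewrite /w => h; have : 0 <= Cst * u (y + e) by rewrite mulr_ge0// ltW.
    have : m * (radial_low (y + e - a) - gr) <= 0.
      by rewrite mulr_ge0_le0//; lra.
    by lra.
  - by rewrite /= zout/=; lra.
have low : r ^- k / 2 <= radial_low (z - a) - gr.
  (* The points at distance at most r / 2 have |z - a|^2 + 3 <= r^2 / 3, and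
     sqrt 3 > 1 + 1/8 + 1/2 leaves half of r^-k after subtracting both terms
     of gr. *)
  have s3 : 17 / 10 <= Num.sqrt 3 :> R.
    rewrite -[leLHS](@ger0_norm _ (17/10))//.
    by rewrite -sqrtr_sqr; apply: ler_wsqrtr; lra.
  have h1 : r ^- k * (17 / 10) <= radial 3 k (z - a).
    apply: (@le_trans _ _ (isq k (r ^+ 2 / 3))).
      rewrite isqM ?sqr_ge0// isq_sqr ?(ltW r0)// ler_pM2l ?invr_gt0 ?exprn_gt0//.
      rewrite /isq sqrtrV// invrK; move: k1; case: (k) => // k' _.
      rewrite exprS; have : 1 <= Num.sqrt 3 ^+ k' :> R by rewrite exprn_ege1//; lra.
      by nra.
    apply: isq_nhomo; first by rewrite ltr_wpDl ?nsq_ge0.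
    rewrite -sqr_enorm; have := enorm_ge0 (R := R) (z - a); nra.
  have h2 : 0 <= radial 3 (k.+1) (z - a) :> R.
    by apply: ltW; apply: isq_gt0; rewrite ltr_wpDl ?nsq_ge0.
  have h3 : r ^- k.+1 <= r ^- k * (1 / 8).
    rewrite exprSr invfM ler_wpM2l ?invr_ge0 ?exprn_ge0 ?(ltW r0)//.
    by rewrite div1r lef_pV2 ?posrE.
  have p0 : 0 < r ^- k by rewrite invr_gt0 exprn_gt0.
  rewrite /radial_low k1E -/k /gr; lra.
rewrite /w => hw.
have h4 : m * (r ^- k / 2) <= Cst * u z.
  apply: le_trans (_ : m * (radial_low (z - a) - gr) <= _); last by lra.
  by rewrite ler_wpM2l.
rewrite -(ler_pM2l Cst0); apply: le_trans h4; rewrite le_eqVlt; apply/orP; left; apply/eqP.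
rewrite /Cst dE !expr_div_n exprVn !exprS; field.
by rewrite !expf_neq0 ?gt_eqF.
Qed.

(** The shell estimate with radii in a fixed ratio: the loss is a constant. *)
Lemma superharmonic_step : exists r0 c : R, [/\ 1 <= r0, 0 < c &
  forall a r m u, r0 <= r -> 0 <= m ->
  (forall z, 0 <= u z) ->
  (forall z, enorm R (z - a) < r -> avg u z <= u z) ->
  (forall z, enorm R (z - a) < r / 4 -> m <= u z) ->
  forall z, enorm R (z - a) <= r / 2 -> c * m <= u z].
Proof.
have [m0 m02 H] := superharmonic_shell.
exists (4 * m0), (2^-1 ^+ d * (1 / 4) ^+ (d - 2)); split.
- by lra.
- by rewrite mulr_gt0 ?exprn_gt0// invr_gt0.
move=> a r m u r4 m_ge0 u0 sup inner z hz.
have := H a r (r / 4) m u; rewrite (_ : r / 4 / r = 1 / 4); last first.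
  by field; rewrite gt_eqF//; lra.
rewrite mulrAC; apply=> //; lra.
Qed.

(** Harnack chain: the large ball of each link contains the small ball of the
    next one, and each link costs the factor c. *)
Lemma superharmonic_chain : exists r0 c : R, [/\ 1 <= r0, 0 < c &
  forall (p : nat -> Zd d) n r m u, r0 <= r -> 0 <= m ->
  (forall z, 0 <= u z) ->
  (forall j, (j < n)%N -> enorm R (p j.+1 - p j) <= r / 4) ->
  (forall j z, (j < n)%N -> enorm R (z - p j) < r -> avg u z <= u z) ->
  (forall z, enorm R (z - p 0%N) < r / 4 -> m <= u z) ->
  c ^+ n * m <= u (p n)].
Proof.
have [r0 [c [r01 c0 H]]] := superharmonic_step.
exists r0, c; split=> // p n r m u rr m0 u0 near_ sup inner.
suff : forall j, (j <= n)%N -> forall z, enorm R (z - p j) < r / 4 -> c ^+ j * m <= u z.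
  by apply=> //; rewrite subrr enorm0; lra.
elim=> [|j IH] jn z hz; first by rewrite mul1r inner.
rewrite exprS -mulrA; apply: (H (p j) r) => //.
- by rewrite mulr_ge0// exprn_ge0// ltW.
- by move=> y; apply: sup.
- by apply: IH; exact: ltnW.
have := enorm_tri (R := R) z (p j.+1) (p j); have := near_ j jn; lra.
Qed.

(** Following a single path from the pole bounds the Green function below on a
    ball of fixed radius m0; the shell estimate extends the bound to the scale
    r. *)
Lemma green_ball_lower : exists r0 c : R, [/\ 1 <= r0, 0 < c &
  forall Om x r, r0 <= r -> (forall z, enorm R (z - x) < r -> Om z) ->
  forall z, enorm R (z - x) <= r / 2 -> c * r ^- (d - 2) <= green Om z x].
Proof.
have [m0 m02 H] := superharmonic_shell.
pose n := (Num.truncn (d%:R * m0)).+1.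
have nm : d%:R * m0 <= n%:R by apply: ltW; exact: truncnS_gt.
pose m : R := d.*2%:R^-1 ^+ n.
have m_gt0 : 0 < m by rewrite exprn_gt0// invr_gt0.
have N1 : d.*2%:R^-1 <= 1 :> R.
  by rewrite invf_le1// ler1n double_gt0.
exists (4 * m0), (2^-1 ^+ d * m * m0 ^+ (d - 2)); split.
- by lra.
- by rewrite mulr_gt0 ?exprn_gt0 ?mulr_gt0 ?exprn_gt0//; [rewrite invr_gt0|lra].
move=> Om x r r4 Omx z hz.
have r0 : 0 < r by lra.
rewrite -[X in X * r ^- _]mulrA -mulrA (_ : m * _ * _ = m * (m0 / r) ^+ (d - 2));
  last by rewrite expr_div_n mulrA.
rewrite mulrA.
apply: (H x r m0 m (fun z => green Om z x)) => //; first by lra.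
- exact: ltW.
- by move=> y; exact: green_ge0.
- by move=> y /Omx yO; rewrite (green_in d3 x yO) lerDr.
have low v : enorm R v < r -> d.*2%:R^-1 ^+ (l1 v) <= green Om (x + v) x :> R.
  move: v; apply: (@l1_ind d) => [|v e se lv IH] vr.
    rewrite addr0 l1_0 expr0 green_in ?eqxx ?lerDl//.
      by apply: (avg_ge0 d0) => e _; exact: green_ge0.
    by apply: Omx; rewrite subrr enorm0.
  have vr' : enorm R v < r by apply: le_lt_trans vr; exact: l1_path_norm.
  rewrite lv exprS; apply: le_trans (ler_wpM2l _ (IH vr')) _; first by rewrite invr_ge0.
  rewrite [leRHS]green_in//; last by apply: Omx; rewrite addrAC subrr add0r.
  apply: le_trans (_ : avg (fun z' => green Om z' x) (x + (v + e)) <= _); last first.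
    by rewrite lerDr.
  have := @avg_ge_term R d d0 (fun z' => green Om z' x) (x + (v + e)) (- e) (is_stepN se).
  by rewrite addrA addrK mulrC; apply=> e' _; exact: green_ge0.
move=> y hy; have := low (y - x); rewrite (addrC x) subrK => h.
apply: le_trans (h _); last by lra.
rewrite /m; apply: ler_wiXn2l => //.
rewrite -(ler_nat R); apply: le_trans (l1_enorm _) _; apply: le_trans nm.
by rewrite ler_wpM2l// ltW.
Qed.

End BallEstimates.

(** * Hitting probabilities as Green functions *)

Section HittingProbability.
Import numFieldNormedType.Exports.
Context {R : realType} {d : nat} (d3 : (3 <= d)%N).
Implicit Types (x y z e : Zd d) (Om K : set (Zd d)).

Let d0 : (0 < d)%N. Proof. by apply: leq_trans d3. Qed.
Let N0 : (0 < d.*2)%N. Proof. by rewrite double_gt0. Qed.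

Let mu : {measure set (measurableTypeR R) -> \bar R} := uniform_prob (@ltr01 R).

(** Probability that the walk from x is at y at time n, having spent the times
    0, ..., n - 1 in Om. *)
Fixpoint exit_kernel Om y (n : nat) x : R :=
  if n is m.+1 then (x \in Om)%:R * avg (exit_kernel Om y m) x else (x == y)%:R.

(** Reversed in time, a path that leaves Om at y is a path inside Om that
    starts at a neighbour of y. *)
Lemma exit_kernelE Om y n x :
  exit_kernel Om y n.+1 x = avg (fun z => walk_kernel Om n z x) y.
Proof.
elim: n x => [|n IH] x.
  rewrite /= /avg mulrCA; congr (_ * _); rewrite mulr_sumr.
  rewrite -(sum_steps_opp (fun e => ((y + e == x) && (y + e \in Om))%:R)).
  apply: eq_bigr => j _; rewrite -mulnb natrM subr_eq eq_sym.
  by case: eqP => [->|_]; rewrite ?addrK ?mul0r ?mulr0// mulr1 mul1r.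
rewrite [LHS](_ : _ = (x \in Om)%:R * avg (exit_kernel Om y n.+1) x)//.
transitivity ((x \in Om)%:R * avg (fun x' => avg (fun z => walk_kernel Om n z x') y) x : R).
  by congr (_ * _); apply: (avg_eq d0) => e _; exact: IH.
rewrite avg_exchange -avgZ.
by apply: (avg_eq d0) => e _; rewrite walk_kernel_backward.
Qed.

Lemma measurable_digit (n j : nat) :
  measurable [set a : measurableTypeR R | digit d.*2 n a = j].
Proof.
apply: (@measurable_fiber_comp R nat _
  (fun a => Num.truncn (d.*2%:R ^+ n.+1 * a)) (modn^~ d.*2)) => m.
by apply: measurable_truncn; rewrite exprn_ge0.
Qed.

(** The first k digits are prescribed and the next n steps carry the event.
    Splitting according to the next digit makes the probability computable by
    induction on n, which stands in for the Markov property. *)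
Definition exit_event x Om y (k : nat) (c : nat -> nat) (n : nat) :
    set (measurableTypeR R) :=
  [set a | [/\ forall i, (i < k)%N -> digit d.*2 i a = c i,
    forall i, (i < n)%N -> Om (walk x a (k + i)%N) & walk x a (k + n)%N = y]].

Lemma measurable_exit_event x Om y k c n : measurable (exit_event x Om y k c n).
Proof.
rewrite (_ : exit_event _ _ _ _ _ _ =
    (\bigcap_(i in [set i | (i < k)%N]) [set a | digit d.*2 i a = c i]) `&`
    ((\bigcap_(i in [set i | (i < n)%N]) [set a | (walk x a (k + i)%N \in Om) = true]) `&`
     [set a | walk x a (k + n)%N = y])); last first.
  apply/seteqP; split=> a /=.
    move=> [h1 h2 h3]; split=> //; split=> // i ni; exact/mem_set/h2.
  by move=> [h1 [h2 h3]]; split=> // i ni; apply/set_mem/h2.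
apply: measurableI; first by apply: bigcap_measurableType => i _; exact: measurable_digit.
apply: measurableI; last exact: measurable_walk_fiber.
apply: bigcap_measurableType => i _.
apply: (@measurable_fiber_comp R (Zd d) bool (fun a => walk x a (k + i)%N)
  (fun z => z \in Om)) => z.
exact: measurable_walk_fiber.
Qed.

(** One more prescribed digit multiplies the probability by 1/(2d), and the
    sum over its 2 d values is a one-step average. *)
Lemma exit_event_prob x Om y n k c : (forall i, (i < k)%N -> (c i < d.*2)%N) ->
  mu (exit_event x Om y k c n) =
  (d.*2%:R ^- k * exit_kernel Om y n (x + \sum_(i < k) unit_step d (c i)))%:E.
Proof.
elim: n k c => [|n IH] k c ck.
  set xk := x + _.
  have wk (a : R) : (forall i, (i < k)%N -> digit d.*2 i a = c i) -> walk x a k = xk.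
    by move=> h; rewrite /walk /xk; congr (_ + _); apply: eq_bigr => i _; rewrite h.
  rewrite /=; case: eqP => [xy|xy].
    rewrite mulr1; apply: (@uniform_prob_digits _ d.*2 k c) => //.
      exact: measurable_exit_event.
    move=> a _; rewrite /exit_event/=; split=> [[]//|h].
    by split=> //; rewrite addn0 wk.
  rewrite mulr0 (_ : exit_event _ _ _ _ _ _ = set0) ?measure0//.
  apply/seteqP; split=> a //= -[h _]; rewrite addn0 wk// => ?; exact: xy.
set xk := x + _.
have wk (a : R) : (forall i, (i < k)%N -> digit d.*2 i a = c i) -> walk x a k = xk.
  by move=> h; rewrite /walk /xk; congr (_ + _); apply: eq_bigr => i _; rewrite h.
rewrite /=; have [xO|xO] := pselect (Om xk); last first.
  rewrite memNset// mul0r mulr0 (_ : exit_event _ _ _ _ _ _ = set0) ?measure0//.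
  apply/seteqP; split=> a //= -[h1 h2 _]; apply: xO; rewrite -(wk a h1).
  by have := h2 0%N isT; rewrite addn0.
rewrite mem_set// mul1r.
pose cj (j i : nat) := if i == k then j else c i.
pose F (j : nat) := exit_event x Om y k.+1 (cj j) n.
have cjk j i : (i < k)%N -> cj j i = c i.
  by move=> ik; rewrite /cj ltn_eqF.
have -> : exit_event x Om y k c n.+1 = \big[setU/set0]_(j < d.*2) F j.
  rewrite -bigcup_mkord; apply/seteqP; split=> a /=.
    move=> [h1 h2 h3]; exists (digit d.*2 k a); first by rewrite /= ltn_mod.
    split=> [i|i ni|]; last by rewrite addSnnS.
      rewrite ltnS leq_eqVlt => /predU1P[->|ik]; first by rewrite /cj eqxx.
      by rewrite cjk// h1.
    by rewrite addSnnS; exact: h2.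
  move=> [j /= jN [h1 h2 h3]].
  have hk i : (i < k)%N -> digit d.*2 i a = c i.
    by move=> ik; rewrite h1 ?cjk// ltnS ltnW.
  split=> //; last by rewrite -addSnnS.
  case=> [|i] ni; first by rewrite addn0 wk.
  by rewrite -addSnnS; exact: h2.
rewrite measure_semi_additive_ord_I.
- rewrite (eq_bigr (fun j : 'I_(d.*2) => ((d.*2%:R ^- k.+1) *
     exit_kernel Om y n (xk + unit_step d j))%:E)); last first.
    move=> j _; apply: etrans (IH k.+1 (cj j) _) _.
      by move=> i ik1; rewrite /cj; case: eqP => // /eqP ik; apply: ck; lia.
    congr (_ * _)%:E; congr (exit_kernel _ _ _ _).
    rewrite big_ord_recr/= addrA /cj eqxx /xk; congr (_ + _ + _).
    by apply: eq_bigr => i _; rewrite ltn_eqF.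
  rewrite sumEFin -mulr_sumr; congr (_%:E).
  by rewrite exprSr invfM -mulrA.
- by move=> j _; exact: measurable_exit_event.
- apply/trivIsetP => i j /= _ _ ij; apply/seteqP; split=> a //= -[[h1 _ _] [h2 _ _]].
  move/eqP: ij; apply; have := h1 k (ltnSn k); have := h2 k (ltnSn k).
  by rewrite /cj eqxx => -> ->.
- by apply: bigsetU_measurable => j _; exact: measurable_exit_event.
Qed.

Definition passage Om y : set (nat -> Zd d) :=
  [set w | exists2 n : nat, (forall k, (k < n)%N -> Om (w k)) & w n = y].

(** By reversibility the probability of leaving Om from x at y is the expected
    number of visits to x of the walk killed outside Om and started from a
    random neighbour of y. *)
Definition hit Om y x : R := avg (fun z => green Om z x) y.

(** The events of leaving at time n are disjoint, and each has the probability
    given by the exit kernel; summed over n these kernels are averages of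
    partial Green sums. *)
Lemma srw_passage Om y x : ~ Om y -> x != y ->
  srw R x (passage Om y) = (hit Om y x)%:E.
Proof.
move=> yO xy; rewrite srwE.
pose F n := exit_event x Om y 0 (fun=> 0%N) n.
have -> : [set a | passage Om y (walk x a)] = \bigcup_n F n.
  by apply/seteqP; split=> a /= [n]; [move=> h1 h2; exists n|move=> _ [_ h1 h2]; exists n].
rewrite -/mu measure_bigcup; last 2 first.
- by move=> n _; exact: measurable_exit_event.
- apply/trivIsetP => i j _ _ ij; apply/seteqP; split=> a //= -[[_ h1 h2] [_ h3 h4]].
  rewrite !add0n in h2 h4.
  have [lt|lt|eq] := ltngtP i j.
  + by apply: yO; rewrite -h2; exact: h3.
  + by apply: yO; rewrite -h4; exact: h1.
  + by rewrite eq eqxx in ij.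
rewrite (eq_eseriesr (g := fun n => (exit_kernel Om y n x)%:E)); last first.
  by move=> n _; rewrite exit_event_prob// expr0 invr1 mul1r big_ord0 addr0.
rewrite (eq_eseriesl (Q := xpredT)); last by move=> n; rewrite in_setT.
apply: cvg_lim => //; rewrite -cvg_shiftS.
have -> : [sequence (\sum_(0 <= n < N.+1) (exit_kernel Om y n x)%:E)%E]_N =
    EFin \o (fun N => avg (fun z => green_sum Om N z x) y).
  apply/funext => N /=; rewrite sumEFin big_nat_recl//.
  rewrite (_ : exit_kernel Om y 0 x = 0); last by rewrite /= (negbTE xy).
  rewrite add0r; congr EFin; rewrite big_mkord.
  under eq_bigr do rewrite exit_kernelE.
  by rewrite /green_sum /avg -mulr_sumr; congr (_ * _); exact: exchange_big.
apply: cvg_EFin; first by near=> N.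
by apply: cvg_avg => z; exact: green_cvg.
Unshelve. all: by end_near. Qed.

Lemma entrance_timeP K (w : nat -> Zd d) (n : nat) :
  entrance_time R K w = n%:R%:E <-> K (w n) /\ forall k, (k < n)%N -> ~ K (w k).
Proof.
rewrite /entrance_time; split=> [h|[Kn Kk]].
  have nK k : (k < n)%N -> ~ K (w k).
    move=> kn Kk; have : (ereal_inf [set k0%:R%:E | k0 in [set k0 : nat | K (w k0)]] <= k%:R%:E :> \bar R)%E.
      by apply: ereal_inf_lbound; exists k.
    by rewrite h lee_fin ler_nat leqNgt kn.
  split=> //; apply: contrapT => Kn.
  have : ((n.+1)%:R%:E <= ereal_inf [set k0%:R%:E | k0 in [set k0 : nat | K (w k0)]] :> \bar R)%E.
    apply: le_ereal_inf_tmp => _ [k /= Kk <-]; rewrite lee_fin ler_nat ltnNge leq_eqVlt.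
    by apply/negP => /predU1P[kn|/nK//]; apply: Kn; rewrite -kn.
  by rewrite h lee_fin ler_nat ltnn.
apply/eqP; rewrite eq_le; apply/andP; split; first by apply: ereal_inf_lbound; exists n.
apply: le_ereal_inf_tmp => _ [k /= Kk' <-]; rewrite lee_fin ler_nat leqNgt.
by apply/negP => /Kk.
Qed.

Lemma enters_atE K y : K y -> enters_at R K y = passage (~` K) y.
Proof.
move=> Ky; apply/seteqP; split=> w /=.
  by move=> [n /entrance_timeP[_ h] wn]; exists n.
by move=> [n h wn]; exists n => //; apply/entrance_timeP; rewrite wn.
Qed.

(** Since y lies in B, entering K at y before leaving B means that the walk
    stays in B and out of K until it reaches y. *)
Lemma enters_beforeE K B y : K y -> B y ->
  enters_at R K y `&` enters_before R K (~` B) = passage (~` K `&` B) y.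
Proof.
move=> Ky By; apply/seteqP; split=> w /=.
  move=> [[n hn wn]]; have /entrance_timeP[_ h] := hn.
  rewrite /enters_before/= hn => lt; exists n => // k kn; split; first exact: h.
  apply: contrapT => nB.
  have : (entrance_time R (~` B) w <= k%:R%:E)%E by apply: ereal_inf_lbound; exists k.
  move/(lt_le_trans lt); rewrite lte_fin ltr_nat; lia.
move=> [n h wn].
have hn : entrance_time R K w = n%:R%:E.
  by apply/entrance_timeP; rewrite wn; split=> // k /h[].
split; first by exists n.
rewrite /enters_before/= hn; apply: (@lt_le_trans _ _ (n.+1)%:R%:E).
  by rewrite lte_fin ltr_nat.
apply: le_ereal_inf_tmp => _ [k /= nB <-]; rewrite lee_fin ler_nat ltnNge leq_eqVlt.
apply/negP => /predU1P[kn|/h[]//]; apply: nB; by rewrite kn wn.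
Qed.

Lemma srw_enters_at K y x : K y -> x != y ->
  srw R x (enters_at R K y) = (hit (~` K) y x)%:E.
Proof. by move=> Ky xy; rewrite enters_atE// srw_passage// => nK; exact: nK. Qed.

Lemma srw_enters_before K B y x : K y -> B y -> x != y ->
  srw R x (enters_at R K y `&` enters_before R K (~` B)) =
  (hit (~` K `&` B) y x)%:E.
Proof. by move=> Ky By xy; rewrite enters_beforeE// srw_passage// => -[nK _]; exact: nK. Qed.

End HittingProbability.

(** * Barriers near a smooth boundary *)

Section Profile.
Context {R : realType} {d : nat} (d0 : (0 < d)%N).
Implicit Types (x y z e v : Zd d) (u : Zd d -> R) (m l : R).

(** A discrete signed distance to a hypersurface that is smooth at scale
    sigma. The last condition is the nondegeneracy of the zero level: it
    replaces |grad delta| = 1, and is asked in the strip where it is used. *)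
Definition profile (sigma a : R) (delta : Zd d -> R) : Prop := [/\
  forall x e, is_step e -> `|delta (x + e) - delta x| <= 1,
  forall x e e', is_step e -> is_step e' ->
    `|delta (x + e + e') - delta (x + e) - delta (x + e') + delta x| <= sigma^-1 &
  forall x, `|delta x| <= a * sigma ->
    exists2 e, is_step e & a <= delta (x + e) - delta x].

Definition grad (delta : Zd d -> R) z (i : 'I_d) : R := delta (z + ev i) - delta z.

(** Telescoping along a shortest path. *)
Lemma lipschitz_l1 (f : Zd d -> R) (c : R) : 0 <= c ->
  (forall x e, is_step e -> `|f (x + e) - f x| <= c) ->
  forall x v, `|f (x + v) - f x| <= c * (l1 v)%:R.
Proof.
move=> c0 H x; apply: l1_ind => [|v e se lv IH]; first by rewrite addr0 subrr normr0 mulr_ge0.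
rewrite (_ : _ - _ = (f (x + v + e) - f (x + v)) + (f (x + v) - f x)); last first.
  by rewrite addrA addrA subrK.
apply: le_trans (ler_normD _ _) _; apply: le_trans (lerD (H _ _ se) IH) _.
by rewrite lv -natr1 mulrDr mulr1 addrC.
Qed.

Section Taylor.
Context (sigma : R) (delta : Zd d -> R) (s0 : 0 < sigma).
Context (H2 : forall x e e', is_step e -> is_step e' ->
  `|delta (x + e + e') - delta (x + e) - delta (x + e') + delta x| <= sigma^-1).

Let is0 : 0 < sigma^-1. Proof. by rewrite invr_gt0. Qed.

Lemma increment_lipschitz e z v : is_step e ->
  `|(delta (z + v + e) - delta (z + v)) - (delta (z + e) - delta z)| <=
    sigma^-1 * (l1 v)%:R.
Proof.
move=> se.
have := @lipschitz_l1 (fun x => delta (x + e) - delta x) sigma^-1 (ltW is0) _ z v.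
apply=> x e' se'; have := H2 x se' se.
by rewrite [in X in X -> _](_ : _ + _ = delta (x + e' + e) - delta (x + e') -
  (delta (x + e) - delta x))//; ring.
Qed.

Lemma increment_opp z i :
  `|(delta (z - ev i) - delta z) + grad delta z i| <= sigma^-1.
Proof.
have se : is_step (ev i) by exists i; left.
have := H2 z se (is_stepN se).
rewrite addrK -normrN; congr (`|_| <= _); rewrite /grad; ring.
Qed.

(** First order Taylor expansion along lattice paths: each step adds an error
    proportional to the distance covered so far. *)
Lemma linear_approx z v :
  `|delta (z + v) - delta z - \sum_i (v 0 i)%:~R * grad delta z i| <=
    sigma^-1 * (l1 v)%:R ^+ 2.
Proof.
move: v; apply: l1_ind => [|v e se lv IH].
  rewrite addr0 subrr l1_0 expr0n mulr0 big1 ?subr0 ?normr0// => i _.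
  by rewrite mxE mul0r.
have inc := @increment_lipschitz e z v se.
have [q qE qb] : exists2 q : R, \sum_i ((v + e) 0 i)%:~R * grad delta z i =
     \sum_i (v 0 i)%:~R * grad delta z i + q &
    `|(delta (z + e) - delta z) - q| <= sigma^-1.
  case: se => i [->|->].
    exists (grad delta z i); last by rewrite /grad subrr normr0 ltW.
    rewrite (bigD1 i)//= [in RHS](bigD1 i)//= !mxE !eqxx/= rmorphD/= mulrDl mul1r.
    rewrite addrAC; congr (_ + _ + _); apply: eq_bigr => k ki.
    by rewrite !mxE (negbTE ki) andbF addr0.
  exists (- grad delta z i); last by rewrite opprK; exact: increment_opp.
  rewrite (bigD1 i)//= [in RHS](bigD1 i)//= !mxE !eqxx/= rmorphB/= mulrBl mul1r.
  rewrite addrAC; congr (_ + _ + _); apply: eq_bigr => k ki.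
  by rewrite !mxE (negbTE ki) andbF subr0.
rewrite qE lv.
set S := \sum_i _ in IH *; set L := (l1 v)%:R in IH inc *.
rewrite (_ : _ - _ = (delta (z + v) - delta z - S) +
   ((delta (z + v + e) - delta (z + v) - (delta (z + e) - delta z)) +
    (delta (z + e) - delta z - q))); last by rewrite !addrA; ring.
apply: le_trans (ler_normD _ _) _.
apply: le_trans (lerD IH (le_trans (ler_normD _ _) (lerD inc qb))) _.
have L0 : 0 <= L by [].
rewrite -natr1 -/L -[X in _ + (_ + X)]mulr1 -!mulrDr ler_pM2l//; nra.
Qed.

End Taylor.

Context (sigma a : R) (delta : Zd d -> R).
Context (a0 : 0 < a) (a1 : a <= 1) (s0 : 0 < sigma) (P : profile sigma a delta).

Let H1 : forall x e, is_step e -> `|delta (x + e) - delta x| <= 1.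
Proof. by case: P. Qed.
Let H2 : forall x e e', is_step e -> is_step e' ->
  `|delta (x + e + e') - delta (x + e) - delta (x + e') + delta x| <= sigma^-1.
Proof. by case: P. Qed.
Let H3 : forall x, `|delta x| <= a * sigma ->
    exists2 e, is_step e & a <= delta (x + e) - delta x.
Proof. by case: P. Qed.
Let N0 : 0 < d.*2%:R :> R. Proof. exact: twod_gt0. Qed.
Let is0 : 0 < sigma^-1. Proof. by rewrite invr_gt0. Qed.

Lemma profile_lipschitz x v : `|delta (x + v) - delta x| <= (l1 v)%:R.
Proof. by rewrite -[leRHS]mul1r; apply: lipschitz_l1. Qed.

Lemma profile_linear_approx z v :
  `|delta (z + v) - delta z - \sum_i (v 0 i)%:~R * grad delta z i| <=
    sigma^-1 * (l1 v)%:R ^+ 2.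
Proof. exact: linear_approx. Qed.

Lemma profile_laplacian x : `|avg delta x - delta x| <= sigma^-1.
Proof.
have -> : avg delta x - delta x =
    (d.*2%:R)^-1 * \sum_(i < d) ((delta (x - ev i) - delta x) + grad delta x i).
  have e : delta x = (d.*2%:R)^-1 * (d.*2%:R * delta x) by rewrite mulKf ?gt_eqF.
  rewrite avg_ev [X in _ - X = _]e -mulrBr; congr (_ * _).
  rewrite (_ : d.*2%:R * delta x = \sum_(i < d) (delta x + delta x)); last first.
    by rewrite sumr_const card_ord twodE -[RHS]mulr_natl; ring.
  rewrite -sumrB; apply: eq_bigr => i _; rewrite /grad; ring.
rewrite normrM ger0_norm ?invr_ge0// ler_pdivrMl//.
apply: le_trans (ler_norm_sum _ _ _) _.
apply: le_trans (_ : \sum_(i < d) sigma^-1 <= _).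
  by apply: ler_sum => i _; exact: (increment_opp H2).
rewrite sumr_const card_ord -[leLHS]mulr_natl twodE ler_wpM2r ?(ltW is0)//.
by have : 0 <= d%:R :> R by []; lra.
Qed.

(** The average of delta^2 exceeds delta^2 by the mean square of the
    increments, and the increasing step alone contributes a^2 / (2d); the
    drift of delta itself costs the last term. *)
Lemma profile_sqr_laplacian x : 0 <= delta x -> delta x <= a * sigma ->
  delta x ^+ 2 + a ^+ 2 / d.*2%:R - 2 * delta x * sigma^-1 <=
    avg (fun z => delta z ^+ 2) x.
Proof.
have a0' := a0.
move=> dx0 dx1.
have [e se he] : exists2 e, is_step e & a <= delta (x + e) - delta x.
  by apply: H3; rewrite ger0_norm.
pose g z := (delta z - delta x) ^+ 2.
have -> : avg (fun z => delta z ^+ 2) x =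
    delta x ^+ 2 + (2 * delta x) * (avg delta x - delta x) + avg g x.
  transitivity (avg (fun z => (- delta x ^+ 2 + (2 * delta x) * delta z) + g z) x).
    by apply: (avg_eq d0) => e' _; rewrite /g; ring.
  rewrite avgD avgD avgZ (avg_cst d0); ring.
have hg : a ^+ 2 / d.*2%:R <= avg g x.
  have := @avg_ge_term R d d0 g x e se (fun e _ => sqr_ge0 _); apply: le_trans.
  rewrite ler_pM2r ?invr_gt0// /g -subr_ge0 subr_sqr.
  by apply: mulr_ge0; move: a0 he; lra.
have := profile_laplacian x; rewrite ler_norml => /andP[h _].
have : 0 <= (2 * delta x) * (avg delta x - delta x + sigma^-1).
  by rewrite mulr_ge0//; lra.
lra.
Qed.

(** The coefficient of the quadratic correction of the barriers, large enough
    that kappa times the gain a^2 / (2d) is 4. *)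
Definition kappa : R := 8 * d%:R / a ^+ 2.
(** At heights below eta * l the correction kappa/l * delta^2 is at most delta
    / 2, so that the barriers remain comparable to delta. *)
Definition eta : R := (2 * kappa)^-1.

Lemma kappa_ge8 : 8 <= kappa.
Proof.
have d1 : 1 <= d%:R :> R by rewrite ler1n.
rewrite /kappa ler_pdivlMr ?exprn_gt0//; have : a ^+ 2 <= 1 by move: a0 a1; nra.
nra.
Qed.

Lemma kappaE : kappa * (a ^+ 2 / d.*2%:R) = 4.
Proof.
rewrite /kappa twodE; field; rewrite !pnatr_eq0 -!lt0n d0/=.
by rewrite gt_eqF.
Qed.

Lemma etaE : eta * kappa = 1 / 2.
Proof. by rewrite /eta; field; have := kappa_ge8; lra. Qed.

Lemma eta_gt0 : 0 < eta.
Proof. by rewrite /eta invr_gt0; have := kappa_ge8; lra. Qed.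

Lemma eta_le : eta <= 1 / 16.
Proof. have := etaE; have := kappa_ge8; have := eta_gt0; nra. Qed.

Section Barrier.
Context (l : R) (l4 : 4 * kappa <= l) (ls : l * kappa <= sigma).

Let k8 := kappa_ge8.
Let l32 : 32 <= l. Proof. by move: l4 kappa_ge8; lra. Qed.
Let l0 : 0 < l. Proof. by move: l32; lra. Qed.
Let sl : sigma^-1 * (l * kappa) <= 1.
Proof. by rewrite ler_pdivrMl// mulr1. Qed.
Let kl : kappa / l <= 1 / 4.
Proof. by rewrite ler_pdivrMr//; move: l4; lra. Qed.
Let kl0 : 0 < kappa / l. Proof. by rewrite divr_gt0//; move: k8; lra. Qed.

Let etal_le : eta * l <= a * sigma.
Proof.
have a0' := a0; have a1' := a1; have k8' := k8; have l0' := l0.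
have ka : 1 <= kappa * a.
  rewrite /kappa (_ : _ * a = 8 * d%:R / a); last by field; rewrite gt_eqF.
  rewrite ler_pdivlMr// mul1r; have d1 : 1 <= d%:R :> R by rewrite ler1n.
  lra.
have : l <= a * sigma.
  by apply: (@le_trans _ _ (a * (l * kappa))); [nra|rewrite ler_pM2l].
by have := eta_le; have := eta_gt0; nra.
Qed.

(** The quadratic correction dominates the curvature of the profile, with 2/l
    to spare: one half for the term |z - x0|^2/l of the barriers, which has
    Laplacian 1/l. *)
Lemma barrier_laplacian x : 0 < delta x -> delta x < eta * l ->
  2 / l <= kappa / l * (avg (fun z => delta z ^+ 2) x - delta x ^+ 2) - sigma^-1.
Proof.
have a0' := a0; have a1' := a1; have k8' := k8; have l0' := l0; have sl' := sl.
have kl' := kl; have kl0' := kl0; have l32' := l32; have e0 := eta_gt0; have e16 := eta_le.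
have ek0 := etaE; have is0' := is0.
move=> dx0 dx1.
have h := @profile_sqr_laplacian x (ltW dx0) (le_trans (ltW dx1) etal_le).
have h2 : 2 * delta x * sigma^-1 <= a ^+ 2 / d.*2%:R / 4.
  have kpos : 0 < kappa by lra.
  rewrite -(ler_pM2r kpos) (_ : _ / 4 * kappa = 1); last first.
    by rewrite mulrAC (mulrC _ kappa) kappaE divff.
  apply: le_trans sl'; rewrite mulrAC (mulrC sigma^-1) ler_pM2r//.
  by rewrite mulrAC; nra.
have h3 : sigma^-1 <= 1 / l.
  rewrite ler_pdivlMr//; apply: le_trans sl; rewrite ler_pM2l//; nra.
have h4 : kappa / l * (a ^+ 2 / d.*2%:R * (3/4)) = 3 / l.
  rewrite (_ : _ * _ = kappa * (a ^+ 2 / d.*2%:R) * (3/4) / l); last by rewrite -!mulrA; ring.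
  by rewrite kappaE; field; rewrite gt_eqF.
have : kappa / l * (a ^+ 2 / d.*2%:R * (3/4)) <=
   kappa / l * (avg (fun z => delta z ^+ 2) x - delta x ^+ 2).
  by rewrite ler_pM2l//; lra.
by rewrite h4; move: h3; lra.
Qed.

Local Ltac clear_local := clear - d0 a0 a1 s0 P H1 H2 H3 N0 is0 l4 ls k8 l32 l0 sl kl kl0 etal_le.
Local Tactic Notation "lra_from" hyp_list(hs) :=
  revert hs; clear - d0 a0 a1 s0 P H1 H2 H3 N0 is0 l4 ls k8 l32 l0 sl kl kl0 etal_le; intros; lra.
Local Tactic Notation "nra_from" hyp_list(hs) :=
  revert hs; clear - d0 a0 a1 s0 P H1 H2 H3 N0 is0 l4 ls k8 l32 l0 sl kl kl0 etal_le; intros; nra.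

(** A slab of height eta * l over a piece of the boundary of diameter of order
    l. *)
Let Reg x0 := [set z | [&& 0 < delta z, delta z < eta * l & enorm R (z - x0) < l]].

Let step_dist z e x0 : is_step e -> enorm R (z + e - x0) <= enorm R (z - x0) + 1.
Proof.
move=> se; rewrite addrAC; apply: le_trans (enormD _ _) _.
by rewrite (enorm_step se).
Qed.

(** A walk started at height h above the boundary has probability at most of
    order h/l to travel distance l before hitting it. The barrier V = 2 +
    delta - kappa/l * delta^2 + |z - x0|^2/l is superharmonic in the slab,
    nonnegative below the boundary, and of order l both at height eta * l and
    at distance l from x0. *)
Lemma escape_upper m x0 u : 0 <= m -> 0 < delta x0 ->
  (forall z, 0 < delta z -> enorm R (z - x0) < l -> u z <= avg u z) ->
  (forall z, delta z <= 0 -> u z <= 0) ->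
  (forall z, 0 < delta z -> enorm R (z - x0) <= l + 1 -> u z <= m) ->
  u x0 <= 4 * m / (eta * l) * (2 + delta x0).
Proof.
have a0' := a0; have a1' := a1; have k8' := k8; have l0' := l0; have sl' := sl.
have kl' := kl; have kl0' := kl0; have l32' := l32; have e0 := eta_gt0; have e16 := eta_le.
have ek0 := etaE; have is0' := is0.
move=> m0 dx0 sub out bd.
have el0 : 0 < eta * l by rewrite mulr_gt0// eta_gt0.
have [xin|xout] := ltP (delta x0) (eta * l); last first.
  apply: le_trans (bd _ dx0 _) _; first by rewrite subrr enorm0; lra.
  rewrite mulrAC ler_pdivlMr//.
  have : 0 <= m * (4 * (2 + delta x0) - eta * l) by apply: mulr_ge0; lra.
  lra.
pose V z := 2 + delta z + (- (kappa / l) * delta z ^+ 2 + l^-1 * nsq (z - x0)).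
have q0 (z : Zd d) : 0 <= nsq z :> R by exact: nsq_ge0.
have il0 : 0 < l^-1 by rewrite invr_gt0.
pose w z := eta * l / 4 * u z + - (m * V z).
have : w x0 <= 0.
  apply: (@maximum_principle R d d0 (Reg x0) w x0 l).
  - by move=> z /and3P[_ _ /ltW].
  - move=> z /and3P[z1 z2 z3]; rewrite /w avgD avgN !avgZ.
    apply: lerD; first by rewrite ler_pM2l ?divr_gt0// sub.
    rewrite lerN2 ler_wpM2l// /V !avgD !avgZ (avg_cst d0) (avg_shift nsq) (avg_nsq d0).
    have := barrier_laplacian z1 z2.
    have := profile_laplacian z; rewrite ler_norml => /andP[_].
    rewrite !mulrDr; lra.
  - move=> z e /and3P[z1 z2 z3] se nR.
    have zd : enorm R (z + e - x0) <= l + 1.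
      by apply: le_trans (step_dist _ _ se) _; lra.
    have := H1 z se; rewrite ler_norml => /andP[i1 i2].
    have nq := q0 (z + e - x0); have nlq : 0 <= l^-1 * nsq (z + e - x0).
      by rewrite mulr_ge0// ltW.
    have [zp|zn] := ltP 0 (delta (z + e)); last first.
      have V0 : 0 <= V (z + e).
        have : delta (z + e) ^+ 2 <= 1 by nra_from z1 i1 zn.
        rewrite /V => hd; have : kappa / l * delta (z + e) ^+ 2 <= 1 / 4.
          by apply: le_trans kl; rewrite ler_piMr// ltW.
        by lra_from z1 i1 nlq.
      have := out _ zn; rewrite /w => un.
      have : eta * l / 4 * u (z + e) <= 0 by rewrite mulr_ge0_le0// ltW// divr_gt0.
      have : 0 <= m * V (z + e) by rewrite mulr_ge0.
      by clear_local; lra.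
    suff hV : eta * l / 4 <= V (z + e).
      have := bd _ zp zd; rewrite /w => um.
      have : eta * l / 4 * u (z + e) <= eta * l / 4 * m by rewrite ler_pM2l// divr_gt0.
      have : m * (eta * l / 4) <= m * V (z + e) by rewrite ler_wpM2l.
      by rewrite (mulrC m); clear_local; lra.
    have qE (t : R) : t - kappa / l * t ^+ 2 = t * (1 - kappa / l * t) by ring.
    have ek : kappa / l * (eta * l) = 1 / 2.
      by rewrite -etaE; field; rewrite gt_eqF.
    have [zl|zl] := ltP (delta (z + e)) (eta * l); last first.
      have : kappa / l * delta (z + e) <= 3 / 4.
        have : kappa / l * delta (z + e) <= kappa / l * (eta * l + 1).
          by rewrite ler_pM2l//; lra_from z2 i2.
        by rewrite mulrDr ek mulr1; lra_from kl'.
      have := qE (delta (z + e)); rewrite /V; set t := delta (z + e) in zl zp *.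
      set k := kappa / l * t.
      by rewrite (_ : - (kappa / l) * t ^+ 2 = - (kappa / l * t ^+ 2)); [nra_from nlq zl zp|ring].
    have lz : l <= enorm R (z + e - x0).
      rewrite leNgt; apply/negP => zr; apply: nR.
      by rewrite /Reg /= zp zl zr.
    have ll : l <= l^-1 * nsq (z + e - x0).
      by rewrite ler_pdivlMl// -sqr_enorm -expr2 ler_sqr ?nnegrE ?enorm_ge0// ltW.
    have : kappa / l * delta (z + e) <= 1 / 2.
      by rewrite -ek ler_pM2l// ltW.
    have := qE (delta (z + e)); rewrite /V; set t := delta (z + e) in zl zp *.
    rewrite (_ : - (kappa / l) * t ^+ 2 = - (kappa / l * t ^+ 2)); last by ring.
    have := eta_le; have := eta_gt0; nra_from nlq ll zp.
  - by rewrite /Reg /= dx0 xin subrr enorm0.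
rewrite /w /V subrr (_ : nsq 0 = 0 :> R); last by rewrite /nsq big1// => i _; rewrite mxE expr0n.
rewrite mulr0 addr0 => hw; rewrite mulrAC ler_pdivlMr//.
have : 0 <= m * (kappa / l * delta x0 ^+ 2) by rewrite mulr_ge0// mulr_ge0 ?sqr_ge0// ltW.
lra.
Qed.

(** The matching lower bound. The barrier V = delta + kappa/l * delta^2 - |z -
    x0|^2/l is subharmonic in the slab, nonpositive below the boundary and at
    distance l from x0, and at most 2 l where the slab is left through its
    top. *)
Lemma escape_lower_aux m x0 u : 0 <= m -> 0 < delta x0 ->
  (forall z, 0 <= u z) ->
  (forall z, 0 < delta z -> enorm R (z - x0) < l -> avg u z <= u z) ->
  (forall z, eta * l <= delta z -> enorm R (z - x0) <= l + 1 -> m <= u z) ->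
  m <= u x0 \/ m / (2 * l) * delta x0 <= u x0.
Proof.
have a0' := a0; have a1' := a1; have k8' := k8; have l0' := l0; have sl' := sl.
have kl' := kl; have kl0' := kl0; have l32' := l32; have e0 := eta_gt0; have e16 := eta_le.
have ek0 := etaE; have is0' := is0.
move=> m0 dx0 u0 sup bd.
have el0 : 0 < eta * l by rewrite mulr_gt0// eta_gt0.
have [xin|xout] := ltP (delta x0) (eta * l); last first.
  by left; apply: bd => //; rewrite subrr enorm0; lra.
right.
pose V z := delta z + (kappa / l * delta z ^+ 2 + - l^-1 * nsq (z - x0)).
have q0 (z : Zd d) : 0 <= nsq z :> R by exact: nsq_ge0.
have il0 : 0 < l^-1 by rewrite invr_gt0.
have ek : kappa / l * (eta * l) = 1 / 2.
  by rewrite -etaE; field; rewrite gt_eqF.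
pose w z := m * V z + - (2 * l * u z).
have l20 : 0 < 2 * l by rewrite mulr_gt0.
have : w x0 <= 0.
  apply: (@maximum_principle R d d0 (Reg x0) w x0 l).
  - by move=> z /and3P[_ _ /ltW].
  - move=> z /and3P[z1 z2 z3]; rewrite /w avgD avgN !avgZ.
    apply: lerD; last by rewrite lerN2 ler_pM2l ?sup.
    rewrite ler_wpM2l// /V !avgD !avgZ (avg_shift nsq) (avg_nsq d0).
    have := barrier_laplacian z1 z2.
    have := profile_laplacian z; rewrite ler_norml => /andP[].
    rewrite !mulrDr; lra.
  - move=> z e /and3P[z1 z2 z3] se nR.
    have zd : enorm R (z + e - x0) <= l + 1.
      by apply: le_trans (step_dist _ _ se) _; lra.
    have := H1 z se; rewrite ler_norml => /andP[i1 i2].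
    have nq := q0 (z + e - x0); have nlq : 0 <= l^-1 * nsq (z + e - x0).
      by rewrite mulr_ge0// ltW.
    have uz : 0 <= 2 * l * u (z + e) by rewrite mulr_ge0// ltW.
    suff : V (z + e) <= 0 \/ (m <= u (z + e) /\ V (z + e) <= 2 * l).
      move=> [V0|[mu V2]]; rewrite /w.
        have : m * V (z + e) <= 0 by rewrite mulr_ge0_le0.
        by lra_from uz.
      have : m * V (z + e) <= m * (2 * l) by rewrite ler_wpM2l.
      have : (2 * l) * m <= 2 * l * u (z + e) by rewrite ler_pM2l.
      by clear_local; lra.
    have qE (t : R) : t + kappa / l * t ^+ 2 = t * (1 + kappa / l * t) by ring.
    have := qE (delta (z + e)); rewrite /V; set t := delta (z + e) in i1 i2 *.
    move=> qt.
    have [zp|zn] := ltP 0 t; last first.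
      left; have : 0 <= 1 + kappa / l * t by nra_from kl' z1 i1 zn.
      by nra_from nlq zn.
    have [zl|zl] := ltP t (eta * l); last first.
      right; split; first exact: bd.
      have : kappa / l * t <= 3 / 4.
        have : kappa / l * t <= kappa / l * (eta * l + 1).
          by rewrite ler_pM2l//; lra_from z2 i2.
        by rewrite mulrDr ek mulr1; lra_from kl'.
      have : t <= l by have := eta_le; nra_from l32' z2 i2.
      by nra_from nlq zp.
    left; have lz : l <= enorm R (z + e - x0).
      rewrite leNgt; apply/negP => zr; apply: nR.
      by rewrite /Reg /= -/t zp zl zr.
    have ll : l <= l^-1 * nsq (z + e - x0).
      by rewrite ler_pdivlMl// -sqr_enorm -expr2 ler_sqr ?nnegrE ?enorm_ge0// ltW.
    have : kappa / l * t <= 1 / 2 by rewrite -ek ler_pM2l// ltW.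
    by have := eta_le; nra_from l20 zp zl ll.
  - by rewrite /Reg /= dx0 xin subrr enorm0.
rewrite /w /V subrr (_ : nsq 0 = 0 :> R); last by rewrite /nsq big1// => i _; rewrite mxE expr0n.
rewrite mulr0 addr0 => hw; rewrite mulrAC ler_pdivrMr//.
have : 0 <= m * (kappa / l * delta x0 ^+ 2) by rewrite mulr_ge0// mulr_ge0 ?sqr_ge0// ltW.
by move: hw; rewrite !mulrDr; lra.
Qed.

(** The first step away from the boundary gains height a, so that the bound
    does not degenerate when delta x0 is tiny. *)
Lemma escape_lower m x0 u : 0 <= m -> 0 < delta x0 ->
  (forall z, 0 <= u z) ->
  (forall z, 0 < delta z -> enorm R (z - x0) < l + 1 -> avg u z <= u z) ->
  (forall z, eta * l <= delta z -> enorm R (z - x0) <= l + 2 -> m <= u z) ->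
  m / d.*2%:R <= u x0 \/ m / (2 * l) * (delta x0 + a) / d.*2%:R <= u x0.
Proof.
have a0' := a0; have a1' := a1; have k8' := k8; have l0' := l0; have sl' := sl.
have kl' := kl; have kl0' := kl0; have l32' := l32; have e0 := eta_gt0; have e16 := eta_le.
have ek0 := etaE; have is0' := is0.
move=> m0 dx0 u0 sup bd.
have N1 : 1 <= d.*2%:R :> R by rewrite ler1n double_gt0.
have [xin|xout] := ltP (delta x0) (eta * l); last first.
  left; rewrite ler_pdivrMr//; apply: le_trans (bd _ xout _) _.
    by rewrite subrr enorm0; lra.
  by rewrite ler_peMr.
have [e se he] : exists2 e, is_step e & a <= delta (x0 + e) - delta x0.
  by apply: H3; rewrite gtr0_norm//; apply: le_trans etal_le; exact: ltW.
have ux : u (x0 + e) / d.*2%:R <= u x0.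
  apply: le_trans (sup x0 dx0 _); last by rewrite subrr enorm0; lra.
  exact: avg_ge_term.
have shift z : enorm R (z - x0) <= enorm R (z - (x0 + e)) + 1.
  apply: le_trans (enorm_tri _ (x0 + e) _) _.
  by rewrite lerD2l addrAC subrr add0r (enorm_step se).
have := @escape_lower_aux m (x0 + e) u m0; case=> //.
- lra.
- by move=> z z1 z2; apply: sup => //; have := shift z; lra.
- by move=> z z1 z2; apply: bd => //; have := shift z; lra.
- by move=> mu; left; apply: le_trans ux; rewrite ler_pM2r ?invr_gt0.
move=> mu; right; apply: le_trans ux; rewrite ler_pM2r ?invr_gt0//.
by apply: le_trans mu; rewrite ler_wpM2l ?divr_ge0//; lra_from l32' he.
Qed.

End Barrier.
End Profile.

(** * Hitting probabilities of a boundary point *)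

Section HitEstimates.
Context {R : realType} {d : nat} (d3 : (3 <= d)%N).
Implicit Types (x y z e v : Zd d) (l m rho sigma h rad : R) (delta : Zd d -> R) (Om : set (Zd d)).

Let d0 : (0 < d)%N. Proof. by apply: leq_trans d3. Qed.
Let N0 : 0 < d.*2%:R :> R. Proof. exact: twod_gt0. Qed.
Let d1E : (d - 1 = (d - 2).+1)%N. Proof. by move: d3; lia. Qed.
Let d0E : (d = (d - 1).+1)%N. Proof. by move: d3; lia. Qed.

Lemma hit_ge0 Om y x : 0 <= hit Om y x :> R.
Proof. by apply: (avg_ge0 d0) => e _; exact: green_ge0. Qed.

Lemma hit_out Om y x : ~ Om x -> hit Om y x = 0 :> R.
Proof.
move=> xO; rewrite /hit -(avg_cst d0 (0 : R) y).
by apply: (avg_eq d0) => e _; rewrite green_sym// green_out.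
Qed.

(** The Green recursion in the variable x; the first term counts the visit at
    time zero, made when x is a neighbour of y. *)
Lemma hit_rec Om y x : Om x ->
  hit Om y x = avg (fun v => (x == v)%:R) y + avg (hit Om y) x :> R.
Proof.
move=> xO; rewrite /hit avg_exchange -avgD; apply: (avg_eq d0) => e _.
by rewrite green_sym// green_in//; congr (_ + _); apply: (avg_eq d0) => e' _; rewrite green_sym.
Qed.

Lemma hit_superharmonic Om y x : Om x -> avg (hit Om y) x <= hit Om y x :> R.
Proof. by move=> xO; rewrite [leRHS]hit_rec// lerDr; apply: (avg_ge0 d0). Qed.

Lemma hit_harmonic Om y x : Om x -> 1 < enorm R (x - y) ->
  hit Om y x = avg (hit Om y) x :> R.
Proof.
move=> xO xy; rewrite hit_rec// -[RHS]add0r; congr (_ + _).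
rewrite -(avg_cst d0 (0 : R) y); apply: (avg_eq d0) => e se.
case: eqP => // xe; move: xy.
by rewrite xe addrAC subrr add0r (enorm_step se) ltxx.
Qed.

Section Constants.
Context (a : R) (a0 : 0 < a) (a1 : a <= 1).

Local Notation kap := (@kappa R d a).
Local Notation et := (@eta R d a).

Let k8 : 8 <= kap. Proof. exact: kappa_ge8. Qed.
Let et0 : 0 < et. Proof. exact: eta_gt0. Qed.
Let et16 : et <= 1 / 16. Proof. exact: eta_le. Qed.

Local Ltac clear_local := clear - d3 d0 N0 d1E d0E a0 a1 k8 et0 et16.
Local Tactic Notation "lra_from" hyp_list(hs) :=
  revert hs; clear - d3 d0 N0 d1E d0E a0 a1 k8 et0 et16; intros; lra.
Local Tactic Notation "nra_from" hyp_list(hs) :=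
  revert hs; clear - d3 d0 N0 d1E d0E a0 a1 k8 et0 et16; intros; nra.

Definition outside (delta : Zd d -> R) : set (Zd d) := [set z | 0 < delta z].

(** By reversibility the walk run backwards from y has to escape to distance
    l, which costs a factor 1/l, before it sees the Green function, which has
    size l^(2-d). *)
Lemma hit_upper : exists2 C : R, 0 < C & forall sigma delta, 0 < sigma ->
  profile sigma a delta -> forall y x l, 16 * kap <= l -> l * kap <= sigma ->
  delta y <= 0 -> l <= enorm R (x - y) ->
  hit (outside delta) y x <= C * l ^- (d - 1).
Proof.
have [Cg Cg0 HG] := @green_upper R d d3.
have k8' := k8; have et0' := et0.
exists (48 * Cg * 2 ^+ (d - 2) / et); first by rewrite divr_gt0// mulr_gt0 ?exprn_gt0// mulr_gt0.
move=> sigma delta s0 P y x l l16 ls dy xy.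
have l0 : 0 < l by lra.
set C := _ / et.
have C0 : 0 < C by rewrite divr_gt0// mulr_gt0 ?exprn_gt0// mulr_gt0.
rewrite /hit; apply: (avg_le_cst d0) => e se.
have [ye|ye] := ltP 0 (delta (y + e)); last first.
  rewrite green_out//; last by rewrite /outside/= ltNge ye.
  by rewrite mulr_ge0 ?invr_ge0 ?exprn_ge0// ltW.
pose m := Cg * (l / 2) ^- (d - 2).
have m0 : 0 <= m by rewrite mulr_ge0 ?invr_ge0 ?exprn_ge0 ?divr_ge0// ltW.
have ye1 : delta (y + e) <= 1.
  case: P => H1 _ _; have := H1 y e se; rewrite ler_norml => /andP[_]; lra.
have l4 : 4 * kap <= l / 4 by lra.
have ls4 : l / 4 * kap <= sigma by nra.
have dist z : enorm R (x - y) <= enorm R (z - x) + enorm R (z - (y + e)) + 1.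
  apply: le_trans (enorm_tri x z y) _; rewrite enormB -addrA lerD2l.
  apply: le_trans (enorm_tri z (y + e) y) _; rewrite lerD2l.
  by rewrite addrAC subrr add0r (enorm_step se).
have -> : C * l ^- (d - 1) = 4 * m / (et * (l / 4)) * 3.
  rewrite /C /m d1E.
  rewrite expr_div_n exprS; have : l ^+ (d - 2) != 0 by rewrite expf_neq0// gt_eqF.
  have : 2 ^+ (d - 2) != 0 :> R by rewrite expf_neq0.
  move: (2 ^+ _) (l ^+ _) => p2 pl p20 pl0.
  by field; rewrite p20 pl0 !gt_eqF.
apply: le_trans (escape_upper d0 a0 a1 s0 P l4 ls4 m0 ye (u := fun z => green (outside delta) z x) _ _ _) _.
- move=> z z0 zl; rewrite green_in// (_ : z == x = false) ?add0r//.
  apply/negP => /eqP zx; have := dist z; rewrite zx subrr enorm0.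
  by move: zl; rewrite zx; lra.
- by move=> z z0; rewrite green_out// /outside/= => /lt_geF; rewrite z0.
- move=> z z0 zl; apply: HG; first by rewrite divr_gt0.
  by have := dist z; lra.
apply: ler_wpM2l; last by lra.
by apply: divr_ge0; apply: mulr_ge0 => //; [exact: ltW|apply: divr_ge0 => //; exact: ltW].
Qed.

(** When x is also near the boundary, the walk from x has to escape to
    distance l as well, which costs a second factor of order (2 + delta x) /
    l. *)
Lemma hit_upper_boundary : exists2 C : R, 0 < C & forall sigma delta, 0 < sigma ->
  profile sigma a delta -> forall y x l, 32 * kap <= l -> l * kap <= sigma ->
  delta y <= 0 -> 0 < delta x -> l <= enorm R (x - y) ->
  hit (outside delta) y x <= C * (2 + delta x) * l ^- d.
Proof.
have [C1 C10 HU] := hit_upper.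
have k8' := k8; have et0' := et0.
exists (16 * C1 * 2 ^+ (d - 1) / et); first by rewrite divr_gt0// mulr_gt0 ?exprn_gt0// mulr_gt0.
move=> sigma delta s0 P y x l l16 ls dy dx xy.
have l0 : 0 < l by lra.
pose m := C1 * (l / 2) ^- (d - 1).
have m0 : 0 <= m by rewrite mulr_ge0 ?invr_ge0 ?exprn_ge0 ?divr_ge0// ltW.
have l4 : 4 * kap <= l / 4 by lra.
have ls4 : l / 4 * kap <= sigma by nra.
have dist z : enorm R (x - y) <= enorm R (z - x) + enorm R (z - y).
  by apply: le_trans (enorm_tri x z y) _; rewrite enormB.
apply: le_trans (escape_upper d0 a0 a1 s0 P l4 ls4 m0 dx (u := hit (outside delta) y) _ _ _) _.
- move=> z z0 zl; rewrite -hit_harmonic//; have := dist z; lra.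
- by move=> z z0; rewrite hit_out// /outside/= => /lt_geF; rewrite z0.
- move=> z z0 zl; apply: (HU sigma) => //; [lra|nra|].
  by have := dist z; lra.
rewrite le_eqVlt; apply/orP; left; apply/eqP.
rewrite /m (_ : l ^+ d = l * l ^+ (d - 1)); last by rewrite -exprS -d0E.
rewrite expr_div_n; have : l ^+ (d - 1) != 0 by rewrite expf_neq0// gt_eqF.
have : 2 ^+ (d - 1) != 0 :> R by rewrite expf_neq0.
move: (2 ^+ _) (l ^+ _) => p2 pl p20 pl0.
by field; rewrite p20 pl0 !gt_eqF.
Qed.

(** The point at proportion j / n of the segment from x to z, rounded down. *)
Definition segment_point x z (n j : nat) : Zd d :=
  \row_i (x 0 i + divz (j%:Z * (z 0 i - x 0 i)) n%:Z).

Lemma segment_pointP x z n j : (0 < n)%N -> (j <= n)%N ->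
  exists2 f : 'I_d -> R, (forall i, 0 <= f i <= 1) &
  forall i, ((segment_point x z n j - x) 0 i)%:~R =
     j%:R / n%:R * ((z - x) 0 i)%:~R - f i :> R.
Proof.
move=> n0 jn; exists (fun i => j%:R / n%:R * ((z - x) 0 i)%:~R -
    ((segment_point x z n j - x) 0 i)%:~R); last by move=> i; rewrite subKr.
move=> i; rewrite !coordB mxE addrAC subrr add0r.
set w := z 0 i - x 0 i; set q := (_ %/ _)%Z.
have nz : n%:Z != 0 by rewrite eqz_nat -lt0n.
have h := divz_eq (j%:Z * w) n%:Z.
have h1 : 0 <= ((j%:Z * w) %% n%:Z)%Z by rewrite modz_ge0.
have h2 : ((j%:Z * w) %% n%:Z)%Z < n%:Z by rewrite ltz_pmod.
rewrite -/q in h; move: h h1 h2; set r := (_ %% _)%Z => h h1 h2.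
have n0R : 0 < n%:R :> R by rewrite ltr0n.
have hR : j%:R * w%:~R = q%:~R * n%:R + r%:~R :> R.
  rewrite -[j%:R]/(j%:Z%:~R) -[n%:R]/(n%:Z%:~R).
  by rewrite -!intrM -intrD h.
have -> : j%:R / n%:R * w%:~R - q%:~R = r%:~R / n%:R :> R.
  rewrite mulrAC hR; field; by rewrite gt_eqF.
rewrite divr_ge0 ?ler0z//= ler_pdivrMr// mul1r ltW//.
by rewrite (_ : n%:R = n%:Z%:~R :> R)// ltr_int.
Qed.

Lemma segment_point0 x z n : segment_point x z n 0 = x.
Proof. by apply/rowP => i; rewrite mxE mul0r div0z addr0. Qed.

Lemma segment_pointn x z n : (0 < n)%N -> segment_point x z n n = z.
Proof.
by move=> n0; apply/rowP => i; rewrite mxE mulrC mulzK ?eqz_nat -?lt0n// addrC subrK.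
Qed.

Lemma segment_point_step x z n j : (0 < n)%N -> (j < n)%N ->
  enorm R (segment_point x z n j.+1 - segment_point x z n j) <=
  n%:R^-1 * enorm R (z - x) + d%:R.
Proof.
move=> n0 jn.
have [f f01 fE] := segment_pointP x z n0 jn.
have [g g01 gE] := segment_pointP x z n0 (ltnW jn).
rewrite (_ : _ - _ = (segment_point x z n j.+1 - x) - (segment_point x z n j - x)); last first.
  by rewrite opprB addrA subrK.
rewrite enormE (@vnorm_eq _ _ _ (fun i => (n%:R^-1 * toR (z - x) i) + (g i - f i))); last first.
  by move=> i; rewrite /toR coordB rmorphB/= fE gE -natr1 /toR; field; rewrite gt_eqF// ltr0n.
apply: le_trans (vnormD _ _) _; rewrite vnormZ ger0_norm ?invr_ge0// lerD2l.
rewrite -[leRHS]mulr1; apply: vnorm_sup => // i.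
by have := f01 i; have := g01 i; rewrite ler_norml; lra.
Qed.

Lemma segment_point_dist x z y n j rho : (0 < n)%N -> (j <= n)%N ->
  enorm R (x - y) <= rho -> enorm R (z - y) <= rho ->
  enorm R (segment_point x z n j - y) <= rho + d%:R.
Proof.
move=> n0 jn xy zy.
have [f f01 fE] := segment_pointP x z n0 jn.
pose t : R := j%:R / n%:R.
have t0 : 0 <= t by rewrite divr_ge0.
have t1 : t <= 1 by rewrite ler_pdivrMr ?ltr0n// mul1r ler_nat.
rewrite (_ : _ - _ = (segment_point x z n j - x) + (x - y)); last by rewrite addrA subrK.
rewrite enormE (@vnorm_eq _ _ _ (fun i => ((1 - t) * toR (x - y) i + t * toR (z - y) i)
    + (- f i))); last first.
  move=> i; rewrite /toR coordD rmorphD/= fE -/t !coordB !rmorphB/=; ring.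
apply: le_trans (vnormD _ _) _; apply: lerD; last first.
  rewrite -[leRHS]mulr1; apply: vnorm_sup => // i.
  by have := f01 i; rewrite normrN ler_norml; lra.
apply: le_trans (vnormD _ _) _; rewrite !vnormZ !ger0_norm ?subr_ge0//.
rewrite -!enormE; nra.
Qed.

(** Near the boundary the domain is almost a half space, so the segment
    between two points at height h stays at height h / 2: along it delta
    differs from an affine function by O(rho^2 / sigma). *)
Lemma segment_point_height sigma delta x y z n j rho h : 0 < sigma ->
  profile sigma a delta -> (0 < n)%N -> (j <= n)%N ->
  enorm R (x - y) <= rho -> enorm R (z - y) <= rho -> d%:R <= rho ->
  13 * d%:R * rho ^+ 2 / sigma <= h / 4 -> d%:R <= h / 4 ->
  h <= delta x -> h <= delta z -> h / 2 <= delta (segment_point x z n j).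
Proof.
move=> s0 P n0 jn xy zy drho hs dh hx hz.
have [f f01 fE] := segment_pointP x z n0 jn.
pose t : R := j%:R / n%:R.
have t0 : 0 <= t by rewrite divr_ge0.
have t1 : t <= 1 by rewrite ler_pdivrMr ?ltr0n// mul1r ler_nat.
have rho0 : 0 <= rho by apply: le_trans xy; exact: enorm_ge0.
have is0 : 0 <= sigma^-1 by rewrite invr_ge0 ltW.
have zx : enorm R (z - x) <= 2 * rho.
  by apply: le_trans (enorm_tri z y x) _; rewrite (enormB y); lra.
pose w := segment_point x z n j - x.
have wn : enorm R w <= 3 * rho.
  rewrite enormE (@vnorm_eq _ _ _ (fun i => t * toR (z - x) i + (- f i))); last first.
    by move=> i; rewrite /toR fE.
  apply: le_trans (vnormD _ _) _; rewrite vnormZ ger0_norm// -enormE.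
  have : vnorm (fun i => - f i) <= d%:R * 1.
    by apply: vnorm_sup => // i; have := f01 i; rewrite normrN ler_norml; lra.
  have := enorm_ge0 (R := R) (z - x); nra.
pose Q := d%:R * rho ^+ 2 / sigma.
have {}hs : 13 * Q <= h / 4 by move: hs; rewrite /Q !mulrA.
have err v (c : R) : 0 <= c -> enorm R v <= c * rho ->
    sigma^-1 * (l1 v)%:R ^+ 2 <= c ^+ 2 * Q.
  move=> c0 vc; rewrite mulrC /Q mulrA ler_pM2r ?invr_gt0//.
  apply: le_trans (l1_sq v) _; rewrite mulrCA -exprMn ler_wpM2l//.
  by rewrite -sqr_enorm ler_sqr ?nnegrE ?enorm_ge0 ?mulr_ge0.
have := profile_linear_approx s0 P x w; rewrite [x + w]addrC /w subrK -/w.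
have := profile_linear_approx s0 P x (z - x); rewrite [x + (z - x)]addrC subrK.
have sumE : \sum_i (w 0 i)%:~R * grad delta x i =
   t * \sum_i ((z - x) 0 i)%:~R * grad delta x i - \sum_i f i * grad delta x i.
  rewrite mulr_sumr -sumrB; apply: eq_bigr => i _; rewrite /w fE -/t; ring.
have fg : `|\sum_i f i * grad delta x i| <= d%:R.
  apply: le_trans (ler_norm_sum _ _ _) _.
  apply: le_trans (_ : \sum_(i < d) (1 : R) <= _); last by rewrite sumr_const card_ord.
  apply: ler_sum => i _; rewrite normrM.
  have gi : `|grad delta x i| <= 1 by case: P => H1 _ _; apply: H1; exists i; left.
  have fi : `|f i| <= 1 by have := f01 i; rewrite ler_norml; lra.
  by rewrite mulr_ile1.
rewrite sumE; move: fg; set S := \sum_i ((z - x) 0 i)%:~R * _; set F := \sum_i f i * _.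
move=> fg e1 e2.
have {}e1 := le_trans e1 (err _ 2 (ler0n R 2) zx).
have {}e2 := le_trans e2 (err _ 3 (ler0n R 3) wn).
move: fg e1 e2; rewrite !ler_norml => /andP[f1 f2] /andP[e1 e2] /andP[e3 e4].
have c1 : delta z - delta x - 4 * Q <= S by lra_from e2.
have c2 : t * (delta z - delta x - 4 * Q) <= t * S by rewrite ler_wpM2l.
have Q0 : 0 <= Q by rewrite /Q mulr_ge0// mulr_ge0// sqr_ge0.
have c3 : t * (4 * Q) <= 4 * Q by rewrite ler_piMl// mulr_ge0.
have c4 : 0 <= t * (delta z - h) by rewrite mulr_ge0// subr_ge0.
have c5 : 0 <= (1 - t) * (delta x - h) by rewrite mulr_ge0// subr_ge0.
lra_from dh hs f2 e3 c2 c3 c4 c5.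
Qed.

(** Two points at height of order l and distance of order l are joined by a
    chain of balls of radius of order l inside the domain. Their number n is
    independent of l, so the bound l^(2-d) near the pole is carried along with
    a constant loss. *)
Lemma green_chain_lower (C2 : R) : 1 <= C2 ->
  exists c l0 th : R, [/\ 0 < c, 1 <= l0, 0 < th &
  forall sigma delta, 0 < sigma -> profile sigma a delta ->
  forall x y z l rho rad, l0 <= l -> l <= rho -> rho <= C2 * l ->
  rho <= th * sigma -> rho + l <= rad ->
  enorm R (x - y) <= rho -> enorm R (z - y) <= rho ->
  et * l / 2 <= delta x -> et * l / 2 <= delta z ->
  c * l ^- (d - 2) <= green (outside delta `&` zball y rad) z x].
Proof.
move=> C21; have et0' := et0; have et16' := et16.
have [r1 [c1 [r11 c10 HC]]] := @superharmonic_chain R d d3.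
have [r2 [c2 [r21 c20 HG]]] := @green_ball_lower R d d3.
have dR : 1 <= d%:R :> R by rewrite ler1n.
(* Balls of radius rr * l around points at height et * l / 4 stay inside the
   domain, delta being Lipschitz with constant d for the Euclidean norm. *)
pose rr : R := et / (8 * d%:R).
have rr0 : 0 < rr by rewrite divr_gt0// mulr_gt0//; lra.
have rrE : rr * d%:R = et / 8 by rewrite /rr; field; lra.
clearbody rr.
pose n := (Num.truncn (16 * C2 / rr)).+1.
have nE : 16 * C2 / rr <= n%:R by apply: ltW; exact: truncnS_gt.
have n0 : (0 < n)%N by [].
have l0E : 0 < 1 + (r1 + r2 + 8 * d%:R) / rr + 8 * d%:R / et.
  by rewrite addr_gt0 ?divr_gt0 ?addr_gt0 ?divr_gt0//; lra.
exists (c1 ^+ n * (c2 * rr ^- (d - 2))), (1 + (r1 + r2 + 8 * d%:R) / rr + 8 * d%:R / et),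
  (et / (104 * d%:R * C2)); split.
- by rewrite mulr_gt0 ?exprn_gt0// mulr_gt0// invr_gt0 exprn_gt0.
- by rewrite -addrA lerDl addr_ge0 ?divr_ge0//; lra_from r11 r21 dR rr0 et0'.
- by rewrite divr_gt0// mulr_gt0//; lra_from dR C21.
move=> sigma delta s0 P x y z l rho rad ll lrho rhol rhos rad_ge xy zy hx hz.
have p1 : 0 <= (r1 + r2 + 8 * d%:R) / rr by rewrite divr_ge0//; lra_from r11 r21 dR rr0.
have p2 : 0 <= 8 * d%:R / et by rewrite divr_ge0//; lra_from et0'.
have lge1 : 1 <= l by lra_from ll p1 p2.
pose r := rr * l.
have rl : r1 + r2 + 8 * d%:R <= r.
  by rewrite /r (mulrC rr) -ler_pdivrMr//; lra_from ll p2.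
have etl : 8 * d%:R <= et * l by rewrite (mulrC et) -ler_pdivrMr//; lra_from ll p1.
have etl1 : et * l <= l / 16.
  by rewrite (_ : l / 16 = 1 / 16 * l); [rewrite ler_pM2r//; lra_from lge1|field].
have rd : r * d%:R = et * l / 8 by rewrite /r mulrAC rrE mulrAC.
have r0 : 0 < r by lra_from r11 r21 dR rl.
have hs : 13 * d%:R * rho ^+ 2 / sigma <= (et * l / 2) / 4.
  rewrite ler_pdivrMr// expr2.
  have h1 : rho * (104 * d%:R * C2) <= et * sigma.
    by move: rhos; rewrite mulrAC ler_pdivlMr// mulr_gt0//; lra_from dR C21.
  have h2 : rho * (rho * (104 * d%:R)) <= (C2 * l) * (rho * (104 * d%:R)).
    by rewrite ler_wpM2r// mulr_ge0//; lra_from lrho lge1.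
  have h3 : l * (rho * (104 * d%:R * C2)) <= l * (et * sigma).
    by rewrite ler_wpM2l//; lra_from lge1.
  lra_from h2 h3.
pose p := segment_point x z n.
have height j : (j <= n)%N -> et * l / 4 <= delta (p j).
  move=> jn; have := @segment_point_height sigma delta x y z n j rho (et * l / 2) s0 P n0 jn xy zy.
  by rewrite (_ : et * l / 2 / 2 = et * l / 4); [apply=> //; lra_from lrho lge1 etl etl1|field].
have dom j w : (j <= n)%N -> enorm R (w - p j) < r -> (outside delta `&` zball y rad) w.
  move=> jn wj; split.
    have := profile_lipschitz P (p j) (w - p j); rewrite [p j + _]addrC subrK ler_norml.
    move=> /andP[h _]; have h' := l1_enorm (R := R) (w - p j).
    have h2 : d%:R * enorm R (w - p j) <= d%:R * r by rewrite ler_wpM2l// ltW.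
    by rewrite /outside/=; have := height j jn; lra_from dR etl rd h h' h2.
  rewrite /zball/= enormB; apply: le_trans (enorm_tri w (p j) y) _.
  have := segment_point_dist n0 jn xy zy; rewrite -/(p j).
  have : r <= l / 2 by nra_from dR etl1 rd r0.
  by lra_from rad_ge etl etl1 r0 wj.
have -> : c1 ^+ n * (c2 * rr ^- (d - 2)) * l ^- (d - 2) = c1 ^+ n * (c2 * r ^- (d - 2)).
  by rewrite /r exprMn invfM; move: (rr ^- _) (l ^- _) (c1 ^+ _) => p3 p4 p5; ring.
rewrite -[in leRHS](segment_pointn x z n0).
apply: (HC p n r _ (fun w => green (outside delta `&` zball y rad) w x)).
- by lra_from r21 dR rl.
- by rewrite mulr_ge0 ?invr_ge0 ?exprn_ge0// ltW.
- by move=> w; exact: green_ge0.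
- move=> j jn; apply: le_trans (segment_point_step x z n0 jn) _.
  have zx : enorm R (z - x) <= 2 * (C2 * l).
    by apply: le_trans (enorm_tri z y x) _; rewrite (enormB y); lra_from rhol xy zy.
  have : n%:R^-1 * enorm R (z - x) <= r / 8.
    rewrite ler_pdivrMl ?ltr0n//; apply: le_trans zx _.
    have : 16 * C2 / rr * r <= n%:R * r by rewrite ler_pM2r.
    rewrite (_ : 16 * C2 / rr * r = 16 * C2 * l); last by rewrite /r; field; rewrite gt_eqF.
    clear_local; lra.
  lra_from r11 r21 rl.
- by move=> j w jn wr; rewrite [leRHS]green_in ?lerDr//; exact: (dom j w (ltnW jn)).
move=> w; rewrite [p 0%N]segment_point0 => wx.
apply: HG; [lra_from r11 dR rl| |lra_from r0 wx].
by move=> w' w'x; apply: (dom 0%N) => //; rewrite [p 0%N]segment_point0.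
Qed.

(** The walk run backwards from y reaches height of order l with probability
    of order 1/l, and there the Green function is of order l^(2-d). *)
Lemma hit_lower (C2 : R) : 1 <= C2 ->
  exists c l0 th : R, [/\ 0 < c, 1 <= l0, 0 < th &
  forall sigma delta, 0 < sigma -> profile sigma a delta ->
  forall x y l rho rad, l0 <= l -> l <= rho -> rho <= C2 * l ->
  rho <= th * sigma -> rho + l <= rad ->
  (exists2 e, is_step e & 0 < delta (y + e)) ->
  enorm R (x - y) <= rho -> et * l <= delta x ->
  c * l ^- (d - 1) <= hit (outside delta `&` zball y rad) y x].
Proof.
move=> C21; have et0' := et0; have et16' := et16; have k8' := k8; have a0' := a0; have a1' := a1.
have [c [l0 [th [c0 l01 th0 H]]]] := green_chain_lower C21.
have N1 : 1 <= d.*2%:R :> R by rewrite ler1n double_gt0.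
exists (c * a / d.*2%:R ^+ 2), (8 * kap + 8 + l0), (Num.min th kap^-1); split.
- by rewrite divr_gt0 ?exprn_gt0// mulr_gt0.
- by lra.
- by rewrite lt_min th0 invr_gt0; lra.
move=> sigma delta s0 P x y l rho rad ll lrho rhol rhos rad_ge [e se ye] xy hx.
have [rhos1 rhos2] : rho <= th * sigma /\ rho * kap <= sigma.
  have [h1 h2] : Num.min th kap^-1 <= th /\ Num.min th kap^-1 <= kap^-1.
    by rewrite !ge_min !lexx orbT.
  split; first by apply: le_trans rhos _; rewrite ler_pM2r.
  rewrite mulrC -ler_pdivlMl; last by lra.
  by apply: le_trans rhos _; rewrite ler_pM2r.
pose m := c * l ^- (d - 2).
have lp : 0 < l by lra.
have m0 : 0 <= m by rewrite mulr_ge0 ?invr_ge0 ?exprn_ge0// ltW.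
set Om := _ `&` _.
have l4 : 4 * kap <= l / 2 by lra.
have lk : l * kap <= rho * kap by rewrite ler_wpM2r//; lra.
have lk0 : 0 <= l * kap by apply: mulr_ge0; lra_from lp k8'.
have etl0 : 0 <= et * l by apply: mulr_ge0; lra_from et0' lp.
have ls : l / 2 * kap <= sigma by lra.
have hz0 : 0 < l / 2 by lra.
have dist z : enorm R (z - y) <= enorm R (z - (y + e)) + 1.
  apply: le_trans (enorm_tri z (y + e) y) _; rewrite lerD2l.
  by rewrite addrAC subrr add0r (enorm_step se).
have u0 z : 0 <= green Om z x :> R by exact: green_ge0.
have key : m * a / l / d.*2%:R <= green Om (y + e) x.
  have hyp1 : forall z, 0 < delta z -> enorm R (z - (y + e)) < l / 2 + 1 ->
     avg (fun z => green Om z x) z <= green Om z x :> R.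
    move=> z z0 zl; rewrite [leRHS]green_in ?lerDr//; split=> //.
    by rewrite /zball/= enormB; move: (dist z); lra_from k8' lrho rad_ge l4 zl.
  have hyp2 : forall z, et * (l / 2) <= delta z ->
     enorm R (z - (y + e)) <= l / 2 + 2 -> m <= green Om z x.
    move=> z z0 zl; apply: (H sigma delta s0 P x y z l rho rad) => //.
    - by lra_from k8' ll.
    - by move: (dist z); lra_from k8' lrho l4 zl.
    - by lra_from hx etl0.
    - by lra_from z0.
  have := escape_lower d0 a0 a1 s0 P l4 ls m0 ye u0 hyp1 hyp2.
  case=> h; apply: le_trans h; rewrite ler_pM2r ?invr_gt0//.
    rewrite ler_pdivrMr// ler_wpM2l//; lra_from k8' a1' l4.
  rewrite (_ : m / (2 * (l / 2)) * (delta (y + e) + a) = m * (delta (y + e) + a) / l); last first.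
    by field; rewrite gt_eqF.
  by rewrite ler_pM2r ?invr_gt0// ler_wpM2l//; lra_from ye.
have -> : c * a / d.*2%:R ^+ 2 * l ^- (d - 1) = m * a / l / d.*2%:R / d.*2%:R.
  rewrite /m d1E.
  rewrite (exprS l); have : l ^+ (d - 2) != 0 by rewrite expf_neq0// gt_eqF.
  by move: (l ^+ (d - 2)) => pl pl0; field; rewrite pl0 !gt_eqF.
apply: le_trans (_ : green Om (y + e) x / d.*2%:R <= _).
  by rewrite ler_pM2r ?invr_gt0.
exact: (@avg_ge_term R d d0 (fun z => green Om z x) y e se).
Qed.

(** The walk from x either starts at height of order l, or climbs there with
    probability of order (delta x + a) / l; then hit_lower applies. *)
Lemma hit_lower_boundary (C2 : R) : 1 <= C2 ->
  exists c l0 th : R, [/\ 0 < c, 1 <= l0, 0 < th &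
  forall sigma delta, 0 < sigma -> profile sigma a delta ->
  forall x y l rho rad, l0 <= l -> rho <= C2 * l ->
  rho <= th * sigma -> rho + l <= rad ->
  (exists2 e, is_step e & 0 < delta (y + e)) ->
  enorm R (x - y) + l + 2 <= rho -> 0 < delta x ->
  c * l ^- (d - 1) <= hit (outside delta `&` zball y rad) y x \/
  c * (delta x + a) * l ^- d <= hit (outside delta `&` zball y rad) y x].
Proof.
move=> C21; have et0' := et0; have et16' := et16; have k8' := k8; have a0' := a0; have a1' := a1.
have [c [l0 [th [c0 l01 th0 H]]]] := hit_lower C21.
have N1 : 1 <= d.*2%:R :> R by rewrite ler1n double_gt0.
exists (c / (2 * d.*2%:R)), (4 * kap + l0), (Num.min th kap^-1); split.
- by rewrite divr_gt0// mulr_gt0.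
- by lra.
- by rewrite lt_min th0 invr_gt0; lra.
move=> sigma delta s0 P x y l rho rad ll rhol rhos rad_ge ye xy hx.
have [rhos1 rhos2] : rho <= th * sigma /\ rho * kap <= sigma.
  have [h1 h2] : Num.min th kap^-1 <= th /\ Num.min th kap^-1 <= kap^-1.
    by rewrite !ge_min !lexx orbT.
  split; first by apply: le_trans rhos _; rewrite ler_pM2r.
  rewrite mulrC -ler_pdivlMl; last by lra.
  by apply: le_trans rhos _; rewrite ler_pM2r.
have xy0 := enorm_ge0 (R := R) (x - y).
have lp : 0 < l by lra.
have ls : l * kap <= sigma.
  by apply: le_trans rhos2; rewrite ler_wpM2r//; lra.
pose m := c * l ^- (d - 1).
have m0 : 0 <= m by rewrite mulr_ge0 ?invr_ge0 ?exprn_ge0// ltW.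
set Om := _ `&` _.
have dist z : enorm R (z - y) <= enorm R (z - x) + enorm R (x - y) by exact: enorm_tri.
have u0 z : 0 <= hit Om y z :> R by exact: hit_ge0.
have hyp1 : forall z, 0 < delta z -> enorm R (z - x) < l + 1 ->
   avg (hit Om y) z <= hit Om y z :> R.
  move=> z z0 zl; apply: hit_superharmonic; split=> //.
  by rewrite /zball/= enormB; move: (dist z); lra_from rad_ge xy lp zl.
have hyp2 : forall z, et * l <= delta z ->
   enorm R (z - x) <= l + 2 -> m <= hit Om y z.
  move=> z z0 zl; apply: (H sigma delta s0 P z y l rho rad) => //; have := dist z; lra_from k8' ll xy xy0 zl.
have l4 : 4 * kap <= l by lra.
have := escape_lower d0 a0 a1 s0 P l4 ls m0 hx u0 hyp1 hyp2.
case=> h; [left|right]; apply: le_trans h.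
  have mN : 0 <= m / d.*2%:R by rewrite divr_ge0// ltW.
  rewrite (_ : _ * _ = m / d.*2%:R / 2); first by lra.
  by rewrite /m; move: (l ^- _) => p; field; rewrite gt_eqF.
rewrite le_eqVlt; apply/orP; left; apply/eqP.
rewrite /m (_ : l ^+ d = l * l ^+ (d - 1)); last by rewrite -exprS -d0E.
have : l ^+ (d - 1) != 0 by rewrite expf_neq0// gt_eqF.
by move: (l ^+ _) => pl pl0; field; rewrite pl0 !gt_eqF.
Qed.

End Constants.
End HitEstimates.

(** * Smoothing and piecewise linear interpolation *)

Section Box.
Context {d : nat} (rho : nat) (rho0 : (0 < rho)%N).
Implicit Types (x z : Zd d) (l : seq 'I_d).

(** The window over which smooth, below, averages at x. *)
Fixpoint box l x z : Prop :=
  if l is j :: l' then exists2 b, (b < rho)%N & box l' (x + ev j *+ b) z else z = x.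

Lemma coord_evMn (j i : 'I_d) (b : nat) : (ev j *+ b) 0 i = if j == i then b%:Z else 0.
Proof.
elim: b => [|b IHb]; first by rewrite mulr0n mxE; case: (j == i).
rewrite mulrS coordD IHb mxE eq_refl eq_sym /=.
by case: (j == i) => /=; [rewrite -intS|].
Qed.

Lemma box_coord l x z : box l x z -> forall i,
  x 0 i <= z 0 i <= x 0 i + ((rho.-1 * count_mem i l)%N)%:Z.
Proof.
elim: l x => [|j l IH] x /=; first by move=> -> i; rewrite muln0 addr0 !lexx.
move=> [b brho /IH h] i; have := h i; rewrite coordD.
rewrite coord_evMn.
set c := count_mem i l; rewrite mulnDr.
by case: (j == i) => /=; move: brho rho0; rewrite ?muln1 ?muln0 ?addn0; lia.
Qed.

Lemma box_enum x z : box (enum 'I_d) x z -> forall i, x 0 i <= z 0 i < x 0 i + rho%:Z.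
Proof.
move=> /box_coord h i; have := h i.
by rewrite count_uniq_mem ?enum_uniq// mem_enum inE muln1; move: rho0; lia.
Qed.

End Box.

Section Smoothing.
Context {R : realType} {d : nat} (rho : nat) (rho0 : (0 < rho)%N).
Implicit Types (x z v : Zd d) (u : Zd d -> R) (l : seq 'I_d).

Let rhoR : 0 < rho%:R :> R. Proof. by rewrite ltr0n. Qed.

Definition avg_dir (j : 'I_d) u x : R := rho%:R^-1 * \sum_(b < rho) u (x + ev j *+ b).

(** The average over a cube, written as iterated averages in coordinate
    directions so that differences can be taken one direction at a time. *)
Definition smooth l u : Zd d -> R := foldr avg_dir u l.

Lemma avg_dir_between j u x lo hi :
  (forall b, (b < rho)%N -> lo <= u (x + ev j *+ b) <= hi) ->
  lo <= avg_dir j u x <= hi.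
Proof.
move=> h; rewrite /avg_dir ler_pdivlMl// ler_pdivrMl//.
have cstE (c : R) : rho%:R * c = \sum_(b < rho) c by rewrite sumr_const card_ord mulr_natl.
by rewrite !cstE; apply/andP; split; apply: ler_sum => b _; case/andP: (h b (ltn_ord b)).
Qed.

Lemma smooth_between l u x lo hi :
  (forall z, box rho l x z -> lo <= u z <= hi) -> lo <= smooth l u x <= hi.
Proof.
elim: l x => [|j l IH] x h /=; first exact: h.
apply: avg_dir_between => b brho; apply: IH => z hz; apply: h; by exists b.
Qed.

Lemma smooth_shiftB l u x v :
  smooth l (fun z => u (z + v) - u z) x = smooth l u (x + v) - smooth l u x.
Proof.
elim: l x => [|j l IH] x //=; rewrite /avg_dir -mulrBr -sumrB; congr (_ * _).
by apply: eq_bigr => b _; rewrite IH addrAC.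
Qed.

(** Averaging over a direction turns a discrete derivative in that direction
    into a difference quotient over the whole window. *)
Lemma smooth_derivative l u (c : R) x j : j \in l -> (forall z, `|u z| <= c) ->
  `|smooth l u (x + ev j) - smooth l u x| <= 2 * c / rho%:R.
Proof.
move=> + uc.
have sc l' z : `|smooth l' u z| <= c.
  by rewrite ler_norml; apply: smooth_between => w _; rewrite -ler_norml.
elim: l x => // i l IH x; rewrite inE => jl /=.
have [ij|ij] := eqVneq j i.
  rewrite -{}ij in jl *; set G := smooth l u.
  have -> : avg_dir j G (x + ev j) - avg_dir j G x =
      rho%:R^-1 * (G (x + ev j *+ rho) - G x).
    rewrite /avg_dir -mulrBr -sumrB; congr (_ * _).
    rewrite -(big_mkord xpredT (fun b => G (x + ev j + ev j *+ b) - G (x + ev j *+ b))).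
    under eq_bigr do rewrite -addrA -mulrS.
    by rewrite telescope_sumr// mulr0n addr0.
  rewrite normrM ger0_norm ?invr_ge0// mulrC ler_pM2r ?invr_gt0//.
  apply: le_trans (ler_normB _ _) _; apply: le_trans (lerD (sc l _) (sc l _)) _.
  by rewrite mulr2n mulrDl mul1r.
rewrite (negbTE ij) /= in jl.
rewrite /avg_dir -mulrBr -sumrB -/(smooth l u) ler_norml.
have := @avg_dir_between i (fun z => smooth l u (z + ev j) - smooth l u z) x
  (- (2 * c / rho%:R)) (2 * c / rho%:R).
rewrite /avg_dir; under eq_bigr do rewrite addrAC; apply=> b _.
by rewrite -ler_norml; exact: IH.
Qed.

End Smoothing.

Section IntegerDivision.
Context (r : nat) (r0 : (0 < r)%N).

Lemma divz_unique (y k : int) : k * r%:Z <= y -> y < k * r%:Z + r%:Z -> divz y r%:Z = k.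
Proof.
move=> h1 h2; have r0z : r%:Z != 0 by rewrite eqz_nat -lt0n.
rewrite -(subrK (k * r%:Z) y) addrC divzMDl// divz_small ?addr0//.
by apply/andP; split; move: h1 h2; rewrite ?absz_nat; lia.
Qed.

Lemma divz_bounds (y : int) :
  divz y r%:Z * r%:Z <= y /\ y < divz y r%:Z * r%:Z + r%:Z.
Proof.
have r0z : r%:Z != 0 by rewrite eqz_nat -lt0n.
have h1 := modz_ge0 y r0z; have h2 : ((y %% r%:Z)%Z < r%:Z) by rewrite ltz_pmod.
by have := divz_eq y r%:Z; split; lia.
Qed.

Lemma divz_mono (y z : int) : y <= z -> divz y r%:Z <= divz z r%:Z.
Proof. by move=> yz; apply: lez_pdiv2r. Qed.

(** Hermite's identity. Among r consecutive shifts exactly one sees the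
    quotient change when y grows by one. *)
Lemma sum_divz_shift (y : int) (t : nat) :
  \sum_(b < r) (divz (y + t%:Z + b%:Z) r%:Z - divz (y + b%:Z) r%:Z) = t%:Z.
Proof.
elim: t => [|t IH]; first by rewrite big1// => b _; rewrite addr0 subrr.
rewrite -[in RHS]addn1 PoszD -[in RHS]IH.
have one (w : int) : \sum_(b < r) (divz (w + 1 + b%:Z) r%:Z - divz (w + b%:Z) r%:Z) = 1.
  rewrite -(big_mkord xpredT (fun b => divz (w + 1 + b%:Z) r%:Z - divz (w + b%:Z) r%:Z)).
  under eq_bigr do rewrite -addrA -intS.
  rewrite (telescope_sumr (fun b => divz (w + b%:Z) r%:Z))// addr0.
  rewrite -{1}[r%:Z]mul1r [w + _]addrC divzMDl ?addrK//.
  by rewrite eqz_nat -lt0n.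
rewrite -[X in _ = _ + X](one (y + t%:Z)) -big_split/=; apply: eq_bigr => b _.
by rewrite intS; set w := divz (y + t%:Z + b%:Z) _; rewrite (addrC 1) addrA; lia.
Qed.

End IntegerDivision.

Section Construction.
Context {R : realType} {d : nat} (r : nat) (r0 : (0 < r)%N).
Implicit Types (x z v k p q : Zd d) (A : set (Zd d)).

Let rR : 0 < r%:R :> R. Proof. by rewrite ltr0n. Qed.

Definition cell x : Zd d := \row_i divz (x 0 i) r%:Z.

Definition diag (b : nat) : Zd d := const_mx b%:Z.

Lemma cell_diag x b i : cell (x + diag b) 0 i = divz (x 0 i + b%:Z) r%:Z.
Proof. by rewrite mxE coordD mxE. Qed.

(** Average along a diagonal of length r. As b grows, the cell of x + b (1,
    ..., 1) runs through the vertices of the Kuhn simplex that contains x,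
    each for a number of shifts proportional to its barycentric coordinate:
    this is the piecewise linear interpolation of c on the Kuhn triangulation
    with vertices in r Z^d. *)
Definition kuhn (c : Zd d -> R) x : R :=
  r%:R^-1 * \sum_(b < r) c (cell (x + diag b)).

Context (c : Zd d -> R) (c01 : forall k, c k = 0 \/ c k = 1).

(** By Hermite's identity a unit step changes the cell of a single shift b. *)
Lemma kuhn_lipschitz_ev x i : `|kuhn c (x + ev i) - kuhn c x| <= r%:R^-1.
Proof.
rewrite /kuhn -mulrBr -sumrB normrM ger0_norm ?invr_ge0//.
rewrite -[leRHS]mulr1 ler_wpM2l ?invr_ge0//.
apply: le_trans (ler_norm_sum _ _ _) _.
rewrite -(_ : (\sum_(b < r) (divz (x 0 i + 1 + b%:Z) r%:Z - divz (x 0 i + b%:Z) r%:Z))%:~R = 1 :> R); last first.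
  by rewrite (sum_divz_shift r0 _ 1).
rewrite rmorph_sum/=; apply: ler_sum => b _.
set D1 := divz _ _; set D2 := divz _ _.
have D12 : D2 <= D1 by apply: divz_mono; lia.
have evE (t : 'I_d) : (ev i) 0 t = (t == i)%:Z by rewrite mxE eqxx natz.
have [DE|DN] := eqVneq D1 D2.
  rewrite DE subrr (_ : cell (x + ev i + diag b) = cell (x + diag b)) ?subrr ?normr0//.
  apply/rowP => t; rewrite !cell_diag coordD evE.
  by have [->|ti] := eqVneq t i; rewrite ?addr0.
have : 1 <= (D1 - D2)%:~R :> R by rewrite ler1z; lia.
apply: le_trans.
by case: (c01 (cell (x + ev i + diag b))) => ->; case: (c01 (cell (x + diag b))) => ->;
  rewrite ?subrr ?subr0 ?sub0r ?normrN ?normr1 ?normr0.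
Qed.

Lemma kuhn_lipschitz x e : is_step e -> `|kuhn c (x + e) - kuhn c x| <= r%:R^-1.
Proof.
move=> [i [->|->]]; first exact: kuhn_lipschitz_ev.
by have := kuhn_lipschitz_ev (x - ev i) i; rewrite subrK distrC.
Qed.

(** Along the edge of the Kuhn simplex joining two of the vertices that carry
    weight at x, the interpolation grows by exactly (c q - c p) / r. Moving by
    v leaves the cells of shifts outside [al, be] alone and replaces the cell
    of b by that of b + 1 in between, so one occurrence of p is exchanged for
    one of q. For c with values 0 and 1 this makes every level strictly
    between nondegenerate. *)
Lemma kuhn_edge_increment x p q (al be : nat) : (al < be)%N -> (be < r)%N ->
  cell (x + diag al) = p -> cell (x + diag be) = q ->
  let v := \row_i ((p 0 i != q 0 i)%:Z) in
  kuhn c (x + v) - kuhn c x = (c q - c p) / r%:R.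
Proof.
move=> ab br xp xq v.
rewrite /kuhn -mulrBr mulrC; congr (_ / _).
pose F b := c (cell (x + diag b)); pose F' b := c (cell (x + v + diag b)).
have vE i : v 0 i = (p 0 i != q 0 i)%:Z by rewrite mxE.
have pE i : p 0 i = divz (x 0 i + al%:Z) r%:Z by rewrite -xp cell_diag.
have qE i : q 0 i = divz (x 0 i + be%:Z) r%:Z by rewrite -xq cell_diag.
have bounds i : let P := p 0 i * r%:Z in P <= x 0 i + al%:Z < P + r%:Z /\
   ((p 0 i = q 0 i /\ x 0 i + be%:Z < P + r%:Z) \/
    [/\ p 0 i != q 0 i, q 0 i = p 0 i + 1 & P + r%:Z <= x 0 i + be%:Z]).
  have [a1 a2] := divz_bounds r0 (x 0 i + al%:Z).
  have [b1 b2] := divz_bounds r0 (x 0 i + be%:Z).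
  rewrite -pE in a1 a2; rewrite -qE in b1 b2.
  cbv zeta; rewrite a1 a2; split=> //.
  have [pq|/eqP pq] := eqVneq (p 0 i) (q 0 i); [by left; rewrite {2}pq|right].
  have Pb : p 0 i * r%:Z + r%:Z <= x 0 i + be%:Z.
    rewrite leNgt; apply/negP => h; apply: pq; rewrite [RHS]qE; apply/esym/(divz_unique r0) => //; lia.
  split=> //.
  by rewrite [LHS]qE; apply: (divz_unique r0); rewrite mulrDl mul1r; lia.
have out b : (b < al)%N \/ (be < b < r)%N -> F' b = F b.
  move=> hb; rewrite /F' /F; congr c; apply/rowP => i; rewrite !cell_diag coordD vE.
  have := bounds i; cbv zeta; set P := p 0 i * r%:Z; move=> [/andP[h1 h2]].
  case=> [[pq h3]|[-> qp h3]] /=; first by rewrite pq eqxx addr0.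
  case: hb => hb.
    by rewrite !(@divz_unique r r0 _ (p 0 i)) -/P//; lia.
  by rewrite !(@divz_unique r r0 _ (p 0 i + 1)) // ?mulrDl ?mul1r -/P; lia.
have mid b : (al <= b)%N -> (b < be)%N -> F' b = F b.+1.
  move=> hb1 hb2; rewrite /F' /F; congr c; apply/rowP => i; rewrite !cell_diag coordD vE.
  have := bounds i; cbv zeta; set P := p 0 i * r%:Z; move=> [/andP[h1 h2]].
  case=> [[pq h3]|[-> qp h3]] /=; last by congr (divz _ _); lia.
  rewrite {1}pq eqxx /=.
  by rewrite !(@divz_unique r r0 _ (p 0 i)) -/P//; lia.
have end_ : F' be = c q.
  rewrite /F'; congr c; apply/rowP => i; rewrite !cell_diag coordD vE.
  have := bounds i; cbv zeta; set P := p 0 i * r%:Z; move=> [/andP[h1 h2]].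
  case=> [[pq h3]|[-> qp h3]] /=; first by rewrite pq eqxx addr0 -qE.
  by rewrite (@divz_unique r r0 _ (q 0 i)) // qp mulrDl mul1r -/P; lia.
rewrite -!(big_mkord xpredT F') -!(big_mkord xpredT F).
rewrite !(@big_cat_nat _ _ _ al 0 r)//= ?(ltnW (ltn_trans ab br))//.
rewrite !(@big_cat_nat _ _ _ be.+1 al r)//= ?(leq_trans (ltnW ab))//.
rewrite [X in X + _ - _](_ : _ = \sum_(0 <= b < al) F b); last first.
  by apply: eq_big_nat => b /andP[_ ?]; apply: out; left.
rewrite [X in _ + (_ + X) - _](_ : _ = \sum_(be.+1 <= b < r) F b); last first.
  by apply: eq_big_nat => b /andP[? ?]; apply: out; right; apply/andP.
have -> : \sum_(al <= b < be.+1) F' b = \sum_(al <= b < be) F b.+1 + c q.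
  rewrite big_nat_recr ?(ltnW ab)//= end_; congr (_ + _).
  by apply: eq_big_nat => b /andP[? ?]; exact: mid.
have -> : \sum_(al <= b < be.+1) F b = c p + \sum_(al <= b < be) F b.+1.
  by rewrite big_nat_recl ?(ltnW ab)// /F xp.
ring.
Qed.

(** At most d * rho diagonal shifts change cell within the next rho shifts, so
    a value w of c with more weight than that is seen at a shift that does
    not. *)
Lemma kuhn_stable_vertex x (rho : nat) (w : R) : (w = 0 \/ w = 1) ->
  d%:R * rho%:R < \sum_(b < r) (1 - `|c (cell (x + diag b)) - w|) ->
  exists b, [/\ (b < r)%N, c (cell (x + diag b)) = w &
    cell (x + diag (b + rho)) = cell (x + diag b)].
Proof.
move=> w01; apply: contraPP => nex; apply/negP; rewrite -leNgt.
rewrite mulr_natl.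
rewrite (_ : rho%:R *+ d = \sum_(i < d) (\sum_(b < r) (divz (x 0 i + rho%:Z + b%:Z) r%:Z -
    divz (x 0 i + b%:Z) r%:Z))%:~R); last first.
  rewrite (eq_bigr (fun=> rho%:R)) ?sumr_const ?card_ord// => i _.
  by rewrite (sum_divz_shift r0).
under [leRHS]eq_bigr do rewrite rmorph_sum/=.
rewrite exchange_big/=; apply: ler_sum => b _.
have mono i : 0 <= divz (x 0 i + rho%:Z + b%:Z) r%:Z - divz (x 0 i + b%:Z) r%:Z.
  by rewrite subr_ge0; apply: divz_mono; lia.
have [cw|cw] := eqVneq (c (cell (x + diag b))) w; last first.
  rewrite (_ : 1 - _ = 0); first by apply: sumr_ge0 => i _; rewrite ler0z.
  by case: w01 cw => ->; case: (c01 (cell (x + diag b))) => ->; rewrite ?eqxx//=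
    ?subr0 ?sub0r ?normrN ?normr1 ?subrr.
rewrite cw subrr normr0 subr0.
have : cell (x + diag (b + rho)) != cell (x + diag b).
  by apply/eqP => h; apply: nex; exists b.
move=> /eqP neq; have [i hi] : exists i, cell (x + diag (b + rho)) 0 i != cell (x + diag b) 0 i.
  by apply/existsP; apply: contrapT => /negP; rewrite negb_exists => /forallP h;
    apply: neq; apply/rowP => i; apply/eqP; have := h i; rewrite negbK.
rewrite (bigD1 i)//=; apply: ler_wpDr.
  by apply: sumr_ge0 => k _; rewrite ler0z.
move: hi (mono i); rewrite !cell_diag PoszD (addrC b%:Z) addrA ler1z; lia.
Qed.

End Construction.

(** * Profiles around an arbitrary set *)

Section ExistsProfile.
Context {R : realType} {d : nat} (d0 : (0 < d)%N) (r rho : nat) (sigma : R).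
Context (rho0 : (0 < rho)%N) (rrho : (8 * d * rho <= r)%N).
Context (sigma_rho : 2 * sigma <= rho%:R) (sigma_big : 4 * d%:R ^+ 2 <= sigma).
Context (A : set (Zd d)).
Implicit Types (x z v k : Zd d).

Let r0 : (0 < r)%N. Proof. by apply: leq_trans rrho; rewrite !muln_gt0 d0. Qed.
Let rR : 0 < r%:R :> R. Proof. by rewrite ltr0n. Qed.
Let rhoR : 0 < rho%:R :> R. Proof. by rewrite ltr0n. Qed.
Let dR : 1 <= d%:R :> R. Proof. by rewrite ler1n. Qed.
Let s0 : 0 < sigma. Proof. by move: sigma_big dR; nra. Qed.
Let rrhoR : 8 * (d%:R * rho%:R) <= r%:R :> R.
Proof. by rewrite -!natrM ler_nat mulnA. Qed.

(** Every cell that a diagonal of length r starting close to a point of A can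
    meet, so that the interpolation is constant equal to 1 near A. *)
Let occupied k := exists2 a, A a & forall i,
  cell r a 0 i <= k 0 i <= cell r a 0 i + 2.

Let c k : R := (`[< occupied k >])%:R.

Let c01 k : c k = 0 \/ c k = 1.
Proof. by rewrite /c; case: (`[< _ >]); [right|left]. Qed.

Let f : Zd d -> R := kuhn r c.
Let F : Zd d -> R := smooth rho (enum 'I_d) f.
(** Positive outside and negative inside, and scaled so that steps change it
    by at most 1. *)
Let delta x : R := r%:R * (1 / 2 - F x).

Let f_lip x e : is_step e -> `|f (x + e) - f x| <= r%:R^-1.
Proof. exact: kuhn_lipschitz. Qed.

Let deltaB x v : delta (x + v) - delta x =
  - (r%:R * smooth rho (enum 'I_d) (fun z => f (z + v) - f z) x).
Proof. by rewrite /delta smooth_shiftB /F; ring. Qed.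

Let H1 x e : is_step e -> `|delta (x + e) - delta x| <= 1.
Proof.
move=> se; rewrite deltaB normrN normrM (ger0_norm (ltW rR)).
rewrite -ler_pdivlMl// mulr1 ler_norml; apply: smooth_between => // z _.
by rewrite -ler_norml; exact: f_lip.
Qed.

(** One difference is bounded by the Lipschitz constant of the interpolation
    and the other falls on the averaging window, which gives 2 / rho. *)
Let H2_ev x e j : is_step e ->
  `|delta (x + e + ev j) - delta (x + e) - delta (x + ev j) + delta x| <= sigma^-1.
Proof.
move=> se; set g := fun z => f (z + e) - f z.
have -> : delta (x + e + ev j) - delta (x + e) - delta (x + ev j) + delta x =
    - (r%:R * (smooth rho (enum 'I_d) g (x + ev j) - smooth rho (enum 'I_d) g x)).
  have h1 := deltaB (x + ev j) e; have h2 := deltaB x e.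
  rewrite -/g in h1 h2; rewrite (addrAC x e (ev j)) mulrBr opprB.
  by move: h1 h2; lra.
rewrite normrN normrM (ger0_norm (ltW rR)).
have jd : j \in enum 'I_d by rewrite mem_enum.
have gb z : `|g z| <= r%:R^-1 by exact: f_lip.
have := smooth_derivative rho0 x jd gb; rewrite -(ler_pM2l rR) => /le_trans; apply.
rewrite (_ : r%:R * _ = 2 / rho%:R); last by field; rewrite !gt_eqF.
by rewrite ler_pdivrMr// ler_pdivlMl//; have := sigma_rho; lra.
Qed.

Let H2 x e e' : is_step e -> is_step e' ->
  `|delta (x + e + e') - delta (x + e) - delta (x + e') + delta x| <= sigma^-1.
Proof.
move=> se [j [->|->]]; first exact: H2_ev.
have := H2_ev (x - ev j) j se; rewrite subrK (addrAC x (- ev j) e) subrK -normrN.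
by congr (`|_| <= _); ring.
Qed.

Let box_l1 x z : box rho (enum 'I_d) x z ->
  exists2 v, z = x + v & (l1 v <= d * rho)%N.
Proof.
move=> /(box_enum rho0) h; exists (z - x); first by rewrite addrC subrK.
rewrite /l1; apply: (@leq_trans (\sum_(i < d) rho)%N); last by rewrite sum_nat_const card_ord.
by apply: leq_sum => i _; rewrite coordB; have := h i; clear; lia.
Qed.

Let box_stable x z b : box rho (enum 'I_d) x z ->
  cell r (x + diag (b + rho)) = cell r (x + diag b) ->
  cell r (z + diag b) = cell r (x + diag b).
Proof.
move=> /(box_enum rho0) h hb; apply/rowP => i; have /andP[h1 h2] := h i.
have := congr1 (fun w : Zd d => w 0 i) hb; rewrite /= !cell_diag PoszD => hbi.
apply/eqP; rewrite eq_le; apply/andP; split.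
  by rewrite -hbi; apply: lez_pdiv2r => //; clear -h2; lia.
by apply: lez_pdiv2r => //; clear -h1; lia.
Qed.

(** The window is small compared with r, so averaging over it hardly moves the
    Lipschitz function f. *)
Let f_near x : `|f x - F x| <= 1 / 8.
Proof.
have near_ z : box rho (enum 'I_d) x z -> `|f z - f x| <= 1 / 8.
  move=> /box_l1[v -> lv].
  apply: le_trans (lipschitz_l1 _ f_lip x v) _; first by rewrite invr_ge0.
  rewrite ler_pdivrMl//; apply: le_trans (_ : (d * rho)%:R <= _); first by rewrite ler_nat.
  by rewrite natrM; have := rrhoR; lra.
have := @smooth_between R d rho rho0 (enum 'I_d) f x (f x - 1/8) (f x + 1/8).
rewrite -/F ler_norml => h; have /andP[] : f x - 1 / 8 <= F x <= f x + 1 / 8; last by lra.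
by apply: h => z /near_; rewrite ler_norml; lra.
Qed.

Let fE x : \sum_(b < r) c (cell r (x + diag b)) = r%:R * f x.
Proof. by rewrite /f /kuhn mulVKf ?gt_eqF. Qed.

Let sum_one : \sum_(b < r) (1 : R) = r%:R.
Proof. by rewrite sumr_const card_ord. Qed.

Let vertex1 x : 1 / 4 <= f x ->
  exists b, [/\ (b < r)%N, c (cell r (x + diag b)) = 1 &
    cell r (x + diag (b + rho)) = cell r (x + diag b)].
Proof.
move=> fx; apply: (kuhn_stable_vertex r0 c01); first by right.
rewrite (eq_bigr (fun b : 'I_r => c (cell r (x + diag b)))); last first.
  move=> b _; case: (c01 (cell r (x + diag b))) => ->; rewrite ?subrr ?normr0 ?subr0//.
  by rewrite sub0r normrN normr1 subrr.
rewrite fE; have := rrhoR; have := rR; nra.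
Qed.

Let vertex0 x : f x <= 3 / 4 ->
  exists b, [/\ (b < r)%N, c (cell r (x + diag b)) = 0 &
    cell r (x + diag (b + rho)) = cell r (x + diag b)].
Proof.
move=> fx; apply: (kuhn_stable_vertex r0 c01); first by left.
rewrite (eq_bigr (fun b : 'I_r => 1 - c (cell r (x + diag b)))); last first.
  by move=> b _; case: (c01 (cell r (x + diag b))) => ->; rewrite subr0 ?normr1 ?normr0.
rewrite sumrB sum_one fE; have := rrhoR; have := rR; nra.
Qed.

(** The edge found at x serves at all points of the averaging window at once,
    because its end points are stable; so its slope survives the averaging. *)
Let edge x (al be : nat) : (al < be)%N -> (be < r)%N ->
  cell r (x + diag (al + rho)) = cell r (x + diag al) ->
  cell r (x + diag (be + rho)) = cell r (x + diag be) ->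
  exists2 v : Zd d, (forall i, v 0 i = 0 \/ v 0 i = 1) &
   delta (x + v) - delta x = c (cell r (x + diag al)) - c (cell r (x + diag be)).
Proof.
move=> ab br sa sb.
set p := cell r (x + diag al); set q := cell r (x + diag be).
exists (\row_i ((p 0 i != q 0 i)%:Z)).
  by move=> i; rewrite mxE; case: (p 0 i == q 0 i); [left|right].
rewrite deltaB.
have inc z : box rho (enum 'I_d) x z ->
    f (z + (\row_i ((p 0 i != q 0 i)%:Z))) - f z = (c q - c p) / r%:R.
  move=> xz; apply: (kuhn_edge_increment r0 c ab br).
    exact: box_stable xz sa.
  exact: box_stable xz sb.
have := @smooth_between R d rho rho0 (enum 'I_d)
  (fun z => f (z + (\row_i ((p 0 i != q 0 i)%:Z))) - f z) x
  ((c q - c p) / r%:R) ((c q - c p) / r%:R).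
have {}inc z : box rho (enum 'I_d) x z -> (c q - c p) / r%:R <=
   f (z + (\row_i ((p 0 i != q 0 i)%:Z))) - f z <= (c q - c p) / r%:R.
  by move=> /inc ->; rewrite !lexx.
move=> /(_ inc) h; rewrite (_ : smooth _ _ _ _ = (c q - c p) / r%:R); last first.
  by apply/eqP; rewrite eq_le andbC.
by field; rewrite gt_eqF.
Qed.

(** Near the zero level f is away from 0 and 1, so both values of c carry
    weight at x, and along the edge between two such vertices delta changes by
    exactly 1. The edge is a vector with entries 0 and 1, so by the Taylor
    expansion one of the d partial differences is of order 1/d. *)
Let H3 x : `|delta x| <= 1 / (4 * d%:R) * sigma ->
  exists2 e, is_step e & 1 / (4 * d%:R) <= delta (x + e) - delta x.
Proof.
move=> hx; have dR' := dR; have s0' := s0.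
have a4 : 1 / (4 * d%:R) <= 1 / 4 :> R.
  by rewrite ler_pdivrMr ?mulr_gt0//; lra.
have Fx : `|F x - 1 / 2| <= 1 / 8.
  have : `|delta x| <= r%:R / 8.
    apply: le_trans hx _; have : 1 / (4 * d%:R) * sigma <= 1 / 4 * sigma by rewrite ler_pM2r.
    have h8 : 8 * rho%:R <= r%:R :> R.
      by apply: le_trans rrhoR; rewrite ler_pM2l// ler_peMl// ltW.
    have := sigma_rho; have := s0; lra.
  rewrite /delta normrM (ger0_norm (ltW rR)) distrC -ler_pdivlMl//.
  by rewrite (_ : r%:R^-1 * _ = 1 / 8)//; field; rewrite gt_eqF.
have fx := f_near x.
move: Fx fx; rewrite !ler_norml => /andP[F1 F2] /andP[f1 f2].
have [b1 [b1r c1 s1]] : exists b, [/\ (b < r)%N, c (cell r (x + diag b)) = 1 &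
    cell r (x + diag (b + rho)) = cell r (x + diag b)] by apply: vertex1; lra.
have [b0 [b0r c0 s0_]] : exists b, [/\ (b < r)%N, c (cell r (x + diag b)) = 0 &
    cell r (x + diag (b + rho)) = cell r (x + diag b)] by apply: vertex0; lra.
have [v v01 hv] : exists2 v : Zd d, (forall i, v 0 i = 0 \/ v 0 i = 1) &
    `|delta (x + v) - delta x| = 1.
  have [lt|lt|eq] := ltngtP b0 b1.
  - have [v v01 hv] := edge lt b1r s0_ s1; exists v => //.
    by rewrite hv c0 c1 sub0r normrN normr1.
  - have [v v01 hv] := edge lt b0r s1 s0_; exists v => //.
    by rewrite hv c0 c1 subr0 normr1.
  - by move: c0; rewrite eq c1 => /eqP; rewrite oner_eq0.
have lv : (l1 v <= d)%N.
  rewrite /l1; apply: (@leq_trans (\sum_(i < d) 1)%N); last by rewrite sum1_card card_ord.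
  by apply: leq_sum => i _; case: (v01 i) => ->.
have half : 1 / 2 <= `|\sum_i (v 0 i)%:~R * grad delta x i|.
  have := @linear_approx R d sigma delta s0 H2 x v.
  have : sigma^-1 * (l1 v)%:R ^+ 2 <= 1 / 4.
    rewrite ler_pdivrMl//; apply: le_trans (_ : d%:R ^+ 2 <= _); last by have := sigma_big; lra.
    by rewrite -!natrX ler_nat leq_sqr.
  move=> h1 h2; have := ler_normD (delta (x + v) - delta x - \sum_i (v 0 i)%:~R * grad delta x i)
     (\sum_i (v 0 i)%:~R * grad delta x i).
  rewrite subrK hv; lra.
have [i gi] : exists i, 1 / (2 * d%:R) <= `|grad delta x i|.
  apply: contrapT => nex.
  have : `|\sum_i (v 0 i)%:~R * grad delta x i| < 1 / 2; last by lra.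
  apply: le_lt_trans (ler_norm_sum _ _ _) _.
  have -> : 1 / 2 = \sum_(i < d) 1 / (2 * d%:R) :> R.
    by rewrite sumr_const card_ord -[RHS]mulr_natl; field; lra.
  apply: ltr_sum; first by apply/hasP; exists (Ordinal d0); rewrite ?mem_index_enum.
  move=> i _; have gi : `|grad delta x i| < 1 / (2 * d%:R).
    by rewrite ltNge; apply/negP => h; apply: nex; exists i.
  case: (v01 i) => ->; first by rewrite mulr0z mul0r normr0 divr_gt0// mulr_gt0//; lra.
  by rewrite mulr1z mul1r.
have a42 : 1 / (4 * d%:R) + sigma^-1 <= 1 / (2 * d%:R) :> R.
  have : sigma^-1 <= (4 * d%:R)^-1.
    rewrite lef_pV2 ?posrE ?mulr_gt0//; last by lra.
    have := sigma_big; nra.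
  rewrite (_ : 1 / (2 * d%:R) = 1 / (4 * d%:R) + (4 * d%:R)^-1); first by lra.
  by field; lra.
have sg : 0 < sigma^-1 by rewrite invr_gt0.
move: gi; rewrite ler_normr => /orP[gi|gi].
  by exists (ev i); [exists i; left|move: gi; rewrite /grad; lra].
exists (- ev i); first by exists i; right.
have := @increment_opp R d sigma delta H2 x i; rewrite ler_norml => /andP[h _].
by lra.
Qed.

(** Smoothed interpolation of the indicator of a union of cells of side r
    around A. The value 1/(4d) is what remains of 1/(2d), the lower bound for
    the largest partial difference, after rounding errors of order 1/sigma. *)
Lemma exists_profile : exists2 delta : Zd d -> R,
  profile sigma (1 / (4 * d%:R)) delta &
  (forall x, A x -> delta x <= 0) /\
  (forall x, delta x <= 0 -> exists2 a, A a & enorm R (x - a) <= d%:R * (3 * r%:R)).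
Proof.
exists delta; first by split; [exact: H1|exact: H2|exact: H3].
split=> [x Ax|x dx].
  have F1 : 1 <= F x.
    have := @smooth_between R d rho rho0 (enum 'I_d) f x 1 1.
    have h z : box rho (enum 'I_d) x z -> 1 <= f z <= 1.
      move=> /(box_enum rho0) hz; rewrite /f /kuhn (eq_bigr (fun=> 1)) ?sum_one; last first.
        move=> b _; rewrite /c; case: asboolP => // -[]; exists x => // i.
        rewrite cell_diag mxE; have := hz i; have := ltn_ord b; have bx := divz_bounds r0 (x 0 i).
        have rho_r : (rho <= r)%N by apply: leq_trans rrho; rewrite leq_pmull// muln_gt0 d0.
        move=> br hzi; apply/andP; split; first by apply: lez_pdiv2r => //; lia.
        rewrite -ltzD1 ltz_divLR ?ltz_nat// mulrDl mul1r mulrDl; lia.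
      by rewrite mulVf ?gt_eqF// lexx.
    by move=> /(_ h) /andP[].
  by rewrite /delta pmulr_rle0//; lra.
have F1 : 1 / 2 <= F x by move: dx; rewrite /delta pmulr_rle0//; lra.
have [z xz fz] : exists2 z, box rho (enum 'I_d) x z & f z != 0.
  apply: contrapT => nex.
  have := @smooth_between R d rho rho0 (enum 'I_d) f x 0 0.
  have h z : box rho (enum 'I_d) x z -> 0 <= f z <= 0.
    move=> xz; have [->|fz] := eqVneq (f z) 0; first by rewrite lexx.
    by exfalso; apply: nex; exists z.
  by move=> /(_ h) /andP[_]; rewrite -/F; lra.
have [b cb] : exists b : 'I_r, c (cell r (z + diag b)) != 0.
  apply/existsP; apply: contraNT fz => /existsPn/= h.
  rewrite /f /kuhn big1 ?mulr0// => b _; apply/eqP.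
  by have := h b; rewrite negbK.
move: cb; rewrite /c; case: asboolP; last by rewrite eqxx.
move=> [a Aa ha] _; exists a => //.
rewrite enormE; apply: vnorm_sup => [i|]; last by rewrite mulr_ge0.
rewrite /toR -intr_norm (_ : 3 * r%:R = (3 * r%:Z)%:~R); last by rewrite intrM.
rewrite ler_int coordB; have := ha i; rewrite cell_diag mxE.
have [a1 a2] := divz_bounds r0 (a 0 i); have [b1 b2] := divz_bounds r0 (z 0 i + b%:Z).
move=> /andP[h1 h2].
have h1r : divz (a 0 i) r%:Z * r%:Z <= divz (z 0 i + b%:Z) r%:Z * r%:Z.
  by rewrite ler_pM2r ?ltz_nat.
have h2r : divz (z 0 i + b%:Z) r%:Z * r%:Z <= (divz (a 0 i) r%:Z + 2) * r%:Z.
  by rewrite ler_pM2r ?ltz_nat.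
rewrite mulrDl in h2r.
have := box_enum rho0 xz i; have := ltn_ord b.
have rho_r : (rho <= r)%N by apply: leq_trans rrho; rewrite leq_pmull// muln_gt0 d0.
move: (divz (a 0 i) r%:Z * r%:Z) (divz (z 0 i + b%:Z) r%:Z * r%:Z) a1 a2 b1 b2 h1r h2r.
move: (a 0 i) (x 0 i) (z 0 i) (nat_of_ord b) => u1 u2 u3 u4 P1 P2 a1 a2 b1 b2 h1r h2r hb hz.
rewrite ler_norml; clear -a1 a2 b1 b2 h1r h2r hb hz rho_r; lia.
Qed.

End ExistsProfile.

(** * Sublevel sets: size of the hitting probabilities *)

Section SmoothSets.
Context {R : realType} {d : nat} (d3 : (3 <= d)%N).
Context (a : R) (a0 : 0 < a) (a1 : a <= 1).
Implicit Types (x y z e v w : Zd d) (l g sigma : R) (delta : Zd d -> R).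

Let d0 : (0 < d)%N. Proof. by apply: leq_trans d3. Qed.
Let dR : 3 <= d%:R :> R. Proof. by rewrite ler_nat. Qed.

Local Notation kap := (@kappa R d a).

Local Ltac clear_local := clear - d3 a0 a1 d0 dR.
Local Tactic Notation "lra_from" hyp_list(hs) :=
  revert hs; clear - d3 a0 a1 d0 dR; intros; lra.

Definition inside delta : set (Zd d) := [set x | delta x <= 0].

Lemma setC_inside delta : ~` inside delta = outside delta.
Proof.
apply/seteqP; split=> x; rewrite /inside/= /outside/=; first by move/negP; rewrite -ltNge.
by move=> h; apply/negP; rewrite -ltNge.
Qed.

Lemma boundaryP sigma delta y : profile sigma a delta ->
  int_boundary R (inside delta) y ->
  [/\ delta y <= 0, - 1 <= delta y & exists2 e, is_step e & 0 < delta (y + e)].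
Proof.
case=> H1 _ _ [dy [z /neighborP[e se ->] nz]]; split=> //; last first.
  by exists e => //; rewrite ltNge; exact/negP.
have := H1 y e se; rewrite ler_norml => /andP[_].
have : 0 < delta (y + e) by rewrite ltNge; exact/negP.
lra.
Qed.

Lemma srw_hit_upper : exists2 C : R, 0 < C & forall sigma delta, 0 < sigma ->
  profile sigma a delta -> forall y x l, 16 * kap <= l -> l * kap <= sigma ->
  int_boundary R (inside delta) y -> l <= enorm R (x - y) ->
  (srw R x (enters_at R (inside delta) y) <= (C * l ^- (d - 1))%:E)%E.
Proof.
have [C C0 H] := hit_upper d3 a0 a1; exists C => // sigma delta s0 P y x l l16 ls by_ xy.
have [dy _ _] := boundaryP P by_.
have k8 : 8 <= kap by exact: kappa_ge8.
rewrite (srw_enters_at d3)//; last first.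
  by apply/eqP => e; move: xy; rewrite e subrr enorm0; lra.
by rewrite lee_fin setC_inside; exact: (H sigma).
Qed.

Lemma grad_norm sigma delta y : 0 < sigma -> profile sigma a delta ->
  2 / a <= sigma -> `|delta y| <= a * sigma ->
  a / 2 <= vnorm (grad delta y) /\ forall i, `|grad delta y i| <= 1.
Proof.
move=> s0 P sa dy; have [H1 H2 H3] := P.
split; last by move=> i; apply: H1; exists i; left.
have a0' := a0; have is0 : sigma^-1 <= a / 2.
  by rewrite -[leRHS]invrK lef_pV2 ?posrE ?invf_div ?divr_gt0//.
have [e [i [->|->]] he] := H3 y dy.
  apply: le_trans (ler_coord_vnorm (grad delta y) i).
  by apply: le_trans (ler_norm _); rewrite /grad; lra.
apply: le_trans (ler_coord_vnorm (grad delta y) i).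
rewrite -normrN; apply: le_trans (ler_norm _).
have := increment_opp H2 y i; rewrite ler_norml => /andP[_]; lra.
Qed.

(** The point at distance t from y in direction n, rounded down. *)
Definition ray_point (n : 'I_d -> R) y (t : R) : Zd d :=
  \row_i (y 0 i + Num.floor (t * n i)).

Lemma ray_pointP n y t : exists2 f : 'I_d -> R, (forall i, 0 <= f i <= 1) &
  forall i, ((ray_point n y t - y) 0 i)%:~R = t * n i - f i.
Proof.
exists (fun i => t * n i - (Num.floor (t * n i))%:~R) => i.
  have /andP[h1 h2] := floor_itv (t * n i).
  by move: h2; rewrite intrD => h2; apply/andP; split; lra.
by rewrite coordB mxE addrAC subrr add0r subKr.
Qed.

Lemma vnorm_frac (f : 'I_d -> R) : (forall i, 0 <= f i <= 1) -> vnorm (fun i => - f i) <= d%:R.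
Proof.
move=> f01; rewrite -[leRHS]mulr1; apply: vnorm_sup => // i.
by have := f01 i; rewrite normrN ler_norml; lra.
Qed.

Lemma ray_point_dist n y t : vnorm n = 1 -> 0 <= t ->
  `|enorm R (ray_point n y t - y) - t| <= d%:R.
Proof.
move=> n1 t0; have [f f01 fE] := ray_pointP n y t.
have e1 : enorm R (ray_point n y t - y) <= t + d%:R.
  rewrite enormE (@vnorm_eq _ _ _ (fun i => t * n i + - f i)) => [|i]; last exact: fE.
  apply: le_trans (vnormD _ _) _; rewrite vnormZ n1 mulr1 ger0_norm// lerD2l.
  exact: vnorm_frac.
have e2 : t <= enorm R (ray_point n y t - y) + d%:R.
  have tE : t = vnorm (fun i => t * n i) by rewrite vnormZ n1 mulr1 ger0_norm.
  rewrite [leLHS]tE.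
  rewrite (@vnorm_eq _ _ _ (fun i => toR (ray_point n y t - y) i + f i)); last first.
    by move=> i; rewrite /toR fE subrK.
  apply: le_trans (vnormD _ _) _; apply: lerD; first exact: lexx.
  rewrite -[leRHS]mulr1; apply: vnorm_sup => // i.
  by have := f01 i; rewrite ler_norml; lra.
by rewrite ler_norml; lra.
Qed.

Lemma ray_point_dist2 n y t t' : vnorm n = 1 -> t' <= t ->
  enorm R (ray_point n y t - ray_point n y t') <= t - t' + d%:R.
Proof.
move=> n1 tt; have [f f01 fE] := ray_pointP n y t; have [f' f01' fE'] := ray_pointP n y t'.
rewrite (_ : _ - _ = (ray_point n y t - y) - (ray_point n y t' - y)); last first.
  by rewrite opprB addrA subrK.
rewrite enormE (@vnorm_eq _ _ _ (fun i => (t - t') * n i + (f' i - f i))); last first.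
  by move=> i; rewrite /toR coordB rmorphB/= fE fE'; ring.
apply: le_trans (vnormD _ _) _; rewrite vnormZ n1 mulr1 ger0_norm ?subr_ge0// lerD2l.
rewrite -[leRHS]mulr1; apply: vnorm_sup => // i.
by have := f01 i; have := f01' i; rewrite ler_norml; lra.
Qed.

(** Along its gradient delta grows at rate at least a / 2, up to O(g^2 /
    sigma), so a ball in that direction is at height of order g. The distances
    from y, 11 / 5 * g for the centre and 3 / 2 * g for the point w0 of the
    ball, leave room for rounding. *)
Lemma exterior_ball : exists g0 th : R, [/\ 1 <= g0, 0 < th &
  forall sigma delta, 0 < sigma -> profile sigma a delta ->
  forall y g, g0 <= g -> g <= th * sigma -> - 1 <= delta y -> delta y <= 0 ->
  exists z : Zd d,
   [/\ g <= zdist R y (zball z g), zdist R y (zball z g) <= 2 * g &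
    forall x, zball z g x -> a * g / 4 <= delta x /\ enorm R (x - y) <= 33 / 10 * g]].
Proof.
have a0' := a0; have a1' := a1; have dR' := dR.
exists (10 * d%:R + 8 * d%:R / a + 2 / a), (a / (110 * d%:R)); split.
- have : 0 <= 8 * d%:R / a by rewrite divr_ge0//; lra.
  have : 0 <= 2 / a by rewrite divr_ge0//; lra.
  lra.
- by rewrite divr_gt0// mulr_gt0//; lra_from dR'.
move=> sigma delta s0 P y g gg gs dy1 dy0.
have p1 : 0 <= 8 * d%:R / a by rewrite divr_ge0//; lra.
have p2 : 0 <= 2 / a by rewrite divr_ge0//; lra.
have gp : 0 < g by lra.
have agd : 8 * d%:R <= a * g by rewrite (mulrC a) -ler_pdivrMr//; lra.
have ag2 : 2 <= a * g by lra.
have gs1 : g <= a * sigma.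
  have : a / (110 * d%:R) * sigma <= a * sigma.
    rewrite ler_pM2r// ler_pdivrMr ?mulr_gt0//; last by lra.
    by rewrite ler_peMr//; lra.
  lra.
have asg : a * sigma <= sigma by rewrite ler_piMl// ltW.
have sa : 2 / a <= sigma by lra.
have dya : `|delta y| <= a * sigma by rewrite ler_norml; apply/andP; split; lra.
have [pn pi1] := grad_norm s0 P sa dya.
set p := grad delta y in pn pi1 *; set pn' := vnorm p in pn.
have pp : 0 < pn' by lra.
pose n i := pn'^-1 * p i.
have n1 : vnorm n = 1 by rewrite /n vnormZ ger0_norm ?invr_ge0 ?ltW// mulVf// gt_eqF.
pose t := 11 / 5 * g; pose t' := 3 / 2 * g.
pose z := ray_point n y t; pose w0 := ray_point n y t'.
have zy : `|enorm R (z - y) - t| <= d%:R by apply: ray_point_dist => //; rewrite /t; lra.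
have wy : `|enorm R (w0 - y) - t'| <= d%:R by apply: ray_point_dist => //; rewrite /t'; lra.
have zw : enorm R (z - w0) <= t - t' + d%:R by apply: ray_point_dist2 => //; rewrite /t /t'; lra.
move: zy wy zw; rewrite !ler_norml /t /t' => /andP[zy1 zy2] /andP[wy1 wy2] zw.
have w0b : zball z g w0 by rewrite /zball/=; lra_from gg p1 p2 wy1 wy2 zw.
exists z; split.
- apply: lb_le_inf; first by exists (enorm R (y - w0)), w0.
  move=> _ [w /= wz <-]; rewrite /zball/= in wz.
  have := enorm_tri (R := R) z w y; rewrite (enormB w y); lra_from gg p1 p2 zy1 wy1 wy2 wz.
- apply: le_trans (_ : enorm R (y - w0) <= _); last by rewrite enormB; lra_from gg p1 p2 wy1 wy2.
  apply: ge_inf; last by exists w0.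
  by exists 0 => _ [w _ <-]; exact: enorm_ge0.
move=> x xz; rewrite /zball/= enormB in xz.
have xy : enorm R (x - y) <= 33 / 10 * g.
  by apply: le_trans (enorm_tri x z y) _; lra_from gg p1 p2 zy2 xz.
split=> //.
have [f f01 fE] := ray_pointP n y t.
have := profile_linear_approx s0 P y (x - y); rewrite [y + (x - y)]addrC subrK.
have -> : \sum_i ((x - y) 0 i)%:~R * grad delta y i =
    \sum_i toR (x - z) i * p i + (t * pn' - \sum_i f i * p i).
  have -> : t * pn' = \sum_i t * (n i * p i).
    rewrite -mulr_sumr; congr (_ * _).
    rewrite (eq_bigr (fun i => pn'^-1 * (p i ^+ 2))) => [|i _]; last by rewrite /n; ring.
    by rewrite -mulr_sumr -sqr_vnorm -/pn' expr2 mulKf// gt_eqF.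
  rewrite -sumrB -big_split/=; apply: eq_bigr => i _.
  rewrite (_ : x - y = (x - z) + (z - y)); last by rewrite addrA subrK.
  rewrite coordD rmorphD/= [X in _ + X](fE i) -/p /toR; ring.
have c1 : - (g * pn') <= \sum_i toR (x - z) i * p i.
  have := cauchy_schwarz (fun i => - toR (x - z) i) p.
  rewrite (_ : \sum_i _ = - \sum_i toR (x - z) i * p i); last first.
    by rewrite -sumrN; apply: eq_bigr => i _; rewrite mulNr.
  have -> : vnorm (fun i => - toR (x - z) i) = enorm R (x - z).
    by rewrite -enormN enormE; apply: vnorm_eq => i; rewrite /toR coordN rmorphN.
  have : enorm R (x - z) * pn' <= g * pn' by rewrite ler_pM2r.
  rewrite -/pn'; clear_local; lra.
have c2 : \sum_i f i * p i <= d%:R.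
  apply: le_trans (ler_norm _) _; apply: le_trans (ler_norm_sum _ _ _) _.
  apply: le_trans (_ : \sum_(i < d) (1 : R) <= _); last by rewrite sumr_const card_ord.
  apply: ler_sum => i _; rewrite normrM mulr_ile1//.
  by have := f01 i; rewrite ler_norml; clear_local; lra.
have c3 : sigma^-1 * (l1 (x - y))%:R ^+ 2 <= 11 * d%:R * g * (a / (110 * d%:R)).
  rewrite ler_pdivrMl//.
  have q1 : nsq (x - y) <= 11 * g ^+ 2.
    rewrite -sqr_enorm; apply: le_trans (_ : (33 / 10 * g) ^+ 2 <= _).
      by rewrite ler_sqr ?nnegrE ?enorm_ge0//; lra_from gp.
    by have := sqr_ge0 g; rewrite exprMn; clear_local; lra.
  apply: le_trans (l1_sq (x - y)) _.
  apply: le_trans (_ : d%:R * (11 * g ^+ 2) <= _); first by rewrite ler_wpM2l.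
  have : 11 * d%:R * g * g <= 11 * d%:R * g * (a / (110 * d%:R) * sigma).
    by rewrite ler_wpM2l// !mulr_ge0// ltW.
  clear_local; lra.
have c4 : 11 * d%:R * g * (a / (110 * d%:R)) = a * g / 10.
  by field; lra_from dR'.
rewrite c4 in c3; rewrite ler_norml => /andP[lo _].
have c5 : g * (a / 2) <= g * pn' by rewrite ler_pM2l.
move: lo; rewrite /t; lra_from dR' dy1 agd c1 c2 c3 c5.
Qed.

(** The whole exterior ball is at height of order g, so hit_lower applies at
    each of its points. *)
Lemma srw_hit_lower : exists c g0 th : R, [/\ 0 < c, 1 <= g0, 0 < th &
  forall sigma delta, 0 < sigma -> profile sigma a delta ->
  forall y g, g0 <= g -> g <= th * sigma -> int_boundary R (inside delta) y ->
  exists z : Zd d,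
   [/\ g <= zdist R y (zball z g), zdist R y (zball z g) <= 2 * g &
    forall x, zball z g x ->
    ((c * g ^- (d - 1))%:E <= srw R x (enters_at R (inside delta) y `&`
       enters_before R (inside delta) (~` zball y (4 * g))))%E]].
Proof.
have a0' := a0; have a1' := a1; have dR' := dR.
have [g1 [th1 [g11 th10 HB]]] := exterior_ball.
have C21 : 1 <= 14 / a by rewrite ler_pdivlMr//; lra.
have [c [l0 [th2 [c0 l01 th20 HL]]]] := hit_lower d3 a0 a1 C21.
exists c, (g1 + 4 * l0 / a), (Num.min th1 (th2 / 4)); split=> //.
- by have : 0 <= 4 * l0 / a; [rewrite divr_ge0//; lra|lra].
- by rewrite lt_min th10 divr_gt0.
move=> sigma delta s0 P y g gg gs by_.
have [dy0 dy1 ye] := boundaryP P by_.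
have p1 : 0 <= 4 * l0 / a by rewrite divr_ge0//; lra.
have gs1 : g <= th1 * sigma.
  by apply: le_trans gs _; rewrite ler_pM2r// ge_min lexx.
have gs2 : g <= th2 / 4 * sigma.
  by apply: le_trans gs _; rewrite ler_pM2r// ge_min lexx orbT.
have gg1 : g1 <= g by lra.
have [z [z1 z2 z3]] := HB sigma delta s0 P y g gg1 gs1 dy1 dy0.
exists z; split=> // x xz; have [dx xy] := z3 x xz.
have gp : 0 < g by lra.
have agp : 0 < a * g by apply: mulr_gt0.
have ag_g : a * g <= g by rewrite ler_piMl// ltW.
rewrite (srw_enters_before d3)//; last 2 first.
- by rewrite /zball/= subrr enorm0; lra.
- by apply/eqP => e; move: dx; rewrite e; lra.
rewrite lee_fin setC_inside.
pose l := a * g / 4.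
have lp : 0 < l by rewrite /l; lra_from agp.
have lg : l <= g by rewrite /l; lra.
have ll0 : l0 <= l.
  by rewrite /l ler_pdivlMr// mulrC (mulrC a) -ler_pdivrMr//; lra_from g11 gg.
have etl : @eta R d a * l <= delta x.
  have := eta_le d0 a0 a1; have : @eta R d a * l <= 1 / 16 * l.
    by rewrite ler_pM2r// eta_le.
  by move: dx; rewrite /l; lra_from agp.
have rl : 33 / 10 * g <= 14 / a * l.
  by rewrite /l (_ : 14 / a * (a * g / 4) = 7 / 2 * g); [lra_from lp lg|field; rewrite gt_eqF].
apply: le_trans (HL sigma delta s0 P x y l (33 / 10 * g) (4 * g) ll0 _ rl _ _ ye xy etl).
- rewrite ler_pM2l// lef_pV2 ?posrE ?exprn_gt0//.
  by rewrite lerXn2r ?nnegrE// ltW.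
- by lra_from lp lg.
- lra_from gs2 lp lg.
- by rewrite /l; lra_from ag_g lp lg.
Qed.

End SmoothSets.

(** * Counting boundary points *)

Section Counting.

(** Points on distinct lines in direction i are distinct, and the lines are
    indexed by the functions from the d - 1 other coordinates to the side of a
    cube. *)
Lemma count_columns (d : nat) (i : 'I_d) (y : Zd d) (M : nat) (S : set (Zd d)) :
  (0 < M)%N -> finite_set S ->
  (forall v : Zd d, v 0 i = 0 -> (forall k, 0 <= v 0 k < M%:Z) ->
     exists m : int, S (y + v + m *: ev i)) ->
  (M ^ d.-1 <= #|` fset_set S|)%N.
Proof.
case: d i y S => [[]//|n] i y S M0 fS H /=.
pose vec (phi : {ffun 'I_n -> 'I_M}) : Zd n.+1 :=
  \row_k (if unlift i k is Some j then (phi j : nat)%:Z else 0).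
have vec_i phi : vec phi 0 i = 0 by rewrite mxE unlift_none.
have /choice[m hm] : forall phi, exists m : int, S (y + vec phi + m *: ev i).
  move=> phi; apply: H; first exact: vec_i.
  move=> k; rewrite mxE; case: (unliftP i k) => [j|] _; last by rewrite lexx ltz_nat.
  by rewrite lez_nat ltz_nat /=.
pose g phi := y + vec phi + m phi *: ev i.
have g_inj : injective g.
  move=> phi psi e; apply/ffunP => j; apply/val_inj.
  have := congr1 (fun w : Zd n.+1 => w 0 (lift i j)) e.
  rewrite /g !mxE liftK !(eq_sym (lift i j)) !(negbTE (neq_lift i j)) /=.
  by rewrite !mulr0 !addr0 => /addrI[].
rewrite -[in X in (X ^ _)%N](card_ord M) -[in X in (_ ^ X)%N](card_ord n) -card_ffun.
rewrite cardE -(size_map g); apply: uniq_leq_size.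
  by rewrite map_inj_uniq// enum_uniq.
by move=> w /mapP[phi _ ->]; rewrite in_fset_set// inE; exact: hm.
Qed.

End Counting.

Section BoundaryGeometry.
Context {R : realType} {d : nat} (d3 : (3 <= d)%N).
Context (a : R) (a0 : 0 < a) (a1 : a <= 1).
Implicit Types (x y z e v w : Zd d) (l g sigma : R) (delta : Zd d -> R).

Let d0 : (0 < d)%N. Proof. by apply: leq_trans d3. Qed.
Let dR : 3 <= d%:R :> R. Proof. by rewrite ler_nat. Qed.

Local Notation kap := (@kappa R d a).

Local Ltac clear_local := clear - d3 a0 a1 d0 dR.
Local Tactic Notation "lra_from" hyp_list(hs) :=
  revert hs; clear - d3 a0 a1 d0 dR; intros; lra.

Lemma enorm_le_l1 v : enorm R v <= (l1 v)%:R.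
Proof.
move: v; apply: l1_ind => [|v e se lv IH]; first by rewrite enorm0.
by apply: le_trans (enormD _ _) _; rewrite (enorm_step se) lv -natr1 lerD2r.
Qed.

Lemma l1N v : l1 (- v) = l1 v.
Proof. by rewrite /l1; apply: eq_bigr => i _; rewrite coordN abszN. Qed.

Lemma l1_mulrn e n : is_step e -> l1 (e *+ n) = n.
Proof.
have evn (i : 'I_d) : l1 (ev i *+ n) = n.
  rewrite /l1 (bigD1 i)//= big1 => [|k ki]; first by rewrite coord_evMn eqxx addn0.
  by rewrite coord_evMn eq_sym (negbTE ki).
by move=> [i [->|->]]; rewrite ?mulNrn ?l1N evn.
Qed.

(** At y the profile grows by at least a along e; within distance a / 2 *
    sigma it still grows by a / 2, so on a line that starts close to y it
    changes sign. *)
Lemma column_crossing sigma delta y e v (T : nat) : 0 < sigma ->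
  profile sigma a delta -> is_step e -> a <= delta (y + e) - delta y ->
  delta y <= 0 -> - 1 <= delta y ->
  (l1 v + T)%:R <= a / 2 * sigma -> (l1 v)%:R + 1 < a / 2 * T%:R ->
  exists n : nat, [/\ (n < 2 * T)%N, delta (y + v - e *+ T + e *+ n) <= 0 &
    0 < delta (y + v - e *+ T + e *+ n.+1)].
Proof.
move=> s0 P se he dy0 dy1 small big; have [H1 H2 H3] := P.
have inc w : (l1 w <= l1 v + T)%N -> a / 2 <= delta (y + w + e) - delta (y + w).
  move=> lw; have := increment_lipschitz s0 H2 y w se; rewrite ler_norml => /andP[h _].
  have : sigma^-1 * (l1 w)%:R <= a / 2.
    rewrite ler_pdivrMl// mulrC; apply: le_trans small.
    by rewrite ler_nat.
  by lra.
have l1D w w' : (l1 (w + w') <= l1 w + l1 w')%N.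
  by rewrite /l1 -big_split/=; apply: leq_sum => i _; rewrite coordD; clear; lia.
have up n : (n <= T)%N -> delta (y + v) + a / 2 * n%:R <= delta (y + v + e *+ n).
  elim: n => [|n IH] nT; first by rewrite mulr0 mulr0n !addr0.
  have := inc (v + e *+ n); rewrite !addrA -[y + v + e *+ n + e]addrA -mulrSr => h.
  have {}h : a / 2 <= delta (y + v + e *+ n.+1) - delta (y + v + e *+ n).
    by apply: h; apply: leq_trans (l1D _ _) _; rewrite l1_mulrn// leq_add2l ltnW.
  by have := IH (ltnW nT); rewrite -[n.+1%:R]natr1; lra.
have down n : (n <= T)%N -> delta (y + v - e *+ n) <= delta (y + v) - a / 2 * n%:R.
  elim: n => [|n IH] nT; first by rewrite mulr0 mulr0n !subr0.
  have E1 : y + (v - e *+ n.+1) = y + v - e *+ n.+1 by rewrite addrA.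
  have E2 : y + (v - e *+ n.+1) + e = y + v - e *+ n.
    by rewrite mulrSr opprD !addrA subrK.
  have h : a / 2 <= delta (y + v - e *+ n) - delta (y + v - e *+ n.+1).
    rewrite -E2 -E1; apply: inc; apply: leq_trans (l1D _ _) _.
    by rewrite l1N l1_mulrn// leq_add2l.
  by have := IH (ltnW nT); rewrite -[n.+1%:R]natr1; lra.
have := profile_lipschitz P y v; rewrite ler_norml => /andP[v1 v2].
have := up T (leqnn T); have := down T (leqnn T) => dT uT.
pose Q n := 0 < delta (y + v - e *+ T + e *+ n).
have Q2T : Q (2 * T)%N.
  rewrite /Q mul2n -addnn mulrnDr addrA subrK. lra.
have [n Qn nmin] := ex_minnP (ex_intro Q _ Q2T).
case: n Qn nmin => [|n] Qn nmin.
  by move: Qn; rewrite /Q mulr0n addr0; lra.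
exists n; split=> //; first exact: nmin.
by rewrite leNgt; apply/negP => h; have := nmin n h; rewrite ltnn.
Qed.

(** Each line in the direction of the step that increases the profile at y
    contains a boundary point. The lines are taken through a cube of side M of
    order l, and followed over a length T of order l. *)
Lemma boundary_count : exists c l0 th : R, [/\ 0 < c, 1 <= l0, 0 < th &
  forall sigma delta, 0 < sigma -> profile sigma a delta ->
  forall y l, l0 <= l -> l <= th * sigma -> int_boundary R (inside delta) y ->
  c * l ^+ d.-1 <=
  (#|` fset_set (int_boundary R (inside delta) `&` zball y l)|)%:R].
Proof.
have a0' := a0; have a1' := a1; have dR' := dR.
exists ((a / (16 * d%:R)) ^+ d.-1), (16 * d%:R / a + 8 * (4 / a + 1) + 1), (a / 2); split.
- by rewrite exprn_gt0// divr_gt0// mulr_gt0//; lra.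
- have : 0 <= 16 * d%:R / a by rewrite divr_ge0//; lra.
  have : 0 <= 4 / a by rewrite divr_ge0//; lra.
  lra.
- by rewrite divr_gt0.
move=> sigma delta s0 P y l ll ls by_.
have [dy0 dy1 _] := boundaryP P by_.
have p1 : 0 <= 16 * d%:R / a by rewrite divr_ge0//; lra.
have p2 : 0 <= 4 / a by rewrite divr_ge0//; lra.
have lp : 1 <= l by lra.
(* So small that the height varies by at most a * l / 8 over the cube, and a
   column of half-length T of order l / 4 crosses the zero level. *)
pose M := Num.truncn (a / (8 * d%:R) * l).
have epsl : 0 <= a / (8 * d%:R) * l by rewrite mulr_ge0// ?divr_ge0//; lra.
have /andP[M1 M2] : M%:R <= a / (8 * d%:R) * l < M.+1%:R by exact: truncn_itv.
have e2 : 2 <= a / (8 * d%:R) * l.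
  rewrite mulrAC ler_pdivlMr; last by rewrite mulr_gt0//; lra.
  have : 16 * d%:R <= a * l by rewrite (mulrC a) -ler_pdivrMr//; lra.
  lra.
rewrite -[M.+1%:R]natr1 in M2.
have M0 : (0 < M)%N by rewrite -(ltr0n R); lra.
clearbody M.
pose T := (Num.truncn ((2 * (d%:R * M%:R) + 4) / a)).+1.
have tT0 : 0 <= (2 * (d%:R * M%:R) + 4) / a.
  by rewrite divr_ge0 ?(ltW a0)// addr_ge0// mulr_ge0// mulr_ge0.
have /andP[T1 T2] : (Num.truncn ((2 * (d%:R * M%:R) + 4) / a))%:R <=
   (2 * (d%:R * M%:R) + 4) / a < T%:R by exact: truncn_itv.
have TE : T%:R = (Num.truncn ((2 * (d%:R * M%:R) + 4) / a))%:R + 1 :> R by rewrite natr1.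
have dM : d%:R * M%:R <= a * l / 8.
  have : d%:R * M%:R <= d%:R * (a / (8 * d%:R) * l) by rewrite ler_wpM2l.
  by rewrite (_ : d%:R * (a / _ * l) = a * l / 8)//; field; lra.
have al : a * l <= l by rewrite ler_piMl//; lra.
have T3 : T%:R <= l / 4 + 4 / a + 1.
  rewrite TE; apply: lerD => //; apply: le_trans T1 _.
  rewrite ler_pdivrMr// !mulrDl divfK ?gt_eqF//; lra_from dM.
have T4 : d%:R * M%:R + 1 < a / 2 * T%:R.
  have : (2 * (d%:R * M%:R) + 4) / a * (a / 2) < T%:R * (a / 2).
    by rewrite ltr_pM2r// divr_gt0.
  rewrite (_ : _ / a * _ = d%:R * M%:R + 2); last by field; rewrite gt_eqF.
  clear_local; lra.
have tot : d%:R * M%:R + T%:R <= l / 2 by lra_from ll p1 dM al T3.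
have asig : `|delta y| <= a * sigma by rewrite ler_norml; apply/andP; split; lra_from ls dy1 lp dy0.
have [e se he] : exists2 e, is_step e & a <= delta (y + e) - delta y.
  by case: P => _ _; exact.
have [i hi] := se.
have l1v v : (forall k, 0 <= v 0 k < M%:Z) -> (l1 v)%:R <= d%:R * M%:R :> R.
  move=> hv; rewrite -natrM ler_nat /l1.
  apply: (@leq_trans (\sum_(k < d) M)%N); last by rewrite sum_nat_const card_ord.
  apply: leq_sum => k _; move: (v 0 k) (hv k) => u hu; clear -hu; lia.
have fin : finite_set (int_boundary R (inside delta) `&` zball y l).
  by apply: sub_finite_set (finite_ball y l) => w [].
have cnt := count_columns (i := i) (y := y) M0 fin.
apply: le_trans (_ : (M ^ d.-1)%:R <= _).
  rewrite natrX -exprMn; apply: lerXn2r; rewrite ?nnegrE//.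
    by rewrite mulr_ge0 ?divr_ge0//; lra_from a0' lp.
  have : a / (8 * d%:R) * l = 2 * (a / (16 * d%:R) * l) by field; lra_from dR'.
  lra_from e2 M2.
rewrite ler_nat; apply: cnt => v vi hv; have lv := l1v v hv.
have h1 : (l1 v + T)%:R <= a / 2 * sigma by rewrite natrD; lra_from ls lp tot lv.
have h2 : (l1 v)%:R + 1 < a / 2 * T%:R by lra_from T4 lv.
have [n [nT n1 n2]] := column_crossing s0 P se he dy0 dy1 h1 h2.
set w := y + v - e *+ T + e *+ n in n1.
have [m mE] : exists m : int, - (e *+ T) + e *+ n = m *: ev i.
  case: hi => ->.
    exists (n%:Z - T%:Z); rewrite scalerBl -!scaler_nat !natz addrC//.
  exists (T%:Z - n%:Z); rewrite scalerBl -!scaler_nat !natz !scalerN opprK//.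
exists m; rewrite -mE addrA -/w; split.
  split=> //; exists (w + e); first exact: neighbor_step.
  by rewrite /inside/= /w -addrA -mulrSr; apply/negP; rewrite -ltNge.
rewrite /zball/= enormB (_ : w - y = v + (e *+ n - e *+ T)); last first.
  rewrite /w; move: (e *+ n) (e *+ T) => p q.
  by apply/rowP => k; rewrite !(coordB, coordD); ring.
apply: le_trans (enormD _ _) _.
have : enorm R (e *+ n - e *+ T) <= T%:R.
  apply: le_trans (enorm_le_l1 _) _; rewrite ler_nat.
  have [nT'|nT'] := leqP n T.
    by rewrite -{1}(subnK nT') mulrnDr opprD addrCA subrr addr0 l1N l1_mulrn// leq_subr.
  rewrite -{1}(subnK (ltnW nT')) mulrnDr addrK l1_mulrn//; clear -nT; lia.
have := enorm_le_l1 v; lra_from lp tot lv.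
Qed.

End BoundaryGeometry.

(** * Comparison of two boundary points *)

Section Separation.
Context {R : realType} {d : nat} (d3 : (3 <= d)%N).
Context (a : R) (a0 : 0 < a) (a1 : a <= 1).
Implicit Types (x y z e v w : Zd d) (l g sigma : R) (delta : Zd d -> R).

Let d0 : (0 < d)%N. Proof. by apply: leq_trans d3. Qed.
Let dR : 3 <= d%:R :> R. Proof. by rewrite ler_nat. Qed.

Local Notation kap := (@kappa R d a).

Local Tactic Notation "lra_from" hyp_list(hs) :=
  revert hs; clear - d3 a0 a1 d0 dR; intros; lra.

(** The separating set: the part outside the enlargement of a sphere of radius
    4 * l, one step thick so that paths cannot jump over it. *)
Definition shell delta y l : set (Zd d) :=
  [set x | 0 < delta x /\ 4 * l <= enorm R (x - y) <= 4 * l + 1].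

(** A path from far away is in the shell at the first time that it comes
    within distance 4 * l + 1; its end point is within distance l, hence is
    reached strictly later. *)
Lemma shell_separates delta y y' l g : 1 <= l -> enorm R (y - y') <= l ->
  4 * l + 2 <= g ->
  separates R (inside delta) (shell delta y l) [set y; y']
    (int_boundary R (zball y g)).
Proof.
move=> l1 yy lg w n [w0g [z wz zg]] wn wK Kn Tn.
have near_end : enorm R (w n - y) <= l.
  by case: Tn => ->; [rewrite subrr enorm0; lra|rewrite enormB].
have far : g - 1 < enorm R (w 0%N - y).
  move: zg; rewrite /zball/= => /negP; rewrite -ltNge => zg.
  have := enorm_tri (R := R) y (w 0%N) z; rewrite wz (enormB y (w 0%N)).
  by move: zg; lra.
pose Q k := enorm R (w k - y) <= 4 * l + 1.
have Qn : Q n by rewrite /Q; lra.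
have [k Qk kmin] := ex_minnP (ex_intro Q n Qn).
have kn : (k <= n)%N by exact: kmin.
case: k Qk kmin kn => [|k] Qk kmin kn; first by move: Qk; rewrite /Q; lra.
have Qk' : 4 * l + 1 < enorm R (w k - y).
  by rewrite ltNge; apply/negP => /kmin; rewrite ltnn.
have lo : 4 * l <= enorm R (w k.+1 - y).
  have := enorm_tri (R := R) (w k) (w k.+1) y.
  by have := wn k kn; rewrite /neighbor => ->; lra.
have kn' : (k.+1 < n)%N.
  rewrite ltn_neqAle kn andbT; apply/eqP => e.
  by move: lo; rewrite e; lra.
exists k.+1 => //; split; last by rewrite lo.
by have := wK _ kn'; rewrite /inside/= => /negP; rewrite -ltNge.
Qed.

(** A boundary Harnack principle. On the shell both hitting probabilities are
    of order (1 + delta x) * l^(-d), with l^(1-d) in place of this at heights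
    of order l, so their ratio is bounded up to the boundary. *)
Lemma srw_hit_ratio : exists C l0 th : R, [/\ 0 < C, 1 <= l0, 0 < th &
  forall sigma delta, 0 < sigma -> profile sigma a delta ->
  forall y y' l g, l0 <= l -> l <= th * sigma -> 8 * l <= 5 * g ->
  int_boundary R (inside delta) y -> int_boundary R (inside delta) y' ->
  enorm R (y - y') <= l -> forall x, shell delta y l x ->
  (srw R x (enters_at R (inside delta) y) /
   srw R x (enters_at R (inside delta) y' `&`
     enters_before R (inside delta) (~` zball y' (5 * g))) <= C%:E)%E].
Proof.
have a0' := a0; have a1' := a1.
have k8 : 8 <= kap by exact: kappa_ge8.
have [C1 C10 HU] := hit_upper d3 a0 a1.
have [C2 C20 HB] := hit_upper_boundary d3 a0 a1.
have c7 : 1 <= 7 :> R by lra.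
have [c [l0 [th [c0 l01 th0 HL]]]] := hit_lower_boundary d3 a0 a1 c7.
exists (C1 / c + 2 * C2 / (a * c)), (l0 + 8 * kap + 3), (Num.min (th / 7) (4 * kap)^-1); split.
- by rewrite addr_gt0// divr_gt0// mulr_gt0.
- by lra.
- by rewrite lt_min divr_gt0//= invr_gt0; lra.
move=> sigma delta s0 P y y' l g ll ls lg by_ by'_ yy x [dx /andP[xl1 xl2]].
have [dy0 dy1 _] := boundaryP P by_; have [dy'0 dy'1 ye'] := boundaryP P by'_.
have ls1 : l <= th / 7 * sigma.
  by apply: le_trans ls _; rewrite ler_pM2r// ge_min lexx.
have ls2 : 4 * l * kap <= sigma.
  have : l <= (4 * kap)^-1 * sigma.
    by apply: le_trans ls _; rewrite ler_pM2r// ge_min lexx orbT.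
  by rewrite ler_pdivlMl; [rewrite mulrAC (mulrC 4)|]; lra_from k8.
have lp : 0 < l by lra_from k8 l01 ll.
have xy' : enorm R (x - y') <= 5 * l + 1.
  by apply: le_trans (enorm_tri x y y') _; lra_from yy xl2.
have upper1 : hit (outside delta) y x <= C1 * l ^- (d - 1).
  apply: le_trans (HU sigma delta s0 P y x (4 * l) _ ls2 dy0 xl1) _; first by lra_from l01 ll lp.
  rewrite ler_pM2l// lef_pV2 ?posrE ?exprn_gt0 ?mulr_gt0//.
  by apply: lerXn2r; rewrite ?nnegrE; lra_from lp.
have upper2 : hit (outside delta) y x <= C2 * (2 + delta x) * l ^- d.
  apply: le_trans (HB sigma delta s0 P y x (4 * l) _ ls2 dy0 dx xl1) _; first by lra_from l01 ll.
  apply: ler_wpM2l; first by rewrite mulr_ge0//; lra_from C20 dx.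
  rewrite lef_pV2 ?posrE ?exprn_gt0 ?mulr_gt0//.
  by apply: lerXn2r; rewrite ?nnegrE; lra_from lp.
have ll0 : l0 <= l by lra_from k8 ll.
have lower := HL sigma delta s0 P x y' l (7 * l) (5 * g) ll0 (lexx _).
have {}lower := lower _ _ ye' _ dx.
have ls7 : 7 * l <= th * sigma by lra_from ls1.
have lg8 : 7 * l + l <= 5 * g by lra_from lg.
have xl : enorm R (x - y') + l + 2 <= 7 * l by lra_from k8 l01 ll xy'.
have {}lower := lower ls7 lg8 xl.
rewrite (srw_enters_at d3)//; last by apply/eqP => e; move: xl1; rewrite e subrr enorm0; lra_from lp.
rewrite (srw_enters_before d3)//; last 2 first.
- by rewrite /zball/= subrr enorm0; lra_from lp lg8.
- by apply/eqP => e; move: dx; rewrite e; lra_from dy'0.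
rewrite !setC_inside.
set H := hit _ y x in upper1 upper2 *; set k := hit _ y' x in lower *.
have ac0 : 0 < a * c by apply: mulr_gt0.
have k_gt0 : 0 < k.
  case: lower => h; apply: lt_le_trans h.
    by rewrite mulr_gt0// invr_gt0 exprn_gt0.
  by rewrite mulr_gt0 ?invr_gt0 ?exprn_gt0// mulr_gt0//; lra_from a0' dx.
rewrite inver gt_eqF// -EFinM lee_fin ler_pdivrMr//.
case: lower => h.
  have h1 : C1 / c * (c * l ^- (d - 1)) <= C1 / c * k by rewrite ler_pM2l// divr_gt0.
  have h2 : 0 <= 2 * C2 / (a * c) * k by
    rewrite mulr_ge0 ?(ltW k_gt0)// divr_ge0 ?(ltW ac0)// mulr_ge0// ltW.
  rewrite (_ : C1 / c * (c * _) = C1 * l ^- (d - 1)) in h1; last first.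
    by rewrite mulrA divfK ?gt_eqF.
  by rewrite mulrDl; lra_from upper1 h2 h1.
have h1 : 2 * C2 / (a * c) * (c * (delta x + a) * l ^- d) <= 2 * C2 / (a * c) * k.
  by rewrite ler_pM2l// divr_gt0// mulr_gt0.
have h2 : 0 <= C1 / c * k by rewrite mulr_ge0 ?(ltW k_gt0)// divr_ge0// ltW.
have h3 : C2 * (2 + delta x) * l ^- d <= 2 * C2 / (a * c) * (c * (delta x + a) * l ^- d).
  rewrite mulrA ler_pM2r ?invr_gt0 ?exprn_gt0//.
  rewrite (_ : 2 * C2 / (a * c) * _ = C2 * (2 * (delta x + a) / a)); last first.
    by field; rewrite !gt_eqF.
  rewrite ler_pM2l// ler_pdivlMr//.
  have : a * delta x <= delta x by rewrite ler_piMl// ltW.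
  lra_from dx.
by rewrite mulrDl; lra_from upper2 h1 h2 h3.
Qed.

End Separation.

(** * Smooth enlargement of a set *)

(** The cells have side r close to s / (25 d), so that the enlargement stays
    within 3 d r <= s / 5; the window has side rho close to r / (8 d), that is
    s / (200 d^2), and half of it bounds the scale sigma. The remaining factor
    2 in sigma absorbs the rounding of r and rho. *)
Lemma smooth_enlargement (R : realType) (d : nat) (s : R) (A : set (Zd d)) :
  (3 <= d)%N -> 3200 * d%:R ^+ 4 <= s ->
  exists2 delta : Zd d -> R,
    profile (1 / (800 * d%:R ^+ 2) * s) (1 / (4 * d%:R)) delta &
    A `<=` inside delta /\ inside delta `<=` zballs A (s / 5).
Proof.
move=> d3 s_big.
have d0 : (0 < d)%N by apply: leq_trans d3.
have dR : 3 <= d%:R :> R by rewrite ler_nat.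
pose D : R := d%:R; rewrite -/D in s_big dR *.
have D2 : 9 <= D ^+ 2 by rewrite expr2; nra.
have D4 : D ^+ 4 = D ^+ 2 * D ^+ 2 by ring.
have D40 : 9 * D ^+ 2 <= D ^+ 4 by rewrite D4 ler_pM2r//; lra.
have s0 : 0 < s by lra.
pose r := Num.truncn (s / (25 * D)); pose rho := (r %/ (8 * d))%N.
have sD : 0 <= s / (25 * D) by rewrite divr_ge0// ?mulr_ge0//; lra.
have /andP[r1 r2] : r%:R <= s / (25 * D) < r.+1%:R by exact: truncn_itv.
rewrite -[r.+1%:R]natr1 in r2.
have rho1 : (8 * d * rho <= r)%N by rewrite mulnC leq_divM.
have rho2 : r%:R < 8 * D * (rho%:R + 1).
  have : (r < rho.+1 * (8 * d))%N by apply: ltn_ceil; rewrite muln_gt0.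
  by rewrite -(ltr_nat R) !natrM -[rho.+1%:R]natr1 -/D mulrC.
have sr : s < 25 * D * (8 * D * (rho%:R + 1) + 1).
  by rewrite (mulrC (25 * D)) -ltr_pdivrMr ?mulr_gt0//; clear -r2 rho2 dR; lra.
have srho : s <= 200 * D ^+ 2 * rho%:R + 300 * D ^+ 2.
  have : 25 * D <= 100 * D ^+ 2 by rewrite expr2; clear -D40; nra.
  by move: sr; rewrite expr2; nra.
pose sigma := 1 / (800 * D ^+ 2) * s.
pose E := D ^+ 2; have E0 : 0 < E by apply: lt_le_trans D2.
have E8 : 0 < 800 * E by apply: mulr_gt0 E0; rewrite ltr0n.
have sigmaE : sigma * (800 * E) = s by rewrite /sigma -/E; field; rewrite gt_eqF.
have sE : 3200 * (E * E) <= s by rewrite -D4.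
have E9 : E * 9 <= E * E by rewrite ler_pM2l.
have sig2 : 2 * sigma <= rho%:R.
  rewrite -(ler_pM2r E8) -mulrA sigmaE.
  by move: srho; rewrite -/E; clear -sE E9 E0 dR; lra.
have sig4 : 4 * E <= sigma.
  by rewrite -(ler_pM2r E8) sigmaE; clear -sE; lra.
have rho0 : (0 < rho)%N.
  by rewrite -(ltr0n R); clear -sig2 sig4 E0; lra.
have [delta P [inA near_A]] := exists_profile d0 rho0 rho1 sig2 sig4 A.
exists delta => //; split=> x; first exact: inA.
move=> /near_A[b Ab xb]; exists b => //; rewrite /zball/= enormB.
apply: le_trans xb _; rewrite -/D.
have : D * (3 * r%:R) <= D * (3 * (s / (25 * D))) by rewrite ler_wpM2l ?ler_wpM2l//; lra.
have -> : D * (3 * (s / (25 * D))) = 3 / 25 * s by field; clear -dR; lra.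
by clear -s0; lra.
Qed.

Theorem proposition6p1 (R : realType) (d : nat) (hd : (3 <= d)%N) :
  exists gamma c1 c2 c3 c4 s0 : R,
    [/\ 0 < gamma, gamma < 1 / 10, 0 < c1, 0 < c2 & c2 < gamma / 2] /\
    [/\ 0 < c3, 0 < c4 & 0 < s0] /\
    forall (s : R) (A : set (Zd d)), s0 <= s -> ~` zballs A s !=set0 ->
    exists As : set (Zd d),
      (A `<=` As /\ As `<=` zballs A (s / 5)) /\
      (forall y, int_boundary R As y ->
        (ereal_sup [set srw R x (enters_at R As y)
                   | x in [set x | (gamma * s / 2 <= enorm R (x - y))%R]]
         <= (c1 * s ^- d.-1)%:E)%E) /\
      (forall y, int_boundary R As y ->
        exists z : Zd d,
          gamma * s <= zdist R y (zball z (gamma * s)) <= 2 * gamma * s /\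
          ((c1^-1 * s ^- d.-1)%:E <=
           ereal_inf [set srw R x (enters_at R As y `&`
                        enters_before R As (~` zball y (4 * gamma * s)%R))
                     | x in zball z (gamma * s)%R])%E) /\
      (forall y, int_boundary R As y ->
        c3 * s ^+ d.-1 <=
        (#|` fset_set (int_boundary R As `&` zball y (c2 * s))|)%:R) /\
      (forall y y', int_boundary R As y -> int_boundary R As y' ->
        enorm R (y - y') <= c2 * s ->
        exists D : set (Zd d),
          separates R As D [set y; y']
            (int_boundary R (zball y (gamma * s))) /\
          (ereal_sup [set srw R x (enters_at R As y) /
                          srw R x (enters_at R As y' `&`
                            enters_before R As (~` zball y' (5 * gamma * s)%R))
                     | x in D `&` [set x | (0 < srw R x (enters_at R As y'))%E]]
           <= c4%:E)%E).
Proof.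
have d0 : (0 < d)%N by apply: leq_trans hd.
have dR : 3 <= d%:R :> R by rewrite ler_nat.
pose a : R := 1 / (4 * d%:R); pose beta : R := 1 / (800 * d%:R ^+ 2).
have a0 : 0 < a by rewrite divr_gt0// mulr_gt0//; lra.
have a1 : a <= 1 by rewrite ler_pdivrMr ?mulr_gt0//; lra.
have d2 : 9 <= d%:R ^+ 2 :> R by rewrite expr2; nra.
have d2p : 0 < 800 * d%:R ^+ 2 :> R.
  by apply: mulr_gt0; [rewrite ltr0n|apply: lt_le_trans d2; rewrite ltr0n].
have beta0 : 0 < beta by rewrite /beta div1r invr_gt0.
have beta1 : beta <= 1 by rewrite /beta ler_pdivrMr// mul1r; lra.
have k8 : 8 <= @kappa R d a by exact: kappa_ge8.
have [Cb Cb0 Hb] := srw_hit_upper hd a0 a1.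
have [cc [gc [thc [cc0 gc1 thc0 Hc]]]] := srw_hit_lower hd a0 a1.
have [cd [ld [thd [cd0 ld1 thd0 Hd]]]] := boundary_count hd a0 a1.
have [Ce [le_ [the [Ce0 le1 the0 He]]]] := srw_hit_ratio hd a0 a1.
set kap := kappa a in k8 Hb.
(* gam' and c2' measure radii in units of sigma = beta * s, the scale of the
   profile, and gamma and c2 measure them in units of s. *)
pose gam' := Num.min thc (Num.min kap^-1 (1 / 20)).
have gam'0 : 0 < gam'.
  by rewrite !lt_min thc0 /= invr_gt0; apply/andP; split; clear -k8; lra.
have gam'c : gam' <= thc by rewrite ge_min lexx.
have gam'k : gam' <= kap^-1 by rewrite !ge_min lexx orbT.
have gam'20 : gam' <= 1 / 20 by rewrite !ge_min lexx !orbT.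
pose c2' := Num.min thd (Num.min the (gam' / 16)).
have c2'0 : 0 < c2' by rewrite !lt_min thd0 the0 divr_gt0.
have c2'd : c2' <= thd by rewrite ge_min lexx.
have c2'e : c2' <= the by rewrite !ge_min lexx orbT.
have c2'g : c2' <= gam' / 16 by rewrite !ge_min lexx !orbT.
clearbody gam' c2'.
pose gamma := gam' * beta; pose c2 := c2' * beta.
have gamma0 : 0 < gamma by apply: mulr_gt0.
have c20 : 0 < c2 by apply: mulr_gt0.
have gamma20 : gamma <= 1 / 20.
  by apply: le_trans gam'20; rewrite /gamma ler_piMr// ltW.
have c2g : c2 <= gamma / 16.
  by rewrite /c2 /gamma mulrAC ler_pM2r.
pose c1 := Cb * (gamma / 2) ^- (d - 1) + cc^-1.
have c10 : 0 < c1.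
  by rewrite addr_gt0 ?invr_gt0// mulr_gt0// invr_gt0 exprn_gt0// divr_gt0.
exists gamma, c1, c2, (cd * c2 ^+ d.-1), Ce,
  (3200 * d%:R ^+ 4 + (gc + 32 * kap + 4) / gamma + (ld + le_) / c2).
have q1 : 0 < (gc + 32 * kap + 4) / gamma by rewrite divr_gt0//; clear -gc1 k8; lra.
have q2 : 0 < (ld + le_) / c2 by rewrite divr_gt0//; clear -ld1 le1; lra.
have q3 : 0 <= 3200 * d%:R ^+ 4 :> R.
  by apply: mulr_ge0; [rewrite ler0n|apply: exprn_ge0; rewrite ler0n].
split; first by split; [exact: gamma0|clear -gamma20; lra|exact: c10|exact: c20|clear -c2g gamma0; lra].
split; first by split; [apply: mulr_gt0 => //; exact: exprn_gt0|exact: Ce0|clear -q1 q2 q3; lra].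
move=> s A s_ge _.
have s_big : 3200 * d%:R ^+ 4 <= s by clear -s_ge q1 q2; lra.
have sp : 0 < s by clear -s_ge q1 q2 q3; lra.
pose sigma := beta * s; have sigma0 : 0 < sigma by apply: mulr_gt0.
pose g := gamma * s.
have gE : g = gam' * sigma by rewrite /g /gamma /sigma -mulrA.
have g_big : gc + 32 * kap + 4 <= g.
  by rewrite /g (mulrC gamma) -ler_pdivrMr//; clear -s_ge q2 q3; lra.
have c2E : c2 * s = c2' * sigma by rewrite /c2 /sigma -mulrA.
have c2_big : ld + le_ <= c2 * s.
  by rewrite (mulrC c2) -ler_pdivrMr//; clear -s_ge q1 q3; lra.
have c2s : c2 * s <= g / 16.
  by rewrite (_ : g / 16 = gamma / 16 * s); [rewrite ler_pM2r|rewrite /g; ring].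
clearbody c2 gamma.
have g0 : 0 < g by apply: mulr_gt0.
clear s_ge q1 q2 q3.
have [delta P [inA nearA]] := smooth_enlargement A hd s_big.
rewrite -/a -/beta -/sigma in P.
exists (inside delta); split; first exact: (conj inA nearA).
have d1E : (d.-1 = d - 1)%N by rewrite subn1.
split; [|split; [|split]].
- move=> y by_; apply: ge_ereal_sup => _ [x xy <-].
  have xg : g / 2 <= enorm R (x - y) by exact: xy.
  have g2k : g / 2 * kap <= sigma.
    have : gam' * sigma * kap <= kap^-1 * sigma * kap by rewrite !ler_pM2r//; clear -k8; lra.
    rewrite -gE (_ : kap^-1 * sigma * kap = sigma); first by clear -sigma0; nra.
    by field; clear -k8; lra.
  apply: le_trans (Hb sigma delta sigma0 P y x (g / 2) _ g2k by_ xg) _; first by clear -gc1 g_big; lra.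
  rewrite lee_fin d1E (_ : Cb * (g / 2) ^- (d - 1) =
    Cb * (gamma / 2) ^- (d - 1) * s ^- (d - 1)); last first.
    by rewrite /g mulrAC exprMn invfM mulrA.
  by rewrite ler_pM2r ?invr_gt0 ?exprn_gt0// lerDl invr_ge0 ltW.
- move=> y by_.
  have gcg : gc <= g by clear -k8 g_big; lra.
  have gth : g <= thc * sigma by rewrite gE ler_pM2r.
  have [z [z1 z2 z3]] := Hc sigma delta sigma0 P y g gcg gth by_.
  exists z; rewrite -!mulrA -/g z1 z2; split=> //.
  apply: le_ereal_inf_tmp => _ [x xz <-]; apply: le_trans (z3 x xz).
  rewrite lee_fin d1E /g exprMn invfM mulrA ler_pM2r ?invr_gt0 ?exprn_gt0//.
  have c1cc : cc^-1 <= c1.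
    by rewrite lerDr mulr_ge0 ?(ltW Cb0)// invr_ge0 exprn_ge0// divr_ge0// ltW.
  have g1 : 1 <= (gamma ^+ (d - 1))^-1.
    rewrite -exprVn exprn_ege1// -[leLHS]invr1 lef_pV2 ?posrE//; clear -gamma20; lra.
  apply: (@le_trans _ _ cc); last by rewrite ler_peMr// ltW.
  by rewrite -[leRHS]invrK lef_pV2 ?posrE ?invr_gt0.
- move=> y by_; rewrite -mulrA -exprMn.
  by apply: (Hd sigma delta) => //; [clear -le1 c2_big; lra|rewrite c2E ler_pM2r].
move=> y y' by_ by'_ yy.
(* The shell is taken at the scale of the distance between the two points, but
   no smaller than the scale from which the estimates hold. *)
pose l := Num.max (enorm R (y - y')) le_.
have l_le : l <= c2 * s by rewrite ge_max yy/=; clear -ld1 c2_big; lra.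
have yl : enorm R (y - y') <= l by rewrite le_max lexx.
have lel : le_ <= l by rewrite le_max lexx orbT.
clearbody l.
exists (shell delta y l); split.
  by apply: shell_separates => //; rewrite -?/g; clear -le1 lel c2s l_le; lra.
apply: ge_ereal_sup => _ [x [xD _] <-]; rewrite -!mulrA -/g.
apply: (He sigma delta sigma0 P y y' l g) => //; last by clear -c2s g0 l_le; lra.
by apply: le_trans l_le _; rewrite c2E ler_pM2r.
Qed.
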